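(* Let $2<q<\infty$ and $1<\rho<\infty$. (i) Let $1<p<\infty$ and $w\in A_p^+$. Then there is a constant $C$ such that for any finite sequence $\{f_k\}_{k\ge1}\subset\ell^p(\mathbb{Z},w)$ $$\sum_{n\in\mathbb{Z}}\Big(\sum_{k\ge1}\big(\mathcal{V}_q\mathcal{A}^+(f_k)(n)\big)^\rho\Big)^{p/\rho}w(n)\le C\sum_{n\in\mathbb{Z}}\Big(\sum_{k\ge1}|f_k(n)|^\rho\Big)^{p/\rho}w(n).$$ (ii) Let $w\in A_1^+$. Then there is a constant $C$ such that for any finite sequence $\{f_k\}_{k\ge1}\subset\ell^1(\mathbb{Z},w)$ and any $\lambda>0$ $$w\Big(\Big\{n\in\mathbb{Z}:\sum_{k\ge1}\big(\mathcal{V}_q\mathcal{A}^+(f_k)(n)\big)^\rho>\lambda^\rho\Big\}\Big)\le\frac{C}{\lambda}\sum_{n\in\mathbb{Z}}\Big(\sum_{k\ge1}|f_k(n)|^\rho\Big)^{1/\rho}w(n).$$ In both parts $C$ does not depend on the sequence $\{f_k\}$ (in particular not on its length) nor on $\lambda$.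
   Context: For a complex-valued function $f$ on $\mathbb{Z}$ and an integer $N\ge0$, $A_N^+(f)(n)=\frac{1}{N+1}\sum_{i=0}^N f(n+i)$, and $\mathcal{A}^+(f)(n)=\{A_N^+(f)(n)\}_{N\ge0}$. For a sequence $a=\{a_N\}_{N\ge0}$ of complex numbers, $\|a\|_{v_q}=\sup\big(\sum_{j=0}^\infty|a_{N_j}-a_{N_{j+1}}|^q\big)^{1/q}$, the supremum running over all increasing sequences $\{N_j\}$ of nonnegative integers. $\mathcal{V}_q\mathcal{A}^+(f)(n)=\|\mathcal{A}^+(f)(n)\|_{v_q}$. Weights on $\mathbb{Z}$ are positive functions; $w(E)=\sum_{n\in E}w(n)$; $\ell^p(\mathbb{Z},w)$ is the space of $f$ with $\sum_n|f(n)|^pw(n)<\infty$. $w\in A_1^+$ if there is a constant $C$ with $\sum_{i=n-k}^{n}w(i)\le C(k+1)\min\{w(i):i\in[n,n+k]\}$ for all $n\in\mathbb{Z}$, $k\ge0$. $w\in A_p^+$ ($1<p<\infty$) if there is a constant $C$ with $\sum_{i=0}^k w(n+i)\,\big(\sum_{i=k}^{2k}w(n+i)^{-\frac1{p-1}}\big)^{p-1}\le C(k+1)^p$ for all $n\in\mathbb{Z}$, $k\ge0$. *)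

(* Defs.v *)
From mathcomp Require Import all_boot all_order all_algebra.
From mathcomp Require Import all_classical all_reals all_analysis.
From mathcomp Require Import complex.

Set Implicit Arguments.
Unset Strict Implicit.
Unset Printing Implicit Defensive.
Import Order.TTheory GRing.Theory Num.Theory.

Local Open Scope classical_set_scope.
Local Open Scope complex_scope.
Local Open Scope ring_scope.

(* The norm of R[i] provided by MathComp takes its values in R[i]; [cabs] is
   the same modulus as an element of R. *)
Definition cabs (R : realType) (z : R[i]) : R := ComplexField.Normc.normc z.

Definition avg_plus (R : realType) (f : int -> R[i]) (n : int) (N : nat) :
    R[i] :=
  (N.+1%:R)^-1 * \sum_(0 <= i < N.+1) f (n + i%:Z).

(* Extended-real valued: the q-variation of a sequence may be infinite. *)
Definition vnorm (R : realType) (q : R) (a : nat -> R[i]) : \bar R :=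
  ereal_sup [set ((\sum_(0 <= j <oo)
                     (cabs (a (N j) - a (N j.+1)) `^ q)%:E) `^ q^-1)%E
            | N in [set N : nat -> nat | {homo N : i j / (i < j)%N}]].

Definition var_avg_plus (R : realType) (q : R) (f : int -> R[i]) (n : int) :
    \bar R :=
  vnorm q (avg_plus f n).

Definition weight (R : realType) (w : int -> R) : Prop := forall n, 0 < w n.

Definition wmeas (R : realType) (w : int -> R) (E : set int) : \bar R :=
  \esum_(n in E) (w n)%:E.

Definition in_lp (R : realType) (p : R) (w : int -> R) (f : int -> R[i]) :
    Prop :=
  (\esum_(n in [set: int]) (cabs (f n) `^ p * w n)%:E < +oo)%E.

Definition A1_plus (R : realType) (w : int -> R) : Prop :=
  exists C : R, forall (n : int) (k : nat),
    \sum_(0 <= i < k.+1) w (n - k%:Z + i%:Z) <=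
      C * k.+1%:R * \big[Num.min/w n]_(0 <= i < k.+1) w (n + i%:Z).

Definition Ap_plus (R : realType) (p : R) (w : int -> R) : Prop :=
  exists C : R, forall (n : int) (k : nat),
    (\sum_(0 <= i < k.+1) w (n + i%:Z)) *
    (\sum_(k <= i < (2 * k).+1) w (n + i%:Z) `^ (- (p - 1)^-1)) `^ (p - 1) <=
      C * k.+1%:R `^ p.

(* Main.v *)
(* All estimates are proved for real functions on the natural numbers vanishing from some
   point on, with constants independent of the window, and transferred to the integers at
   the end by translation, truncation and passage to the limit.

   Scalar unweighted case. With [j(N)] the integer part of [log2 (N + 1)], the q-variation
   of the averages is at most that of the dyadic martingale [E_j f], which is of weak type
   (2,2) by a greedy count of jumps (Lepingle), plus the 2-variation of
   [A_N f - E_j(N) f], which is bounded on l^2 by decomposing [f] into martingale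
   differences: the part at distance [s] from the scale [j(N)] has norm at most
   [C 2^(-s/2)].

   Vector-valued weighted case. An unweighted weak type gives weak type (1,1) by a
   Calderon-Zygmund decomposition along the rising sun set of the one-sided maximal
   function, hence all small exponents by interpolation. A one-sided good-lambda
   inequality, on Whitney pieces of the level sets and with the one-sided reverse Hoelder
   inequality, then gives weighted weak types around every [p] with [w] in [A_p^+], which
   is an open condition. This is used twice: first to get the scalar unweighted l^rho
   bound, which is trivially vector-valued, and then to reach all [p] and [w]. The
   weighted weak type (1,1) is the Calderon-Zygmund decomposition again, now for an
   [A_1^+] weight. *)

Require Import Defs.
From mathcomp Require Import all_boot all_order all_algebra.
From mathcomp Require Import all_classical all_reals all_analysis.
From mathcomp Require Import complex.
From mathcomp Require Import ring lra zify.
Set Implicit Arguments.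
Unset Strict Implicit.
Unset Printing Implicit Defensive.
Import Order.TTheory GRing.Theory Num.Theory.
Local Open Scope classical_set_scope.
Local Open Scope complex_scope.
Local Open Scope ring_scope.
#[local] Hint Extern 0 (is_true (0 <= _)) => exact: powR_ge0 : core.
#[local] Hint Extern 0 (is_true (0 <= _)) => apply: ltW; assumption : core.

(** The good-lambda step from an unweighted weak type at exponent [r] involves the maximal function
    of [r]-th powers, so it reaches an exponent [P] only for weights of class [P / r]. Hence the
    exponent must first be pushed down near 1, and openness of the weight class is what leaves room
    for some [r > 1] with [s r < p]. A vector-valued starting point is available only at exponent
    [rho], where the sums over [k] and over the points commute; this explains the detour through a
    scalar bound at that exponent. Variations are bounded by additive control functions, whose total
    growth dominates the sum of the [t]-th powers of the increments. For a quotient [S N / N.+1],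
    time is cut into blocks of length at most [d], at times at least [d], on which [S] has size and
    total variation at most [h]; the cost is the sum of [(h / d) ^ t]. In the Calderon-Zygmund and
    good-lambda parts [t > 1] makes this sum converge over distant blocks. The condition [q > 2]
    enters through the geometric series of [2 ^ (- l (q - 2))] over the jump sizes
    [2 ^ (- l) lam]. *)

Lemma eq_le (R : realType) (x y : R) : x = y -> x <= y. Proof. by move=> ->. Qed.
#[local] Opaque powR expR ln sup.
Ltac nlia := repeat match goal with
  | H : is_true (@Order.le _ _ _ _) |- _ => clear H
  | H : is_true (@Order.lt _ _ _ _) |- _ => clear H
  | H : @eq (Real.sort _) _ _ |- _ => clear H
  | H : forall _, _ |- _ => clear H
  | x := _ : ?T |- _ => lazymatch T with nat => fail | _ => clearbody x end
  end; lia.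

(** * Powers and finite norms *)

Section PowerInequalities.
Variable R : realType.
Implicit Types x y z p q t a b : R.

Lemma le_powR p x y : 0 <= p -> 0 <= x -> x <= y -> x `^ p <= y `^ p.
Proof.
by move=> p0 x0 xy; apply: ge0_ler_powR => //; rewrite nnegrE// (le_trans x0).
Qed.

Lemma lt_powR p x y : 0 < p -> 0 <= x -> x < y -> x `^ p < y `^ p.
Proof.
by move=> p0 x0 xy; apply: gt0_ltr_powR => //; rewrite nnegrE// (le_trans x0)// ltW.
Qed.

Lemma powRK p x : p != 0 -> 0 <= x -> (x `^ p) `^ p^-1 = x.
Proof. by move=> p0 x0; rewrite -powRrM divff// powRr1. Qed.

Lemma powRVK p x : p != 0 -> 0 <= x -> (x `^ p^-1) `^ p = x.
Proof. by move=> p0 x0; rewrite -powRrM mulVf// powRr1. Qed.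

Lemma powR_le_root p x y : 0 < p -> 0 <= x -> 0 <= y -> x <= y `^ p -> x `^ p^-1 <= y.
Proof.
move=> p0 x0 y0 xy; rewrite -[leRHS](@powRK p) ?gt_eqF//.
by apply: le_powR => //; rewrite invr_ge0 ltW.
Qed.

Lemma root_le_powR p x y : 0 < p -> 0 <= x -> x `^ p^-1 <= y -> x <= y `^ p.
Proof.
move=> p0 x0 xy; rewrite -[leLHS](@powRVK p) ?gt_eqF//.
exact: le_powR.
Qed.

Lemma powR_div p x y : 0 <= x -> 0 <= y -> (x / y) `^ p = x `^ p / y `^ p.
Proof.
by move=> x0 y0; rewrite powRM ?invr_ge0// -(powR_inv1 y0) -powRrM mulN1r powRN.
Qed.

Lemma powR_superadd p x y : 1 <= p -> 0 <= x -> 0 <= y ->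
  x `^ p + y `^ p <= (x + y) `^ p.
Proof.
move=> p1 x0 y0; have p0 : 0 < p by lra.
rewrite -!(@mulr_powRB1 _ _ p) ?addr_ge0// mulrDl lerD//.
- by apply: ler_wpM2l => //; apply: le_powR => //; lra.
- by apply: ler_wpM2l => //; apply: le_powR => //; lra.
Qed.

Lemma powR_sub_le p x y : 1 <= p -> 0 <= x -> x <= y ->
  (y - x) `^ p <= y `^ p - x `^ p.
Proof.
move=> p1 x0 xy; have := @powR_superadd p x (y - x) p1 x0.
by rewrite subr_ge0 => /(_ xy); rewrite subrKC; lra.
Qed.

Lemma powR_add_le p x y : 0 <= p -> 0 <= x -> 0 <= y ->
  (x + y) `^ p <= 2 `^ p * (x `^ p + y `^ p).
Proof.
move=> p0 x0 y0; wlog xy : x y x0 y0 / x <= y.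
  move=> H; have [/H|/ltW /H] := leP x y; first exact.
  by rewrite addrC [y `^ p + _]addrC; exact.
apply: (@le_trans _ _ ((2 * y) `^ p)).
  by apply: le_powR => //; [exact: addr_ge0 | lra].
rewrite powRM// ler_wpM2l ?powR_ge0//; have := powR_ge0 x p; lra.
Qed.

Lemma powR_subadd p x y : 0 < p -> p <= 1 -> 0 <= x -> 0 <= y ->
  (x + y) `^ p <= x `^ p + y `^ p.
Proof.
move=> p0 p1 x0 y0; rewrite -{1}[x](@powRK p) ?gt_eqF// -{1}[y](@powRK p) ?gt_eqF//.
rewrite -[leRHS](@powRVK p) ?gt_eqF ?addr_ge0 ?powR_ge0//.
apply: le_powR; [exact: ltW | by rewrite addr_ge0 ?powR_ge0|].
by apply: powR_superadd; rewrite ?powR_ge0// invf_ge1.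
Qed.

Lemma powR_convex p x y t : 1 <= p -> 0 <= x -> 0 <= y -> 0 <= t -> t <= 1 ->
  (t * x + (1 - t) * y) `^ p <= t * x `^ p + (1 - t) * y `^ p.
Proof.
move=> p1 x0 y0 t0 t1.
have := @convex_powR R p p1 (Itv01 t0 t1) x y.
rewrite !inE /= !in_itv /= x0 y0 => /(_ isT isT).
by rewrite !convRE.
Qed.

End PowerInequalities.

Section FiniteNorms.
Variables (R : realType) (I : Type) (r : seq I).
Implicit Types (u v : I -> R) (p q : R).

Definition lnorm p u : R := (\sum_(i <- r) `|u i| `^ p) `^ p^-1.

Lemma sum_powR_ge0 p u : 0 <= \sum_(i <- r) `|u i| `^ p.
Proof. by apply: sumr_ge0 => i _; exact: powR_ge0. Qed.

Lemma lnorm_ge0 p u : 0 <= lnorm p u.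
Proof. exact: powR_ge0. Qed.

Lemma lnorm_powR p u : p != 0 -> lnorm p u `^ p = \sum_(i <- r) `|u i| `^ p.
Proof. by move=> p0; rewrite /lnorm powRVK// sum_powR_ge0. Qed.

Lemma lnorm_le p u v : 0 < p -> (forall i, `|u i| <= `|v i|) -> lnorm p u <= lnorm p v.
Proof.
move=> p0 uv; apply: le_powR; rewrite ?invr_ge0 ?sum_powR_ge0//.
by apply: ler_sum => i _; apply: le_powR => //; exact: ltW.
Qed.

Lemma eq_lnorm p u v : u =1 v -> lnorm p u = lnorm p v.
Proof. by move=> uv; rewrite /lnorm; under eq_bigr do rewrite uv. Qed.

Lemma lnormN p u : lnorm p (fun i => - u i) = lnorm p u.
Proof. by rewrite /lnorm; under eq_bigr do rewrite normrN. Qed.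

Lemma lnorm_abs p u : lnorm p (fun i => `|u i|) = lnorm p u.
Proof. by rewrite /lnorm; under eq_bigr do rewrite normr_id. Qed.

Lemma lnormZ p c u : p != 0 -> lnorm p (fun i => c * u i) = `|c| * lnorm p u.
Proof.
move=> p0; rewrite /lnorm.
under eq_bigr do rewrite normrM powRM//.
rewrite -mulr_sumr powRM ?powR_ge0 ?sum_powR_ge0//.
by rewrite powRK.
Qed.

Lemma lnorm0 p : p != 0 -> lnorm p (fun=> 0) = 0.
Proof.
move=> p0; rewrite /lnorm big1 ?powR0 ?invr_eq0// => i _.
by rewrite normr0 powR0.
Qed.

(** Minkowski's inequality by convexity: [u + v] is [a + b] times a convex combination of [u / a]
    and [v / b]. With positive upper bounds [a], [b] in place of the norms, a zero norm is no
    special case; [lnormD] lets the excess tend to 0. *)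
Let lnormD_aux p u v a b : 1 <= p -> 0 < a -> 0 < b ->
  \sum_(i <- r) `|u i| `^ p <= a `^ p -> \sum_(i <- r) `|v i| `^ p <= b `^ p ->
  \sum_(i <- r) `|u i + v i| `^ p <= (a + b) `^ p.
Proof.
move=> p1 a0 b0 ua vb; have ab0 : 0 < a + b by exact: addr_gt0.
have p0 : 0 <= p by lra.
pose th := a / (a + b).
have th0 : 0 <= th by rewrite divr_ge0// ltW.
have th1 : th <= 1 by rewrite ler_pdivrMr// mul1r; lra.
have thE : 1 - th = b / (a + b) by rewrite /th; field; rewrite gt_eqF.
have ap0 : 0 < a `^ p by exact: powR_gt0.
have bp0 : 0 < b `^ p by exact: powR_gt0.
have step i : `|u i + v i| `^ p <= (a + b) `^ p *
    (th * (`|u i| `^ p / a `^ p) + (1 - th) * (`|v i| `^ p / b `^ p)).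
  rewrite -!powR_div//.
  apply: le_trans (ler_wpM2l (powR_ge0 _ _) (@powR_convex _ p _ _ th p1 _ _ th0 th1));
    last 2 first.
  - by rewrite divr_ge0// ltW.
  - by rewrite divr_ge0// ltW.
  rewrite -powRM ?(ltW ab0)//; last first.
    by rewrite addr_ge0// mulr_ge0 ?divr_ge0 ?subr_ge0// ltW.
  apply: le_powR => //; rewrite thE.
  have -> : (a + b) * (th * (`|u i| / a) + b / (a + b) * (`|v i| / b)) = `|u i| + `|v i|.
    by rewrite /th; field; rewrite !gt_eqF.
  exact: ler_normD.
apply: (le_trans (ler_sum _ (fun i _ => step i))).
rewrite -mulr_sumr -[leRHS]mulr1 ler_wpM2l ?powR_ge0//.
rewrite big_split /= -!mulr_sumr -!mulr_suml.
have : th * ((\sum_(i <- r) `|u i| `^ p) / a `^ p) <= th * 1.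
  by rewrite ler_wpM2l// ler_pdivrMr// mul1r.
have : (1 - th) * ((\sum_(i <- r) `|v i| `^ p) / b `^ p) <= (1 - th) * 1.
  by rewrite ler_wpM2l ?subr_ge0// ler_pdivrMr// mul1r.
by lra.
Qed.

Lemma lnormD p u v : 1 <= p -> lnorm p (fun i => u i + v i) <= lnorm p u + lnorm p v.
Proof.
move=> p1; have p0 : 0 < p by lra.
apply/ler_addgt0Pr => e e0; have e20 : 0 < e / 2 by lra.
rewrite [in leRHS](splitr e) addrACA.
have H w : \sum_(i <- r) `|w i| `^ p <= (lnorm p w + e / 2) `^ p.
  apply: root_le_powR => //; first exact: sum_powR_ge0.
  by rewrite lerDl.
apply: powR_le_root => //; first exact: sum_powR_ge0.
  by rewrite !addr_ge0 ?lnorm_ge0 ?(ltW e20).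
by apply: lnormD_aux => //; apply: ltr_wpDl => //; exact: lnorm_ge0.
Qed.

Lemma lnorm_sum (J : Type) (s : seq J) (P : pred J) p (F : J -> I -> R) : 1 <= p ->
  lnorm p (fun i => \sum_(j <- s | P j) F j i) <= \sum_(j <- s | P j) lnorm p (F j).
Proof.
move=> p1; elim: s => [|j s IH].
  rewrite big_nil (@eq_lnorm _ _ (fun=> 0)); last by move=> i; rewrite big_nil.
  by rewrite lnorm0// gt_eqF//; lra.
rewrite big_cons; case: ifPn => Pj; last first.
  rewrite (@eq_lnorm _ _ (fun i => \sum_(j <- s | P j) F j i))//.
  by move=> i; rewrite big_cons (negPf Pj).
rewrite (@eq_lnorm _ _ (fun i => F j i + \sum_(j <- s | P j) F j i)); last first.
  by move=> i; rewrite big_cons Pj.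
by apply: (le_trans (lnormD _ _ p1)); rewrite lerD2l.
Qed.

Lemma sum_mul_le_lnorm p q u v : 0 < p -> 0 < q -> p^-1 + q^-1 = 1 ->
  \sum_(i <- r) `|u i| * `|v i| <= lnorm p u * lnorm q v.
Proof.
move=> p0 q0 pq.
have aux a b : 0 < a -> 0 < b -> \sum_(i <- r) `|u i| `^ p <= a `^ p ->
    \sum_(i <- r) `|v i| `^ q <= b `^ q -> \sum_(i <- r) `|u i| * `|v i| <= a * b.
  move=> a0 b0 ua vb.
  have step i : `|u i| * `|v i| <= a * b * (`|u i| `^ p / (a `^ p * p) +
                                       `|v i| `^ q / (b `^ q * q)).
    have := @conjugate_powR R (`|u i| / a) (`|v i| / b) p q.
    rewrite !divr_ge0 ?(ltW a0) ?(ltW b0)// => /(_ isT isT p0 q0 pq).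
    rewrite !powR_div// !invfM !mulrA => H.
    have ab0 : 0 < a * b by exact: mulr_gt0.
    rewrite -(@ler_pM2l _ (a * b)) in H => //.
    by apply: le_trans H; rewrite le_eqVlt; apply/orP; left; apply/eqP; field;
       rewrite !gt_eqF.
  apply: (le_trans (ler_sum _ (fun i _ => step i))).
  rewrite -mulr_sumr -[leRHS]mulr1 ler_wpM2l ?(mulr_ge0 (ltW a0) (ltW b0))//.
  rewrite big_split /= -!mulr_suml -pq lerD//.
  - by rewrite ler_pdivrMr ?mulr_gt0 ?powR_gt0// mulrCA mulVf ?gt_eqF// mulr1.
  - by rewrite ler_pdivrMr ?mulr_gt0 ?powR_gt0// mulrCA mulVf ?gt_eqF// mulr1.
apply: (@le_trans _ _ (\sum_(i <- r) `|u i| * `|v i|)) => //.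
have H w s e : 0 < s -> 0 < e -> \sum_(i <- r) `|w i| `^ s <= (lnorm s w + e) `^ s.
  move=> s0 e0; apply: root_le_powR => //; first exact: sum_powR_ge0.
  by rewrite lerDl.
set A := lnorm p u; set B := lnorm q v.
have A0 : 0 <= A by exact: lnorm_ge0.
have B0 : 0 <= B by exact: lnorm_ge0.
apply/ler_addgt0Pr => e e0.
(* Since [d <= 1], [(A + d) (B + d) - A B = d (A + B + d)] is at most [d (A + B + 1) <= e]. *)
pose d := Num.min 1 (e / (A + B + 1)).
have d0 : 0 < d by rewrite lt_min ltr01 divr_gt0//; lra.
have d1 : d <= 1 by rewrite ge_min lexx.
have d2 : d * (A + B + 1) <= e.
  by rewrite -ler_pdivlMr ?ge_min ?lexx ?orbT//; lra.
apply: (le_trans (aux (A + d) (B + d) _ _ (H _ _ _ p0 d0) (H _ _ _ q0 d0))); try lra.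
nra.
Qed.

Lemma powR_sum_le p u : 1 <= p ->
  (\sum_(i <- r) `|u i|) `^ p <= (size r)%:R `^ (p - 1) * \sum_(i <- r) `|u i| `^ p.
Proof.
rewrite le_eqVlt => /predU1P[<-|p1].
  rewrite subrr powRr0 mul1r powRr1 ?sumr_ge0//.
  by apply: ler_sum => i _; rewrite powRr1.
have p0 : 0 < p by lra.
pose q := p / (p - 1).
have q0 : 0 < q by rewrite divr_gt0//; lra.
have pq : p^-1 + q^-1 = 1 by rewrite /q; field; rewrite gt_eqF ?gt_eqF//; lra.
have := @sum_mul_le_lnorm p q u (fun=> 1) p0 q0 pq.
under eq_bigr do rewrite normr1 mulr1.
rewrite /lnorm; under [in X in _ * X]eq_bigr do rewrite normr1 powR1.
rewrite big_const_seq count_predT iter_addr_0 => H.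
apply: (le_trans (le_powR (ltW p0) _ H)); first by apply: sumr_ge0.
rewrite powRM ?powR_ge0// powRVK ?gt_eqF ?sum_powR_ge0// mulrC.
rewrite -powRrM (_ : q^-1 * p = p - 1)//.
by rewrite /q; field; rewrite gt_eqF//; lra.
Qed.

(** After division by the norm every term is at most 1, so a larger power decreases it; without
    division, [x ^ q <= x ^ p * norm ^ (q - p)]. *)
Lemma lnorm_mono p q u : 0 < p -> p <= q -> lnorm q u <= lnorm p u.
Proof.
move=> p0 pq; have q0 : 0 < q by lra.
apply: powR_le_root; rewrite ?lnorm_ge0 ?sum_powR_ge0//.
have aux x : 0 <= x -> x <= lnorm p u -> x `^ q <= x `^ p * lnorm p u `^ (q - p).
  rewrite le_eqVlt => /predU1P[<- _|x0 xl].
    by rewrite !powR0 ?gt_eqF// mul0r.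
  have -> : x `^ q = x `^ p * x `^ (q - p).
    by rewrite -powRD ?subrKC// (gt_eqF x0) implybT.
  by rewrite ler_wpM2l//; apply: le_powR => //; lra.
have -> : lnorm p u `^ q = lnorm p u `^ p * lnorm p u `^ (q - p).
  have := lnorm_ge0 p u; rewrite le_eqVlt => /predU1P[<-|l0].
    by rewrite (@powR0 _ q) ?(@powR0 _ p) ?gt_eqF// mul0r.
  by rewrite -powRD ?subrKC// (gt_eqF l0) implybT.
rewrite lnorm_powR ?gt_eqF// mulr_suml.
(* Membership in [r] cannot be tested in a general type, so the induction runs over lists whose norm
   is below that of [r]. *)
suff H : forall s : seq I, (forall x, 0 <= x -> x <= (\sum_(i <- s) `|u i| `^ p) `^ p^-1 ->
    x <= lnorm p u) -> \sum_(i <- s) `|u i| `^ q <= \sum_(i <- s) `|u i| `^ p * lnorm p u `^ (q - p).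
  by apply: H.
elim=> [|i s IH] H; first by rewrite !big_nil.
have Ss0 : 0 <= \sum_(j <- s) `|u j| `^ p by apply: sumr_ge0 => j _; exact: powR_ge0.
rewrite !big_cons lerD//.
  apply: aux => //; apply: H => //; rewrite big_cons -[leLHS](@powRK _ p) ?gt_eqF//.
  by apply: le_powR; rewrite ?invr_ge0 //; lra.
apply: IH => x x0 xs; apply: H => //; apply: (le_trans xs).
apply: le_powR; rewrite ?invr_ge0 ?(ltW p0)// big_cons.
by have := powR_ge0 `|u i| p; lra.
Qed.

End FiniteNorms.

(** * Sums over intervals and geometric sums *)

Section Sums.
Variable R : realType.
Implicit Types (F G : nat -> R) (a b c d n : nat).

Lemma ler_sum_widen F a b c d : (forall i, 0 <= F i) -> (c <= a)%N -> (b <= d)%N ->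
  \sum_(a <= i < b) F i <= \sum_(c <= i < d) F i.
Proof.
move=> F0 ca bd; have [ab|ba] := leqP a b; last first.
  by rewrite big_geq ?(ltnW ba)//; apply: sumr_ge0.
rewrite (@big_cat_nat _ _ _ a c d)//=; last exact: leq_trans bd.
rewrite (@big_cat_nat _ _ _ b a d)//=.
rewrite addrCA lerDl addr_ge0//; exact: sumr_ge0.
Qed.

Lemma ler_term_sum F a b n : (forall i, 0 <= F i) -> (a <= n < b)%N ->
  F n <= \sum_(a <= i < b) F i.
Proof.
move=> F0 /andP[an nb]; have -> : F n = \sum_(n <= i < n.+1) F i by rewrite big_nat1.
exact: ler_sum_widen.
Qed.

Lemma sum_cat F a b c : (a <= b)%N -> (b <= c)%N ->
  \sum_(a <= i < c) F i = \sum_(a <= i < b) F i + \sum_(b <= i < c) F i.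
Proof. by move=> ab bc; rewrite (@big_cat_nat _ _ _ b a c). Qed.

Lemma sum_nat_ge0 F a b : (forall i, 0 <= F i) -> 0 <= \sum_(a <= i < b) F i.
Proof. by move=> F0; exact: sumr_ge0. Qed.

Lemma ler_sum_pred F (P Q : pred nat) (r : seq nat) : (forall i, 0 <= F i) ->
  (forall i, i \in r -> P i -> Q i) ->
  \sum_(i <- r | P i) F i <= \sum_(i <- r | Q i) F i.
Proof.
move=> F0 PQ; rewrite big_mkcond [leRHS]big_mkcond !big_seq.
apply: ler_sum => i ir; case: ifPn => [/(PQ _ ir) -> //|_].
by case: ifP.
Qed.

Lemma ler_sum_nat_pred F (P Q : pred nat) a b : (forall i, 0 <= F i) ->
  (forall i, (a <= i < b)%N -> P i -> Q i) ->
  \sum_(a <= i < b | P i) F i <= \sum_(a <= i < b | Q i) F i.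
Proof.
by move=> F0 PQ; apply: ler_sum_pred => // i; rewrite mem_index_iota; exact: PQ.
Qed.

Lemma ler_sum_predU F (P Q S : pred nat) (r : seq nat) : (forall i, 0 <= F i) ->
  (forall i, i \in r -> P i -> Q i || S i) ->
  \sum_(i <- r | P i) F i <= \sum_(i <- r | Q i) F i + \sum_(i <- r | S i) F i.
Proof.
move=> F0 PQ; rewrite big_mkcond [in leRHS]big_mkcond /= [X in _ <= _ + X]big_mkcond /=.
rewrite -big_split /= !big_seq; apply: ler_sum => i ir.
have := PQ _ ir; case: (P i) => [/(_ isT)|_].
  by case: (Q i) => /=; [rewrite lerDl; case: ifP|move=> ->; rewrite add0r].
by rewrite addr_ge0//; case: ifP.
Qed.

Lemma sum_indicator F (P : pred nat) (r : seq nat) :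
  \sum_(i <- r | P i) F i = \sum_(i <- r) (P i)%:R * F i.
Proof. by rewrite big_mkcond; apply: eq_bigr => i _; case: (P i); rewrite ?mul1r ?mul0r. Qed.

Lemma sum_const_nat_R (x : R) a b : \sum_(a <= i < b) x = (b - a)%:R * x.
Proof. by rewrite big_const_nat iter_addr_0 mulr_natl. Qed.

End Sums.

Section Geometric.
Variable R : realType.
Implicit Types (x t c p r : R) (K k : nat).

(** The sum of the geometric series of ratio [2 ^ (- p)]. *)
Definition geoC p : R := 2 `^ p / (2 `^ p - 1).

Lemma two_powR_gt1 p : 0 < p -> 1 < (2 : R) `^ p.
Proof.
by move=> p0; have := @lt_powR R p 1 2 p0 ler01; rewrite powR1; apply; lra.
Qed.

Lemma geoC_ge0 p : 0 < p -> 0 <= geoC p.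
Proof. by move=> /two_powR_gt1 p1; rewrite divr_ge0//; lra. Qed.

Lemma geoC_ge1 p : 0 < p -> 1 <= geoC p.
Proof. by move=> /two_powR_gt1 p1; rewrite ler_pdivlMr; lra. Qed.

Lemma scale_powR c p k : 0 <= c -> (c * 2 ^+ k) `^ p = c `^ p * (2 `^ p) ^+ k.
Proof.
move=> c0; rewrite powRM ?exprn_ge0//; congr (_ * _).
have -> : (2 : R) ^+ k = 2 `^ k%:R by rewrite powR_mulrn.
by rewrite powRAC powR_mulrn.
Qed.

Lemma geo_sum_up p c K : 0 < p -> 0 <= c ->
  \sum_(0 <= k < K.+1) (c * 2 ^+ k) `^ p <= geoC p * (c * 2 ^+ K) `^ p.
Proof.
move=> p0 c0; have th1 := two_powR_gt1 p0.
under eq_bigr do rewrite scale_powR//.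
rewrite scale_powR// -mulr_sumr [leRHS]mulrCA ler_wpM2l//.
elim: K => [|K IH]; first by rewrite big_nat1 expr0 mulr1 geoC_ge1.
rewrite big_nat_recr//= exprS; apply: (le_trans (lerD IH (lexx _))).
rewrite -exprS exprS mulrA -{2}[_ ^+ K]mul1r mulrA -mulrDl ler_wpM2r ?exprn_ge0//.
rewrite /geoC mulr1 le_eqVlt; apply/orP; left; apply/eqP; field.
by rewrite gt_eqF; lra.
Qed.

(** Dyadic substitute for the integral of [s ^ (p - 1)] over [[0, t]]; [geo_down] does the same for
    [s ^ (- p - 1)] over [[t, oo)]. They serve in the integrations over levels. *)
Lemma geo_up p c t K : 0 < p -> 0 < c -> 0 <= t ->
  \sum_(0 <= k < K | c * 2 ^+ k < t) (c * 2 ^+ k) `^ p <= geoC p * t `^ p.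
Proof.
move=> p0 c0 t0; elim: K => [|K IH].
  by rewrite big_geq// mulr_ge0// geoC_ge0.
have [tc|ct] := leP t (c * 2 ^+ K).
  rewrite big_mkcond big_nat_recr//= -big_mkcond/=.
  by rewrite ltNge tc/= addr0.
apply: (@le_trans _ _ (\sum_(0 <= k < K.+1) (c * 2 ^+ k) `^ p)).
  rewrite big_mkcond; apply: ler_sum => k _; by case: ifP.
apply: (le_trans (geo_sum_up _ p0 (ltW c0))).
rewrite ler_wpM2l ?geoC_ge0//; apply: le_powR; rewrite ?(ltW ct)//.
by rewrite mulr_ge0 ?exprn_ge0// ltW.
Qed.

Lemma geo_sum_down p c K : 0 < p -> 0 < c ->
  \sum_(0 <= k < K) (c * 2 ^+ k) `^ (- p) <= geoC p * c `^ (- p).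
Proof.
move=> p0; have th1 := two_powR_gt1 p0.
elim: K c => [|K IH] c c0; first by rewrite big_geq// mulr_ge0// geoC_ge0.
rewrite big_nat_recl//= expr0 mulr1.
have -> : \sum_(0 <= i < K) (c * 2 ^+ i.+1) `^ (- p) =
    \sum_(0 <= i < K) ((c * 2) * 2 ^+ i) `^ (- p).
  by apply: eq_bigr => i _; rewrite exprS mulrA.
apply: (le_trans (lerD (lexx _) (IH _ _))); first by rewrite mulr_gt0.
rewrite powRM ?(ltW c0)// (powRN 2) mulrCA -[X in X + _]mulr1 -mulrDr mulrC.
rewrite ler_wpM2r// /geoC le_eqVlt; apply/orP; left; apply/eqP; field.
by rewrite !gt_eqF//; lra.
Qed.

Lemma geo_down p c t K : 0 < p -> 0 < c -> 0 < t ->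
  \sum_(0 <= k < K | t <= c * 2 ^+ k) (c * 2 ^+ k) `^ (- p) <= geoC p * t `^ (- p).
Proof.
move=> p0 c0 t0; elim: K c c0 => [|K IH] c c0.
  by rewrite big_geq// mulr_ge0// geoC_ge0.
have [tc|ct] := leP t c.
  apply: (@le_trans _ _ (\sum_(0 <= k < K.+1) (c * 2 ^+ k) `^ (- p))).
    by rewrite big_mkcond; apply: ler_sum => k _; case: ifP.
  apply: (le_trans (geo_sum_down _ p0 c0)).
  rewrite ler_wpM2l ?geoC_ge0// !powRN lef_pV2 ?posrE ?powR_gt0//.
  by apply: le_powR => //; exact: ltW.
rewrite big_mkcond big_nat_recl//= expr0 mulr1 (leNgt t c) ct/= add0r.
rewrite -big_mkcond/=.
have -> : \sum_(0 <= i < K | t <= c * 2 ^+ i.+1) (c * 2 ^+ i.+1) `^ (- p) =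
    \sum_(0 <= i < K | t <= (c * 2) * 2 ^+ i) ((c * 2) * 2 ^+ i) `^ (- p).
  by apply: eq_big => i; rewrite exprS mulrA.
by apply: IH; rewrite mulr_gt0.
Qed.

Lemma ltn_expr2 n : n%:R < (2 : R) ^+ n.
Proof. by rewrite -natrX ltr_nat ltn_expl. Qed.

Lemma expr2_unbounded c t : 0 < c -> exists K, t < c * 2 ^+ K.
Proof.
move=> c0; exists (Num.truncn (`|t| / c)).+1.
rewrite mulrC -ltr_pdivrMr//; apply: (@le_lt_trans _ _ (`|t| / c)).
  by rewrite ler_pM2r ?invr_gt0// ler_norm.
apply: (lt_trans _ (ltn_expr2 _)).
by apply: truncnS_gt; rewrite divr_ge0// ltW.
Qed.

(** The last level [c 2 ^ k] below [t] satisfies [t <= c 2 ^ k.+1], so its term alone suffices. *)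
Lemma geo_cover p c t K : 0 <= p -> 0 < c -> c < t -> t <= c * 2 ^+ K ->
  t `^ p <= \sum_(0 <= k < K | c * 2 ^+ k < t) (c * 2 ^+ k.+1) `^ p.
Proof.
move=> p0 c0; elim: K => [|K IH] ct tc.
  by move: tc; rewrite expr0 mulr1 leNgt ct.
have t0 : 0 <= t by rewrite (le_trans (ltW c0))// ltW.
rewrite big_mkcond big_nat_recr//= -big_mkcond/=.
case: ifPn => [h|]; last first.
  by rewrite -leNgt addr0 => h; apply: IH.
rewrite -[leLHS]add0r lerD ?sumr_ge0//.
by apply: le_powR.
Qed.

Lemma geo_cover_down p c t K : 0 <= p -> 0 < c -> c <= t -> t <= c * 2 ^+ K ->
  t `^ (- p) <= 2 `^ p * \sum_(0 <= k < K.+1 | t <= c * 2 ^+ k) (c * 2 ^+ k) `^ (- p).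
Proof.
move=> p0; elim: K c => [|K IH] c c0 ct tc.
  rewrite big_mkcond big_nat1 expr0 mulr1 in tc *.
  have -> : t = c by apply: le_anti; rewrite ct tc.
  rewrite lexx -[leLHS]mul1r ler_wpM2r//.
  by have := @le_powR R p 1 2 p0 ler01; rewrite powR1; apply; lra.
have t0 : 0 < t by exact: lt_le_trans ct.
have [h|h] := leP t (c * 2).
  rewrite big_mkcond big_nat_recl//= expr0 mulr1 big_nat_recl//= expr1 h.
  apply: (@le_trans _ _ (2 `^ p * (c * 2) `^ (- p))).
    rewrite !powRN -powR_div ?mulr_ge0 ?(ltW c0)// ?invr_ge0 ?powR_ge0//.
    rewrite (_ : 2 / (c * 2) = c^-1); last by field; rewrite gt_eqF.
    rewrite -!powRN -powR_inv1 ?(ltW c0)// -powRrM mulN1r.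
    rewrite !powRN lef_pV2 ?posrE ?powR_gt0//.
    exact: le_powR.
  rewrite ler_wpM2l// addrCA lerDl addr_ge0//; first by case: ifP.
  by apply: sumr_ge0 => i _; case: ifP.
apply: (le_trans (IH (c * 2) _ _ _)); rewrite ?mulr_gt0 ?(ltW h)// -?mulrA -?exprS//.
rewrite ler_wpM2l// [leRHS]big_mkcond big_nat_recl//=.
rewrite -[leLHS]add0r lerD//; first by case: ifP.
rewrite -big_mkcond/= le_eqVlt; apply/orP; left; apply/eqP.
by apply: eq_big => i; rewrite exprS mulrA.
Qed.

Definition tailC r : R := 2 `^ r * 2 * geoC (r - 1).

(** Summation by parts on dyadic levels: [t ^ (- r)] is at most [2 ^ r] times the sum of
    [(l 2 ^ k) ^ (- r)] over the levels above [t]. After exchanging sums, the mass of [q] up to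
    [l 2 ^ k] is at most [A (l 2 ^ k + 1) <= 2 A l 2 ^ k]; this is the 2 in [tailC]. *)
Lemma tail_sum_le (q : nat -> R) (A r : R) (l n : nat) : 1 < r -> 0 <= A ->
  (forall b, 0 <= q b) -> (forall n, \sum_(0 <= b < n) q b <= A * n%:R) ->
  (0 < l)%N ->
  \sum_(l <= t < n) q t * t%:R `^ (- r) <= tailC r * A * l%:R `^ (1 - r).
Proof.
move=> r1 A0 q0 qA l0; have r0 : 0 <= r by lra.
have lR : 0 < l%:R :> R by rewrite ltr0n.
have step (t : nat) : (l <= t < n)%N -> q t * t%:R `^ (- r) <= 2 `^ r *
    \sum_(0 <= k < n.+1) (q t *+ (t%:R <= l%:R * 2 ^+ k :> R)%R) * (l%:R * 2 ^+ k) `^ (- r).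
  move=> /andP[lt tn].
  have := @geo_cover_down r l%:R t%:R n r0 lR; rewrite ler_nat => /(_ lt) H.
  apply: (le_trans (ler_wpM2l (q0 t) (H _))).
    have l1 : 1 <= l%:R :> R by rewrite (ler_nat _ 1).
    have := ltn_expr2 n; have : t%:R <= n%:R :> R by rewrite ler_nat ltnW.
    have e0 : 0 <= (2 : R) ^+ n by rewrite exprn_ge0.
    by nra.
  rewrite mulrCA ler_wpM2l// mulr_sumr big_mkcond; apply: ler_sum => k _.
  by case: ifP => _; rewrite ?mulr1n ?mulr0n ?mul0r.
rewrite big_nat; apply: (le_trans (ler_sum _ step)); rewrite -big_nat -mulr_sumr.
rewrite exchange_big/=.
have -> : tailC r * A * l%:R `^ (1 - r) = 2 `^ r * (2 * A * (geoC (r - 1) * l%:R `^ (1 - r))).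
  by rewrite /tailC; ring.
rewrite ler_wpM2l//.
apply: (@le_trans _ _ (\sum_(0 <= k < n.+1) 2 * A * (l%:R * 2 ^+ k) `^ (- (r - 1)))).
  apply: ler_sum => k _; rewrite -mulr_suml.
  have lk0 : 0 < l%:R * 2 ^+ k :> R by rewrite mulr_gt0 ?exprn_gt0.
  rewrite opprB addrC powRD; last by rewrite (gt_eqF lk0) implybT.
  rewrite powRr1 ?(ltW lk0)//.
  rewrite (mulrC (_ `^ _)) mulrA ler_wpM2r//.
  apply: (@le_trans _ _ (\sum_(0 <= b < (l * 2 ^ k).+1) q b)).
    under eq_bigr do rewrite mulrb.
    rewrite -big_mkcond/=.
    apply: (@le_trans _ _ (\sum_(0 <= b < n | (b <= l * 2 ^ k)%N) q b)).
      apply: le_trans (_ : \sum_(l <= b < n | (b <= l * 2 ^ k)%N) q b <= _).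
        by apply: ler_sum_nat_pred => // i _; rewrite -natrX -natrM ler_nat.
      by rewrite big_mkcond [leRHS]big_mkcond; apply: ler_sum_widen => // i; case: ifP.
    rewrite big_mkcond -[leRHS]addr0.
    have [h|h] := leqP n (l * 2 ^ k).+1.
      rewrite addr0; apply: le_trans (ler_sum_widen q0 (leqnn 0) h).
      by apply: ler_sum => i _; case: ifP.
    rewrite (@sum_cat _ _ 0 (l * 2 ^ k).+1 n)//; last exact: ltnW.
    rewrite lerD//; first by apply: ler_sum => i _; case: ifP.
    rewrite big_nat big1// => i /andP[h1 _].
    by rewrite leqNgt h1.
  apply: (le_trans (qA _)); rewrite (mulrC 2) -mulrA ler_wpM2l//.
  rewrite -natrX -natrM -natr1.
  suff : 1 <= (l * 2 ^ k)%:R :> R by lra.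
  by rewrite (ler_nat _ 1) muln_gt0 l0 expn_gt0.
rewrite -mulr_sumr -[1 - r]opprB ler_wpM2l ?mulr_ge0//.
by apply: geo_sum_down => //; lra.
Qed.

End Geometric.

(** * Variation of sequences and control functions *)

Section Variation.
Variable R : realType.
Implicit Types (a b om : nat -> R) (q t : R) (M N m : nat).

(** Bounding the indices by [M] keeps the supremum finite and in [R]. Repeated indices contribute 0;
    allowing them makes the sequences stable under clamping and under nondecreasing maps. *)
Definition vsums q M a : set R :=
  [set x | exists m (N : nat -> nat), [/\ {homo N : i j / (i <= j)%N},
    forall i, (N i <= M)%N & x = \sum_(0 <= i < m) `|a (N i.+1) - a (N i)| `^ q]].

Definition vari q M a : R := sup (vsums q M a) `^ q^-1.

(** An additive form of the control functions of rough path theory: the increments of [om] telescope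
    along any sequence of times, so [om M - om 0] bounds the whole variation. *)
Definition controls q M a om : Prop :=
  forall N N', (N <= N' <= M)%N -> `|a N' - a N| `^ q <= om N' - om N.

Lemma controls_homo q M a om N N' : controls q M a om -> (N <= N' <= M)%N ->
  om N <= om N'.
Proof. by move=> H /H H1; rewrite -subr_ge0; apply: le_trans H1. Qed.

Lemma vsums_controls q M a om x : controls q M a om -> vsums q M a x ->
  x <= om M - om 0.
Proof.
move=> H [m [N [Nm NM ->]]].
apply: (@le_trans _ _ (\sum_(0 <= i < m) (om (N i.+1) - om (N i)))).
  by apply: ler_sum => i _; apply: H; rewrite NM Nm.
rewrite telescope_sumr//.
by rewrite lerB//; apply: (controls_homo H); rewrite ?NM ?leqnn.
Qed.

Lemma norm_sub_le_sum a N N' : (N <= N')%N ->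
  `|a N' - a N| <= \sum_(N <= M < N') `|a M.+1 - a M|.
Proof. by move=> NN'; rewrite -telescope_sumr//; exact: ler_norm_sum. Qed.

(** A crude control, valid for every sequence, from which the supremum defining [vari] is seen to be
    finite. *)
Lemma controls_bv q M a : 1 <= q ->
  controls q M a (fun N => (\sum_(0 <= M < N) `|a M.+1 - a M|) `^ q).
Proof.
move=> q1 N N' /andP[NN' _]; apply: le_trans (powR_sub_le _ _ _) => //.
- rewrite (@sum_cat _ _ 0 N N')// [X in _ <= X `^ _]addrAC subrr add0r.
  by apply: le_powR => //; [lra|exact: norm_sub_le_sum].
- exact: sum_nat_ge0.
- by rewrite (@sum_cat _ _ 0 N N')// lerDl sum_nat_ge0.
Qed.

Lemma has_sup_vsums q M a : 1 <= q -> has_sup (vsums q M a).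
Proof.
move=> q1; split.
  by exists 0, 0%N, (fun=> 0%N); split=> //; rewrite big_geq.
eexists; move=> x; exact: (vsums_controls (controls_bv _ q1)).
Qed.

Lemma sup_vsums_ge0 q M a : 1 <= q -> 0 <= sup (vsums q M a).
Proof.
move=> q1; apply: ub_le_sup; first by case: (@has_sup_vsums q M a q1).
by exists 0%N, (fun=> 0%N); split=> //; rewrite big_geq.
Qed.

Lemma vari_ge0 q M a : 0 <= vari q M a.
Proof. exact: powR_ge0. Qed.

Lemma vari_powR q M a : 1 <= q -> vari q M a `^ q = sup (vsums q M a).
Proof.
by move=> q1; rewrite /vari powRVK ?sup_vsums_ge0// gt_eqF//; lra.
Qed.

Lemma vsums_le_vari q M a x : 1 <= q -> vsums q M a x -> x <= vari q M a `^ q.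
Proof.
move=> q1 ax; rewrite vari_powR//.
by apply: ub_le_sup => //; case: (@has_sup_vsums q M a q1).
Qed.

Lemma vari_le q M a c : 1 <= q -> 0 <= c -> (forall x, vsums q M a x -> x <= c `^ q) ->
  vari q M a <= c.
Proof.
move=> q1 c0 H; apply: powR_le_root => //; [lra|exact: sup_vsums_ge0|].
by apply: ge_sup => //; case: (@has_sup_vsums q M a q1).
Qed.

Lemma lnorm_le_vari q M a m (N : nat -> nat) : 1 <= q ->
  {homo N : i j / (i <= j)%N} -> (forall i, (N i <= M)%N) ->
  lnorm (index_iota 0 m) q (fun i => a (N i.+1) - a (N i)) <= vari q M a.
Proof.
move=> q1 Nm NM; apply: powR_le_root; rewrite ?vari_ge0 ?sum_powR_ge0//; first lra.
by apply: vsums_le_vari => //; exists m, N.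
Qed.

Lemma vari_le_lnorm q M a c : 1 <= q -> 0 <= c ->
  (forall m (N : nat -> nat), {homo N : i j / (i <= j)%N} ->
     (forall i, (N i <= M)%N) ->
     lnorm (index_iota 0 m) q (fun i => a (N i.+1) - a (N i)) <= c) ->
  vari q M a <= c.
Proof.
move=> q1 c0 H; apply: vari_le => // _ [m [N [Nm NM ->]]].
by apply: root_le_powR; [lra|exact: sum_powR_ge0|exact: H].
Qed.

Lemma eq_vari q M a b : (forall N, (N <= M)%N -> a N = b N) ->
  vari q M a = vari q M b.
Proof.
move=> ab; rewrite /vari; congr (sup _ `^ _); apply/seteqP; split => x [m [N [Nm NM ->]]];
  by exists m, N; split => //; apply: eq_bigr => i _; rewrite !ab.
Qed.

Lemma variD q M a b : 1 <= q ->
  vari q M (fun N => a N + b N) <= vari q M a + vari q M b.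
Proof.
move=> q1; apply: vari_le_lnorm; rewrite ?addr_ge0 ?vari_ge0// => m N Nm NM.
apply: le_trans (lerD (lnorm_le_vari _ m q1 Nm NM) (lnorm_le_vari _ m q1 Nm NM)).
apply: le_trans (lnormD _ _ _ q1).
by rewrite le_eqVlt; apply/orP; left; apply/eqP; apply: eq_lnorm => i; ring.
Qed.

Lemma vari_comp q M a (phi : nat -> nat) : 1 <= q ->
  {homo phi : i j / (i <= j)%N} -> (forall N, (N <= M)%N -> (phi N <= M)%N) ->
  vari q M (a \o phi) <= vari q M a.
Proof.
move=> q1 phim phiM; apply: vari_le_lnorm; rewrite ?vari_ge0// => m N Nm NM.
apply: (@lnorm_le_vari q M a m (phi \o N)) => // [i j ij|i] /=.
- by apply: phim; apply: Nm.
- by apply: phiM.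
Qed.

Lemma vari_addC q M a c : vari q M (fun N => a N + c) = vari q M a.
Proof.
rewrite /vari; congr (sup _ `^ _); apply/seteqP; split => x [m [N [Nm NM ->]]];
  exists m, N; split => //; apply: eq_bigr => i _; congr (`|_| `^ _); ring.
Qed.

Lemma vari_exponent q t M a : 1 <= t -> t <= q -> vari q M a <= vari t M a.
Proof.
move=> t1 tq; apply: vari_le_lnorm; rewrite ?vari_ge0//; first lra.
move=> m N Nm NM; apply: (@le_trans _ _ (lnorm (index_iota 0 m) t (fun i => a (N i.+1) - a (N i)))).
  by apply: lnorm_mono => //; lra.
exact: lnorm_le_vari.
Qed.

Lemma vari_controls q t M a om : 1 <= t -> t <= q -> controls t M a om ->
  vari q M a `^ t <= om M - om 0.
Proof.
move=> t1 tq H; apply: (@le_trans _ _ (vari t M a `^ t)).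
  by apply: le_powR; [lra|exact: vari_ge0|exact: vari_exponent].
rewrite vari_powR//; apply: ge_sup; first by case: (@has_sup_vsums t M a t1).
by move=> x; apply: vsums_controls.
Qed.

Lemma vari_const q M a : 1 <= q -> (forall N, (N <= M)%N -> a N = a 0%N) -> vari q M a = 0.
Proof.
move=> q1 ac; apply: le_anti; rewrite vari_ge0 andbT.
have H : controls q M a (fun=> 0).
  move=> N N' /andP[NN' N'M]; rewrite !ac//; last exact: leq_trans N'M.
  by rewrite !subrr normr0 powR0// gt_eqF//; lra.
apply: vari_le => // x /(vsums_controls H); rewrite subrr.
by rewrite powR0// gt_eqF//; lra.
Qed.

(** The two clamped sequences add up to [a N + a (minn L M)], and constants do not affect the
    variation. Clamping at [minn L M] keeps the indices of the second one at most [M] even when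
    [M < L]. *)
Lemma vari_split q M L a : 1 <= q ->
  vari q M a <= vari q M (a \o minn L) + vari q M (a \o maxn (minn L M)).
Proof.
move=> q1; rewrite -(@vari_addC _ _ a (a (minn L M))).
apply: le_trans (variD _ _ _ q1).
rewrite le_eqVlt; apply/orP; left; apply/eqP; apply: eq_vari => N NM /=.
have [LN|NL] := leqP L N.
  rewrite (minn_idPl (leq_trans LN NM)) (maxn_idPr LN).
  exact: addrC.
by rewrite (maxn_idPl _)// leq_min (ltnW NL).
Qed.

End Variation.

Section Blocks.
Variable R : realType.
Variables (t : R) (t1 : 1 <= t).

Let t0 : 0 <= t. Proof. exact: le_trans t1. Qed.

Definition blockC : R := 2 * (2 `^ t + 1) + 1.

(* Gluing control functions along the level sets of a nondecreasing label [c]: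
   crossing a boundary costs the sizes of [a] in both level sets. *)
Lemma block_controls (D : pred nat) (a : nat -> R) (c : nat -> nat) (Y om : nat -> R) :
  (forall N N', N \in D -> N' \in D -> (N <= N')%N -> (c N <= c N')%N) ->
  (forall b, 0 <= Y b) ->
  (forall N, N \in D -> `|a N| `^ t <= Y (c N)) ->
  (forall N, N \in D -> 0 <= om N <= Y (c N)) ->
  (forall N N', N \in D -> N' \in D -> (N <= N')%N -> c N = c N' ->
    `|a N' - a N| `^ t <= om N' - om N) ->
  exists om' : nat -> R,
    (forall N N', N \in D -> N' \in D -> (N <= N')%N ->
       `|a N' - a N| `^ t <= om' N' - om' N) /\
    (forall N, N \in D -> 0 <= om' N <= blockC * \sum_(0 <= b < (c N).+1) Y b).
Proof.
move=> cm Y0 aY omY inb.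
have k0 : 0 <= (2 : R) `^ t + 1 by rewrite addr_ge0.
(* Moving to a larger label adds at least [Y (c N)] to the first sum and [Y (c N')] to the second,
   which pays for the sizes on both sides; the 1 in the factor pays for the loss of [om N]. *)
exists (fun N => (2 `^ t + 1) * (\sum_(0 <= b < c N) Y b +
  \sum_(0 <= b < (c N).+1) Y b) + om N); split => [N N' ND N'D NN'|N ND]; last first.
  have /andP[z0 zY] := omY _ ND.
  have s0 : 0 <= \sum_(0 <= b < c N) Y b by exact: sum_nat_ge0.
  rewrite big_nat_recr//=.
  have Y0' := Y0 (c N).
  apply/andP; split; first by rewrite !addr_ge0// mulr_ge0// !addr_ge0.
  rewrite /blockC; set k := 2 `^ t + 1 in k0 *; set s := \sum_(_ <= _ < _) _ in s0 *.
  by nra.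
have [cc|cNN'] := eqVneq (c N) (c N').
  have := inb _ _ ND N'D NN' cc; rewrite cc; set k := _ * _; move: k => k H.
  by apply: le_trans H _; lra.
have cc : (c N < c N')%N by rewrite ltn_neqAle cm// andbT.
have /andP[z0 zY] := omY _ ND.
have /andP[z0' zY'] := omY _ N'D.
apply: (@le_trans _ _ (2 `^ t * (Y (c N') + Y (c N)))).
  apply: (@le_trans _ _ ((`|a N'| + `|a N|) `^ t)).
    by apply: le_powR => //; exact: ler_normB.
  apply: (le_trans (powR_add_le _ _ _)) => //.
  by rewrite ler_wpM2l// lerD// aY.
rewrite (@sum_cat _ _ 0 (c N) (c N'))// ?(ltnW cc)//.
rewrite (@sum_cat _ _ 0 (c N).+1 (c N').+1)// ?(leqW cc)//.
have h1 : Y (c N) <= \sum_(c N <= b < c N') Y b by apply: ler_term_sum => //; rewrite leqnn.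
have h2 : Y (c N') <= \sum_((c N).+1 <= b < (c N').+1) Y b.
  by apply: ler_term_sum => //; rewrite cc leqnn.
have Y1 := Y0 (c N); have Y2 := Y0 (c N').
set k := 2 `^ t in k0 *; have kk : 0 <= k by rewrite /k.
set s1 := \sum_(0 <= b < c N) Y b; set s2 := \sum_(c N <= b < c N') Y b in h1 *.
set s3 := \sum_(0 <= b < (c N).+1) Y b; set s4 := \sum_((c N).+1 <= b < (c N').+1) Y b in h2 *.
nra.
Qed.

Definition fracC : R := blockC * 2 `^ t.

Lemma blockC_ge0 : 0 <= blockC.
Proof. by rewrite /blockC; have := powR_ge0 (2 : R) t; lra. Qed.

Lemma fracC_ge0 : 0 <= fracC.
Proof. by rewrite mulr_ge0// blockC_ge0. Qed.

(** On a level set of [c] the quotient has size at most [h / d] and total variation at most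
    [2 h / d]: one half from the increments of [S], the other from the change of the denominator
    over a time at most [d]. The [t]-th power of the total variation controls each level set, and
    [block_controls] glues. The bad part, the shifted averages and both kinds of martingale
    deviations all go through this lemma. *)
Lemma frac_controls (lo hi : nat) (S : nat -> R) (c : nat -> nat) (h d : nat -> R) :
  (forall b, 0 <= h b) -> (forall b, 0 < d b) ->
  (forall N N', (lo <= N)%N -> (N <= N')%N -> (N' <= hi)%N -> (c N <= c N')%N) ->
  (forall N, (lo <= N <= hi)%N -> `|S N| <= h (c N) /\ d (c N) <= N.+1%:R) ->
  (forall N N', (lo <= N)%N -> (N <= N')%N -> (N' <= hi)%N -> c N = c N' ->
    \sum_(N <= M < N') `|S M.+1 - S M| <= h (c N) /\ (N' - N)%:R <= d (c N)) ->
  exists om : nat -> R,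
    (forall N N', (lo <= N)%N -> (N <= N')%N -> (N' <= hi)%N ->
       `|S N' / N'.+1%:R - S N / N.+1%:R| `^ t <= om N' - om N) /\
    (forall N, (lo <= N <= hi)%N ->
       0 <= om N <= fracC * \sum_(0 <= b < (c hi).+1) (h b / d b) `^ t).
Proof.
move=> h0 d0 cm Sh Sd.
pose D := [pred N | (lo <= N <= hi)%N].
pose a N := S N / N.+1%:R.
pose Y b := (2 * (h b / d b)) `^ t.
(* Bound for one increment, from [a M.+1 - a M = (S M.+1 - S M) / M.+2 - S M / (M.+1 M.+2)]. *)
pose G b M := (`|S M.+1 - S M| + h b / d b) / d b.
have G0 b M : 0 <= G b M by rewrite divr_ge0 ?addr_ge0 ?divr_ge0 ?(ltW (d0 b)).
pose v N := \sum_(lo <= M < N | c M == c N) G (c N) M.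
have v0 N : 0 <= v N by apply: sumr_ge0.
have aY N : N \in D -> `|a N| <= h (c N) / d (c N).
  move=> ND; have [h1 h2] := Sh _ ND.
  rewrite /a normrM normfV (ger0_norm (ler0n _ _)).
  by rewrite ler_pM ?invr_ge0 ?ler0n// lef_pV2 ?posrE ?ltr0n.
have vE N N' : (lo <= N)%N -> (N <= N')%N -> (N' <= hi)%N -> c N = c N' ->
    v N' - v N = \sum_(N <= M < N') G (c N) M.
  move=> lN NN' Nh cc; rewrite /v -cc (@big_cat_nat _ _ _ N lo N')//=.
  rewrite addrAC subrr add0r big_mkcond big_nat [RHS]big_nat.
  apply: eq_bigr => M /andP[NM MN]; rewrite ifT//.
  rewrite eqn_leq {1}cc !cm//; do ?[exact: leq_trans NM|exact: ltnW].
  by apply: leq_trans Nh; exact: ltnW.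
have vle N : N \in D -> v N <= 2 * (h (c N) / d (c N)).
  move=> /andP[lN Nh].
  (* [N0] is the entry time into the level set of [N]. There [v] vanishes, so [v N] is the variation
     accumulated since then. *)
  pose P M := (lo <= M)%N && (c M == c N).
  have exP : exists M, P M by exists N; rewrite /P lN eqxx.
  case: (ex_minnP exP) => N0 /andP[lN0 /eqP cN0] minN0.
  have N0N : (N0 <= N)%N by apply: minN0; rewrite /P lN eqxx.
  have [h1 h2] := Sd _ _ lN0 N0N Nh cN0.
  have vN0 : v N0 = 0.
    rewrite /v big_nat_cond big1// => M /andP[/andP[lM MN0]] /eqP cM.
    have : (N0 <= M)%N by apply: minN0; rewrite /P lM cM cN0 eqxx.
    by rewrite leqNgt MN0.
  have := vE _ _ lN0 N0N Nh cN0; rewrite vN0 subr0 => ->.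
  rewrite /G -mulr_suml big_split/= sum_const_nat_R cN0 in h1 h2 *.
  rewrite [leRHS]mulrA ler_pM2r ?invr_gt0 ?d0//.
  have : (N - N0)%:R * (h (c N) / d (c N)) <= h (c N).
    rewrite mulrCA -[leRHS]mulr1 ler_wpM2l// ler_pdivrMr ?d0// mul1r//.
  lra.
have aD N : N \in D -> forall M, (N <= M < hi)%N -> c M = c N ->
    `|a M.+1 - a M| <= G (c N) M.
  move=> /andP[lN Nh] M /andP[NM Mh] cM.
  have [h1 h2] : `|S M| <= h (c M) /\ d (c M) <= M.+1%:R.
    by apply: Sh; rewrite (leq_trans lN NM) ltnW.
  have -> : a M.+1 - a M = (S M.+1 - S M) / M.+2%:R - S M / (M.+1%:R * M.+2%:R).
    rewrite /a -(natr1 M.+1); field.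
    by apply/andP; split; rewrite gt_eqF//; have := ler0n R M; lra.
  rewrite cM in h1 h2; apply: (le_trans (ler_normB _ _)); rewrite /G [in leRHS]mulrDl.
  have dM2 : d (c N) <= M.+2%:R by apply: (le_trans h2); rewrite ler_nat.
  rewrite lerD// normrM [X in _ * X]ger0_norm ?invr_ge0 ?mulr_ge0 ?ler0n//.
    by rewrite ler_wpM2l// lef_pV2 ?posrE ?ltr0n.
  rewrite -mulrA -invfM ler_pM ?invr_ge0 ?mulr_ge0//.
  by rewrite lef_pV2 ?posrE ?mulr_gt0 ?ltr0n// ler_pM// ltW.
have Y0 b : 0 <= Y b by exact: powR_ge0.
have dh0 b : 0 <= h b / d b by rewrite divr_ge0// ltW.
have [om [om1 om2]] := @block_controls D a c Y (fun N => v N `^ t)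
  (fun N N' h1 h2 h3 => cm _ _ (proj1 (andP h1)) h3 (proj2 (andP h2))) Y0
  ltac:(move=> N ND; apply: le_powR => //; apply: (le_trans (aY _ ND));
        have := dh0 (c N); lra)
  ltac:(move=> N ND; rewrite powR_ge0/=; apply: le_powR => //; exact: vle)
  ltac:(move=> N N' /andP[lN Nh] /andP[lN' Nh'] NN' cc;
    apply: le_trans (powR_sub_le t1 (v0 N) _);
      [apply: le_powR => //; apply: (le_trans (norm_sub_le_sum _ NN'));
       rewrite vE// big_nat [leRHS]big_nat; apply: ler_sum => M /andP[NM MN'];
       apply: aD; rewrite ?inE ?lN ?Nh ?NM ?(leq_trans MN')//;
       apply/eqP; rewrite eqn_leq {1}cc !cm//;
       do ?[exact: ltnW|exact: (leq_trans lN)|exact: (leq_trans (ltnW MN'))]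
      |rewrite -subr_ge0 vE//; exact: sum_nat_ge0]).
exists om; split => [N N' lN NN' N'h|N ND].
  by apply: om1 => //; rewrite inE ?lN ?N'h ?(leq_trans lN)// (leq_trans NN').
have /andP[h1 h2] := om2 _ ND; rewrite h1/=; apply: (le_trans h2).
rewrite /fracC -mulrA ler_wpM2l ?blockC_ge0// mulr_sumr.
apply: (@le_trans _ _ (\sum_(0 <= b < (c hi).+1) Y b)).
  apply: ler_sum_widen => //; rewrite ltnS; move: ND => /andP[lN Nh]; exact: cm.
by apply: ler_sum => b _; rewrite /Y powRM.
Qed.

End Blocks.

(** * One-sided weights and the maximal function *)

Section OneSidedWeights.
Variable R : realType.
Implicit Types (w f v : nat -> R) (p s C lam : R) (a b c n x y z L N : nat).

(** The weight condition tested on functions: one form for [p = 1] and [p > 1], and all that the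
    maximal inequality needs. [Ap] implies it by Hoelder's inequality. *)
Definition Bp p C w : Prop := forall a y c, (a <= y <= c)%N ->
  forall f, (forall i, 0 <= f i) ->
  (\sum_(a <= i < y.+1) w i) * (\sum_(y <= i < c.+1) f i) `^ p <=
  C * (c.+1 - a)%:R `^ p * \sum_(y <= i < c.+1) f i `^ p * w i.

Definition A1 C w : Prop := forall a n, (a <= n)%N ->
  \sum_(a <= i < n.+1) w i <= C * (n.+1 - a)%:R * w n.

Definition Ap p C w : Prop := forall a y c, (a <= y <= c)%N ->
  (\sum_(a <= i < y.+1) w i) *
  (\sum_(y <= i < c.+1) w i `^ (- (p - 1)^-1)) `^ (p - 1) <=
  C * (c.+1 - a)%:R `^ p.

Lemma A1_Bp C w : (forall i, 0 <= w i) -> 0 <= C -> A1 C w -> Bp 1 C w.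
Proof.
move=> w0 C0 H a y c /andP[ay yc] f f0.
rewrite powRr1 ?sum_nat_ge0// powRr1// [leLHS]mulr_sumr [leRHS]mulr_sumr big_nat [leRHS]big_nat.
apply: ler_sum => n /andP[yn nc]; rewrite powRr1// mulrC [leRHS]mulrCA ler_wpM2l//.
apply: (@le_trans _ _ (\sum_(a <= i < n.+1) w i)); first exact: ler_sum_widen.
apply: (le_trans (H _ _ (leq_trans ay yn))); rewrite ler_wpM2r// ler_wpM2l//.
by rewrite ler_nat leq_sub2r.
Qed.

(** Apply the hypothesis to [f ^ (s / p)] and use Jensen's inequality for the power [s / p]. *)
Lemma Bp_exponent p s C w : (forall i, 0 <= w i) -> 0 <= C -> 1 <= p -> p <= s ->
  Bp p C w -> Bp s C w.
Proof.
move=> w0 C0 p1 ps H a y c ayc f f0; have /andP[ay yc] := ayc.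
have p0 : 0 < p by lra.
pose t := s / p; have t1 : 1 <= t by rewrite ler_pdivlMr// mul1r.
have tp : t * p = s by rewrite divfK// gt_eqF.
have := H a y c ayc (fun i => f i `^ t) (fun=> powR_ge0 _ _).
under [in leRHS]eq_bigr do rewrite -powRrM tp.
set l : R := (c.+1 - a)%:R => Ht.
have l0 : 0 <= l by exact: ler0n.
have F0 : 0 <= \sum_(y <= i < c.+1) f i by exact: sum_nat_ge0.
have J : (\sum_(y <= i < c.+1) f i) `^ s <=
    l `^ (s - p) * (\sum_(y <= i < c.+1) f i `^ t) `^ p.
  rewrite -[in leLHS]tp powRrM.
  have -> : l `^ (s - p) = (l `^ (t - 1)) `^ p.
    by rewrite -powRrM mulrBl tp mul1r.
  rewrite -powRM ?sum_nat_ge0//; apply: le_powR => //.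
  have := @powR_sum_le R nat (index_iota y c.+1) t f t1.
  rewrite size_iota.
  under eq_bigr do rewrite ger0_norm//.
  under [in X in _ <= _ * X]eq_bigr do rewrite ger0_norm//.
  move=> /le_trans; apply; rewrite ler_wpM2r ?sum_nat_ge0//.
  by apply: le_powR => //; [lra|rewrite ler_nat leq_sub2l].
apply: (le_trans (ler_wpM2l (sum_nat_ge0 _ _ w0) J)).
rewrite mulrCA; apply: (le_trans (ler_wpM2l (powR_ge0 _ _) Ht)).
have -> : l `^ s = l `^ (s - p) * l `^ p.
  have ln0 : l != 0 by rewrite pnatr_eq0 -lt0n subn_gt0 ltnS (leq_trans ay).
  by rewrite -powRD ?subrK// ln0 implybT.
by apply: eq_le; ring.
Qed.

Lemma Ap_Bp p C w : (forall i, 0 < w i) -> 0 <= C -> 1 < p -> Ap p C w -> Bp p C w.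
Proof.
move=> w0 C0 p1 H a y c ayc f f0; have p0 : 0 < p by lra.
pose q := p / (p - 1).
have q0 : 0 < q by rewrite divr_gt0//; lra.
have pq : p^-1 + q^-1 = 1 by rewrite /q; field; rewrite !gt_eqF//; lra.
have := @sum_mul_le_lnorm R nat (index_iota y c.+1) p q
  (fun i => f i * w i `^ p^-1) (fun i => w i `^ (- p^-1)) p0 q0 pq.
have -> : \sum_(i <- index_iota y c.+1) `|f i * w i `^ p^-1| * `|w i `^ (- p^-1)| =
    \sum_(y <= i < c.+1) f i.
  apply: eq_bigr => i _; rewrite !ger0_norm ?mulr_ge0// -mulrA -powRD.
    by rewrite subrr powRr0 mulr1.
  by rewrite (gt_eqF (w0 i)) implybT.
set A := lnorm _ p _; set B := lnorm _ q _.
have A0 : 0 <= A by exact: lnorm_ge0.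
have B0 : 0 <= B by exact: lnorm_ge0.
have AE : A `^ p = \sum_(y <= i < c.+1) f i `^ p * w i.
  rewrite /A lnorm_powR; last by rewrite gt_eqF.
  apply: eq_bigr => i _; rewrite ger0_norm ?mulr_ge0// powRM// powRVK ?gt_eqF//.
  exact: ltW.
have BE : B `^ p = (\sum_(y <= i < c.+1) w i `^ (- (p - 1)^-1)) `^ (p - 1).
  rewrite /B /lnorm -powRrM (_ : q^-1 * p = p - 1); last first.
    by rewrite /q; field; rewrite !gt_eqF//; lra.
  congr (_ `^ _); apply: eq_bigr => i _; rewrite ger0_norm// -powRrM; congr (_ `^ _).
  by rewrite /q; field; rewrite !gt_eqF//; lra.
clearbody A B; move=> /(le_powR (ltW p0) (sum_nat_ge0 _ _ f0)) Hf0.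
have Hf := le_trans Hf0 (eq_le (powRM p A0 B0)).
rewrite {}AE {}BE in Hf.
apply: (le_trans (ler_wpM2l (sum_nat_ge0 _ _ (fun i => ltW (w0 i))) Hf)).
rewrite mulrCA [leRHS]mulrC ler_wpM2l ?H// sum_nat_ge0// => i.
by rewrite mulr_ge0// ltW.
Qed.

(* The superlevel sets of the one-sided maximal function. *)
Definition msup f lam : pred nat :=
  fun n => `[< exists N, lam * N.+1%:R < \sum_(n <= i < n + N.+1) f i >].

Lemma msupP f lam n :
  reflect (exists z, (n < z)%N /\ lam * (z - n)%:R < \sum_(n <= i < z) f i) (msup f lam n).
Proof.
apply: (iffP (asboolP _)) => [[N HN]|[z [nz H]]].
  by exists (n + N.+1)%N; rewrite addKn; split => //; lia.
by exists (z - n).-1; rewrite prednK ?subn_gt0// subnKC// ltnW.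
Qed.

Lemma msupN f lam n z : ~~ msup f lam n -> \sum_(n <= i < z) f i <= lam * (z - n)%:R.
Proof.
have [zn _|nz /msupP H] := leqP z n.
  by rewrite big_geq// (eqP (_ : z - n == 0)%N) ?mulr0// subn_eq0.
by rewrite leNgt; apply/negP => h; apply: H; exists z.
Qed.

Lemma msup_lt f lam L n : 0 <= lam -> (forall i, (L <= i)%N -> f i = 0) ->
  msup f lam n -> (n < L)%N.
Proof.
move=> l0 fL /msupP[z [nz]]; rewrite ltnNge; apply: contraTN => Ln.
rewrite -leNgt big_nat big1 ?mulr_ge0// => i /andP[ni _].
by rewrite fL// (leq_trans Ln).
Qed.

(* Rising sun: inside a run of the superlevel set ending at [b], every average
   from a point up to [b] exceeds the level. *)
Lemma msup_tail f lam x b : (x <= b)%N -> (forall i, (x <= i <= b)%N -> msup f lam i) ->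
  ~~ msup f lam b.+1 -> lam * (b.+1 - x)%:R < \sum_(x <= i < b.+1) f i.
Proof.
move: {2}(b - x)%N (leqnn (b - x)) => k; elim: k x => [|k IH] x bx xb run nb.
  have -> : x = b by apply/eqP; rewrite eqn_leq xb/= -subn_eq0 -leqn0.
  have /msupP[z [bz]] := run b ltac:(by rewrite xb leqnn).
  rewrite (@sum_cat _ _ b b.+1 z)//.
  have := @msupN f lam b.+1 z nb.
  rewrite subSnn -[(z - b)%N]prednK ?subn_gt0// -natr1 -subnS.
  by lra.
have /msupP[z [xz Hz]] := run x ltac:(by rewrite leqnn xb).
have [zb|bz] := leqP z b.
  have H := IH z ltac:(lia) zb _ nb.
  have {}H := H ltac:(by move=> i /andP[zi ib]; apply: run; rewrite ib (leq_trans (ltnW xz))).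
  rewrite (@sum_cat _ _ x z b.+1)//; [|exact: ltnW|exact: leqW].
  have -> : (b.+1 - x)%:R = (z - x)%:R + (b.+1 - z)%:R :> R.
    by rewrite -natrD; congr _%:R; lia.
  by lra.
have := @msupN f lam b.+1 z nb.
have E : \sum_(x <= i < z) f i = \sum_(x <= i < b.+1) f i + \sum_(b.+1 <= i < z) f i.
  by apply: sum_cat => //; exact: leqW.
have -> : (z - b.+1)%:R = (z - x)%:R - (b.+1 - x)%:R :> R.
  rewrite -natrB; last by lia.
  by congr _%:R; lia.
by move: Hz; rewrite E; lra.
Qed.

(** Cut the run at the points [a = x_0 < x_1 < ...] where the tail sum [F] first drops to half. From
    [x_(i+1) - 1] up to [x_(i+2)] the function carries at least a quarter of [F x_i], hence at least
    [lam / 4] times the length of [[x_i, x_(i+2))], and [Bp] bounds the weight of [[x_i, x_(i+1))].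
    The quarter gives [4 ^ p], the overlap of consecutive windows the factor 2. *)
Lemma weak_run p C w f lam a b : 1 <= p -> 0 <= C -> (forall i, 0 <= w i) ->
  (forall i, 0 <= f i) -> 0 < lam -> Bp p C w -> (a <= b)%N ->
  (forall x, (a <= x <= b)%N -> lam * (b.+1 - x)%:R <= \sum_(x <= i < b.+1) f i) ->
  lam `^ p * \sum_(a <= i < b.+1) w i <=
  2 * (4 `^ p * C) * \sum_(a <= i < b.+1) f i `^ p * w i.
Proof.
move=> p1 C0 w0 f0 lam0 Bw ab tail.
have p0 : 0 < p by lra.
pose F y := \sum_(y <= i < b.+1) f i.
pose S y := \sum_(y <= i < b.+1) f i `^ p * w i.
have fw0 i : 0 <= f i `^ p * w i by rewrite mulr_ge0.
have Smono x y : (x <= y)%N -> S y <= S x by move=> xy; exact: ler_sum_widen.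
have S0 x : 0 <= S x by exact: sum_nat_ge0.
have Fpos x : (a <= x <= b)%N -> 0 < F x.
  move=> axb; apply: lt_le_trans (tail _ axb); rewrite mulr_gt0// ltr0n subn_gt0.
  by case/andP: axb.
pose next x x' := [/\ (x < x' <= b.+1)%N, F x' <= F x / 2 &
  forall y, (x <= y < x')%N -> F x / 2 < F y].
have ex_next x : (a <= x <= b)%N -> exists x', next x x'.
  move=> axb; have xb : (x <= b)%N by case/andP: axb.
  have exP : exists y, (x < y)%N && (F y <= F x / 2).
    by exists b.+1; rewrite ltnS xb {1}/F big_geq// divr_ge0// ltW// Fpos.
  case: (ex_minnP exP) => x' /andP[xx' Fx'] minx'; exists x'; split => //.
    rewrite xx'/=; apply: minx'; rewrite ltnS xb {1}/F big_geq// divr_ge0//.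
    by rewrite ltW// Fpos.
  move=> y /andP[xy yx']; move: xy; rewrite leq_eqVlt => /predU1P[<-|xy].
    by have := Fpos _ axb; lra.
  rewrite ltNge; apply/negP => Fy; have := minx' y; rewrite xy Fy => /(_ isT).
  by rewrite leqNgt yx'.
have step x x' z : (a <= x <= b)%N -> next x x' -> (x' <= z <= b.+1)%N ->
    F z <= F x / 4 ->
    lam `^ p * \sum_(x <= i < x') w i <= 4 `^ p * C * (S x - S z).
  move=> axb [/andP[xx' x'b] _ Hx'] /andP[x'z zb] Fz.
  have [y x'E] : exists y, x' = y.+1 by exists x'.-1; rewrite prednK// (leq_trans _ xx').
  have [c zE] : exists c, z = c.+1 by exists z.-1; rewrite prednK// (leq_trans _ x'z)// x'E.
  have xy : (x <= y)%N by rewrite -ltnS -x'E.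
  have yc : (y <= c)%N by rewrite -ltnS -zE -x'E.
  have := Bw x y c ltac:(by rewrite xy yc) f f0.
  have FyE : \sum_(y <= i < c.+1) f i = F y - F z.
    by rewrite /F (@sum_cat _ _ y c.+1 b.+1) ?zE ?(leqW yc)// -?zE// addrK.
  have SyE : \sum_(y <= i < c.+1) f i `^ p * w i = S y - S z.
    by rewrite /S (@sum_cat _ _ y c.+1 b.+1) ?zE ?(leqW yc)// -?zE// addrK.
  rewrite FyE SyE -x'E -zE; set d := (z - x)%:R.
  have d0 : 0 < d :> R by rewrite /d ltr0n subn_gt0 (leq_trans xx').
  move=> H.
  have lF : lam * d / 4 <= F y - F z.
    have h1 : F x / 2 < F y by apply: Hx'; rewrite xy x'E leqnn.
    have h2 : lam * d <= F x.
      apply: le_trans (tail _ axb); rewrite ler_pM2l// ler_nat leq_sub2r//.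
    by lra.
  have l4 : 0 <= lam * d / 4 by rewrite divr_ge0// mulr_ge0// ltW.
  have W0 : 0 <= \sum_(x <= i < x') w i by exact: sum_nat_ge0.
  have {}H := le_trans (ler_wpM2l W0 (le_powR (ltW p0) l4 lF)) H.
  rewrite powR_div ?mulr_ge0 ?(ltW d0)// powRM ?(ltW d0)// in H.
  have dp : 0 < d `^ p by exact: powR_gt0.
  have fp : 0 < (4 : R) `^ p by exact: powR_gt0.
  rewrite mulrA ler_pdivrMr// in H.
  have {}H : d `^ p * (lam `^ p * \sum_(x <= i < x') w i) <=
      d `^ p * (4 `^ p * C * (S y - S z)).
    move: H; set W := \sum_(_ <= _ < _) _; set l := lam `^ p; set D := d `^ p.
    set k := 4 `^ p; set s1 := S y - S z => H.
    by apply: le_trans (le_trans H _); apply: eq_le; ring.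
  rewrite ler_pM2l// in H; apply: (le_trans H); rewrite ler_wpM2l ?mulr_ge0//.
  by rewrite lerB// Smono.
(* The bound for the window from [x] to [x2] and the induction hypothesis telescope: [(S x - S x2) +
   (S x' + S x2) = S x + S x']. *)
have claim k : forall x x', (b.+1 - x <= k)%N -> (a <= x <= b)%N -> next x x' ->
    lam `^ p * \sum_(x <= i < b.+1) w i <= 4 `^ p * C * (S x + S x').
  elim: k => [|k IH] x x' kx axb nx.
    by move: axb; rewrite leqn0 subn_eq0 in kx; rewrite (leqNgt x) kx andbF.
  have [/andP[xx' x'b] Fx' _] := nx.
  have Fx := Fpos _ axb.
  have [x'lt|x'ge] := leqP x' b; last first.
    have x'E : x' = b.+1 by apply/eqP; rewrite eqn_leq x'b.
    have := step x x' x' axb nx; rewrite leqnn x'b => /(_ isT).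
    rewrite x'E /F big_geq// => /(_ _)/le_trans -> //; first by rewrite divr_ge0// ltW.
    by rewrite ler_wpM2l ?mulr_ge0//; have := S0 b.+1; lra.
  have axb' : (a <= x' <= b)%N.
    by rewrite x'lt andbT; case/andP: axb => ax _; rewrite (leq_trans ax)// ltnW.
  have [x2 nx2] := ex_next _ axb'.
  have [/andP[x'x2 x2b] Fx2 _] := nx2.
  have H1 := IH x' x2 ltac:(lia) axb' nx2.
  have H2 := step x x' x2 axb nx ltac:(by rewrite (ltnW x'x2)) ltac:(lra).
  rewrite (@sum_cat _ _ x x' b.+1) ?(ltnW xx')// mulrDr.
  apply: (le_trans (lerD H2 H1)); rewrite -mulrDr ler_wpM2l ?mulr_ge0//.
  by apply: eq_le; ring.
have aab : (a <= a <= b)%N by rewrite leqnn.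
have [a' na] := ex_next _ aab.
apply: (le_trans (claim _ _ _ (leqnn _) aab na)).
rewrite [leRHS](_ : _ = 4 `^ p * C * (S a + S a)); last by rewrite /S; ring.
rewrite ler_wpM2l ?mulr_ge0// lerD2l Smono//.
by case: na => /andP[/ltnW].
Qed.

Lemma weak_maximal p C w f lam L : 1 <= p -> 0 <= C -> (forall i, 0 <= w i) ->
  (forall i, 0 <= f i) -> (forall i, (L <= i)%N -> f i = 0) -> 0 < lam -> Bp p C w ->
  lam `^ p * \sum_(0 <= n < L | msup f lam n) w n <=
  2 * (4 `^ p * C) * \sum_(0 <= n < L) f n `^ p * w n.
Proof.
move=> p1 C0 w0 f0 fL lam0 Bw.
have fw0 i : 0 <= f i `^ p * w i by rewrite mulr_ge0.
have K0 : 0 <= 2 * (4 `^ p * C) by rewrite !mulr_ge0.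
suff claim k : forall n, (L - n <= k)%N ->
    lam `^ p * \sum_(n <= i < L | msup f lam i) w i <=
    2 * (4 `^ p * C) * \sum_(n <= i < L) f i `^ p * w i by exact: (claim _ 0%N (leqnn _)).
elim: k => [|k IH] n Ln.
  by rewrite leqn0 subn_eq0 in Ln; rewrite !big_geq// !mulr0.
have [Ln'|nL] := leqP L n; first by rewrite !big_geq// !mulr0.
have [Hn|Hn] := boolP (msup f lam n); last first.
  rewrite big_mkcond big_ltn//= (negPf Hn) add0r -big_mkcond/=.
  apply: (le_trans (IH n.+1 _)); first by lia.
  by rewrite ler_wpM2l// ler_sum_widen.
have exb : exists b, (n <= b)%N && ~~ msup f lam b.+1.
  exists L; rewrite (ltnW nL)/=; apply/negP => /(msup_lt (ltW lam0) fL).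
  by rewrite ltnNge leqnSn.
case: (ex_minnP exb) => b /andP[nb Hb] minb.
have run i : (n <= i <= b)%N -> msup f lam i.
  case: i => [|i] /andP[ni ib]; first by move: ni Hn; rewrite leqn0 => /eqP ->.
  move: ni; rewrite leq_eqVlt => /predU1P[<- //|ni].
  apply: contraT => Hi; have := minb i; rewrite -ltnS ni Hi => /(_ isT).
  by rewrite leqNgt ib.
have bL : (b < L)%N by apply: (msup_lt (ltW lam0) fL); apply: run; rewrite nb leqnn.
rewrite (@big_cat_nat _ _ _ b.+1 n L)//= ?(leqW nb)//.
rewrite (@sum_cat _ _ n b.+1 L) ?(leqW nb)// !mulrDr lerD//; last by apply: IH; lia.
apply: le_trans (weak_run p1 C0 w0 f0 lam0 Bw nb _).
  by rewrite ler_wpM2l// big_mkcond; apply: ler_sum => i _; case: ifP.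
move=> x /andP[nx xb]; apply: ltW; apply: msup_tail => // i /andP[xi ib].
by apply: run; rewrite (leq_trans nx).
Qed.

End OneSidedWeights.

(** * The reverse Hoelder inequality *)

Section ReverseHolder.
Variable R : realType.
Implicit Types (w v : nat -> R) (p C lam th eta : R) (a b c n x y z L : nat).

Lemma powRD_pos (x r s : R) : 0 < x -> x `^ (r + s) = x `^ r * x `^ s.
Proof. by move=> x0; rewrite powRD// (gt_eqF x0) implybT. Qed.

(* The one-sided A_infinity condition on the window [0, L): the mass of the left part
   is controlled by the mass of any substantial subset of the right part. *)
Definition Ainf p C L v : Prop := forall a y c, (a <= y <= c)%N -> (c < L)%N ->
  forall E : pred nat,
  (\sum_(a <= i < y.+1) v i) * (\sum_(y <= i < c.+1 | E i) 1) `^ p <=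
  C * (c.+1 - a)%:R `^ p * \sum_(y <= i < c.+1 | E i) v i.

Lemma Bp_Ainf p C L w : 1 <= p -> Bp p C w -> Ainf p C L w.
Proof.
move=> p1 H a y c ayc _ E; have := H a y c ayc (fun i => (E i)%:R) (fun=> ler0n _ _).
rewrite [in X in _ <= X -> _](eq_bigr (fun i => (E i)%:R * w i)); last first.
  by move=> i _; case: (E i); rewrite ?powR1// powR0// gt_eqF//; lra.
rewrite -sum_indicator => H1; apply: le_trans H1.
apply: eq_le; congr (_ * _ `^ _); rewrite [RHS]big_mkcond [LHS]big_mkcond.
by apply: eq_bigr => i _; case: (E i).
Qed.

(* Unweighted weak type (1,1), with constant one, of the left maximal function. *)
Lemma left_averages_point v lam a b c : (a <= b < c)%N -> (forall i, 0 <= v i) ->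
  0 <= lam -> \sum_(a <= i < c) v i < lam * (c - b)%:R ->
  exists2 z, (b <= z < c)%N & forall x, (a <= x <= z)%N ->
    \sum_(x <= i < z.+1) v i <= lam * (z.+1 - x)%:R.
Proof.
move=> /andP[ab bc] v0 lam0; rewrite ltNge => /negP H.
apply: contrapT => /forall2NP HN; apply: H.
have H z : (b <= z < c)%N -> exists2 x, (a <= x <= z)%N &
    lam * (z.+1 - x)%:R < \sum_(x <= i < z.+1) v i.
  move=> bzc; apply: contrapT => /forall2NP Hx.
  case: (HN z) => [/(_ bzc) //|]; apply => x axz.
  by case: (Hx x) => [/(_ axz) //|/negP]; rewrite -leNgt.
have claim k : forall d, (d <= k)%N -> (b <= d <= c)%N ->
    lam * (d - b)%:R <= \sum_(a <= i < d) v i.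
  elim: k => [|k IH] d dk /andP[bd dc].
    have -> : d = b by lia.
    by rewrite subnn mulr0 sum_nat_ge0.
  move: bd; rewrite leq_eqVlt => /predU1P[<-|bd].
    by rewrite subnn mulr0 sum_nat_ge0.
  have [x /andP[ax xd]] := H d.-1 ltac:(lia).
  rewrite prednK ?(leq_trans _ bd)// => Hx.
  rewrite (@sum_cat _ _ a x d)//; last by lia.
  have [xb|bx] := leqP x b.
    apply: (@le_trans _ _ (lam * (d - x)%:R)); first by rewrite ler_wpM2l// ler_nat leq_sub2l.
    by rewrite (le_trans (ltW Hx))// lerDr sum_nat_ge0.
  have Hb := IH x ltac:(lia) ltac:(lia).
  have -> : (d - b)%:R = (x - b)%:R + (d - x)%:R :> R.
    by rewrite -natrD; congr _%:R; lia.
  by rewrite mulrDr lerD// ltW.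
by apply: (claim c c) => //; rewrite leqnn andbT ltnW.
Qed.

Lemma half_split_card (E : pred nat) y s (r : R) : (y <= s)%N ->
  \sum_(y <= i < s | E i) 1 <= r -> (s - y)%:R - r <= \sum_(y <= i < s | ~~ E i) (1 : R).
Proof.
move=> ys H.
have : \sum_(y <= i < s | E i) (1 : R) + \sum_(y <= i < s | ~~ E i) 1 = (s - y)%:R.
  rewrite -[RHS]mulr1 -sum_const_nat_R [in RHS](bigID E)//=.
lra.
Qed.

Lemma mid_interval a s (y := (a + (s - a).-1 %/ 2)%N) : (a < s)%N ->
  [/\ (a <= y < s)%N, (s - a <= (y.+1 - a) * 2)%N & (s - a <= (s - y) * 2)%N].
Proof. by rewrite /y => as_; split; lia. Qed.

(** Solves [dens * 2 (C + 1) * 4 ^ (p - 1) = 1], just small enough for the contradiction in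
    [run_density]. *)
Definition dens p C : R := 4 `^ (1 - p) / (2 * (C + 1)).

Lemma dens_gt0 p C : 0 <= C -> 0 < dens p C.
Proof. by move=> C0; rewrite divr_gt0 ?powR_gt0// mulr_gt0//; lra. Qed.

Lemma dens_le1 p C : 1 <= p -> 0 <= C -> dens p C <= 1.
Proof.
move=> p1 C0; rewrite ler_pdivrMr ?mulr_gt0//; try lra.
have : (4 : R) `^ (1 - p) <= 4 `^ 0 by apply: ler_powR; lra.
by rewrite powRr0; lra.
Qed.

(** Otherwise the right half contains a set [E] of more than a quarter of the points where
    [v <= dens lam]. [Ainf] would then bound the mass of the left half, at least [lam / 2] times the
    length, by the mass of [E], and [dens] is too small for that. *)
Lemma run_density p C L v lam a s : 1 < p -> 0 <= C -> (forall i, 0 <= v i) ->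
  Ainf p C L v -> 0 < lam -> (a < s <= L)%N ->
  (forall x, (a <= x < s)%N -> lam * (x.+1 - a)%:R < \sum_(a <= i < x.+1) v i) ->
  (s - a)%:R <= 4 * \sum_(a <= x < s | dens p C * lam < v x) (1 : R).
Proof.
move=> p1 C0 v0 A lam0 /andP[as_ sL] H.
set th := dens p C; have th0 : 0 < th by exact: dens_gt0.
pose n := (s - a)%N; pose y := (a + n.-1 %/ 2)%N.
have [/andP[ay ys] yl yr] := mid_interval as_; rewrite -/n -/y in ay ys yl yr.
have [c sE] : exists c, s = c.+1 by exists s.-1; rewrite prednK// (leq_trans _ as_).
pose E := [pred x | v x <= th * lam].
have := A a y c ltac:(rewrite ay; lia) ltac:(lia) E.
rewrite -sE; set e := \sum_(y <= i < s | E i) 1; set W := \sum_(a <= i < y.+1) v i.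
have e0 : 0 <= e by exact: sumr_ge0.
have vE : \sum_(y <= i < s | E i) v i <= th * lam * e.
  by rewrite /e mulr_sumr; apply: ler_sum => i; rewrite mulr1.
have nR : n%:R = (s - a)%:R :> R by [].
have n0 : 0 < n%:R :> R by rewrite ltr0n subn_gt0.
have W0 : lam * (n%:R / 2) <= W.
  apply: le_trans (ltW (H y _)); last by rewrite ay.
  by rewrite ler_pM2l// ler_pdivrMr// -natrM ler_nat.
rewrite -/n => HA.
have eq : e <= n%:R / 4.
  rewrite leNgt; apply/negP => en.
  have e1 : 0 < e by apply: lt_trans en; rewrite divr_gt0.
  have h1 : (n%:R / 4) `^ (p - 1) <= e `^ (p - 1).
    by apply: le_powR; rewrite ?(ltW en)//; lra.
  have h2 : e `^ p = e * e `^ (p - 1) by rewrite mulr_powRB1//; lra.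
  have h3 : n%:R `^ p = n%:R * n%:R `^ (p - 1) :> R by rewrite mulr_powRB1//; lra.
  rewrite powR_div// in h1.
  have q0 : 0 < (4 : R) `^ (p - 1) by exact: powR_gt0.
  have N0 : 0 < n%:R `^ (p - 1) :> R by exact: powR_gt0.
  have thE : th * (2 * (C + 1)) * 4 `^ (p - 1) = 1.
    rewrite /th /dens divfK ?gt_eqF ?mulr_gt0//; last by lra.
    by rewrite -powRD_pos// addrC addrA subrK subrr powRr0.
  have h4 : lam * (n%:R / 2) * (e * (n%:R `^ (p - 1) / 4 `^ (p - 1))) <=
      C * (n%:R * n%:R `^ (p - 1)) * (th * lam * e).
    rewrite -h3; apply: le_trans (le_trans HA (ler_wpM2l _ vE)); last by rewrite mulr_ge0.
    rewrite h2 ler_pM//; first by rewrite mulr_ge0// ltW.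
      by rewrite mulr_ge0// divr_ge0// ltW.
    by rewrite ler_wpM2l.
  move: h4; set N := n%:R in n0 *; set Nq := _ `^ _ in N0 *; set q := 4 `^ _ in q0 thE *.
  have -> : lam * (N / 2) * (e * (Nq / q)) = lam * e * N * Nq * (2^-1 / q) by ring.
  have -> : C * (N * Nq) * (th * lam * e) = lam * e * N * Nq * (C * th) by ring.
  rewrite ler_pM2l ?mulr_gt0// ler_pdivrMr// => h4.
  have := mulr_gt0 th0 q0; lra.
have := @half_split_card E y s (n%:R / 4) (ltnW ys) eq.
have yn : n%:R <= (s - y)%:R * 2 :> R by rewrite -natrM ler_nat.
have : \sum_(y <= i < s | ~~ E i) (1 : R) <= \sum_(a <= x < s | th * lam < v x) 1.
  rewrite big_mkcond [leRHS]big_mkcond.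
  apply: le_trans (ler_sum_widen _ ay (leqnn s)).
    by apply: ler_sum => i _; rewrite /= -ltNge; case: ifP.
  by move=> i; case: ifP.
by rewrite -nR; lra.
Qed.

(** Let [s] be the first point where the average from [a] is at most [lam]; the bound on averages
    ending at [z] makes it exist. Before [s], a quarter of the points are above [dens lam], while
    the mass up to [s] is at most [2 lam (s - a)]: hence the 8. The point [s] itself is not in the
    level set, and one restarts from [s.+1]. *)
Lemma level_mass p C L v lam z : 1 < p -> 0 <= C -> (forall i, 0 <= v i) ->
  Ainf p C L v -> 0 < lam -> (z < L)%N -> forall a,
  (forall x, (a <= x <= z)%N -> \sum_(x <= i < z.+1) v i <= lam * (z.+1 - x)%:R) ->
  \sum_(a <= x < z.+1 | lam < v x) v x <=
  8 * lam * \sum_(a <= x < z.+1 | dens p C * lam < v x) (1 : R).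
Proof.
move=> p1 C0 v0 A lam0 zL a.
move: {2}(z.+1 - a)%N (leqnn (z.+1 - a)) => k; elim: k a => [|k IH] a.
  by rewrite leqn0 subn_eq0 => za H; rewrite !big_geq// mulr0.
move=> ak H.
have [za|az] := leqP z.+1 a; first by rewrite !big_geq// mulr0.
have dle x : lam < v x -> dens p C * lam < v x.
  move=> h; apply: le_lt_trans h; rewrite -[leRHS]mul1r ler_wpM2r ?(ltW lam0)//.
  by apply: dens_le1 => //; exact: ltW.
have exs : exists s, (a <= s)%N && (\sum_(a <= i < s.+1) v i <= lam * (s.+1 - a)%:R).
  by exists z; rewrite -ltnS az/= H// leqnn.
case: (ex_minnP exs) => s /andP[as_ Hs] mins.
have sz : (s <= z)%N by apply: mins; rewrite -ltnS az/= H// leqnn.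
have Hlt x : (a <= x < s)%N -> lam * (x.+1 - a)%:R < \sum_(a <= i < x.+1) v i.
  move=> /andP[ax xs]; rewrite ltNge; apply/negP => h.
  by have := mins x; rewrite ax h => /(_ isT); rewrite leqNgt xs.
have vs : ~~ (lam < v s).
  rewrite -leNgt; move: as_; rewrite leq_eqVlt => /predU1P[aE|as_].
    by move: Hs; rewrite aE big_nat1 subSnn mulr1.
  have := Hlt s.-1 ltac:(lia); rewrite prednK ?(leq_trans _ as_)// => h.
  move: Hs; rewrite big_nat_recr//=; last exact: ltnW.
  have -> : (s.+1 - a)%:R = (s - a)%:R + 1 :> R by rewrite natr1; congr _%:R; lia.
  lra.
have sz1 : (s.+1 <= z.+1)%N by [].
have IHs : \sum_(s.+1 <= x < z.+1 | lam < v x) v x <=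
    8 * lam * \sum_(s.+1 <= x < z.+1 | dens p C * lam < v x) 1.
  apply: IH => [|x /andP[sx xz]]; first by lia.
  by apply: H; rewrite xz andbT; lia.
rewrite (@big_cat_nat _ _ _ s a z.+1)//=; last exact: leqW.
rewrite [in leRHS](@big_cat_nat _ _ _ s a z.+1)//=; last exact: leqW.
rewrite mulrDr lerD//.
  move: as_; rewrite leq_eqVlt => /predU1P[<-|as_]; first by rewrite !big_geq// mulr0.
  have := @run_density p C L v lam a s p1 C0 v0 A lam0 ltac:(lia) Hlt.
  have : \sum_(a <= x < s | lam < v x) v x <= \sum_(a <= i < s.+1) v i.
    rewrite big_mkcond; apply: le_trans (ler_sum_widen v0 (leqnn a) (leqnSn s)).
    by apply: ler_sum => i _; case: ifP.
  have : (s.+1 - a)%:R <= 2 * (s - a)%:R :> R by rewrite -natrM ler_nat; lia.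
  move: Hs; set m' := \sum_(a <= i < s.+1) v i; set m := \sum_(a <= x < s | _) v x.
  set d := \sum_(a <= x < s | _) 1; set k1 : R := (s.+1 - a)%:R; set k2 : R := (s - a)%:R.
  by clearbody m m' d k1 k2 => h1 h2 h3 h4; nra.
rewrite big_mkcond big_ltn//= (negPf vs) add0r -big_mkcond/=.
apply: (le_trans IHs); rewrite ler_wpM2l ?mulr_ge0 ?(ltW lam0)//.
by rewrite [leRHS]big_mkcond [leRHS]big_ltn//= -big_mkcond/= lerDr; case: ifP.
Qed.

(** Layer cake in telescoped form. The factor [2 ^ eta - 1] tends to 0 with [eta], and this
    smallness permits the absorption in [reverse_holder]. *)
Lemma geo_cover_diff eta (c t : R) (K : nat) : 0 < eta -> 0 < c -> 0 <= t -> t <= c * 2 ^+ K ->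
  t `^ eta <= c `^ eta +
    \sum_(0 <= k < K | c * 2 ^+ k < t) (2 `^ eta - 1) * (c * 2 ^+ k) `^ eta.
Proof.
move=> eta0 c0 t0; have th1 := two_powR_gt1 eta0.
elim: K => [|K IH] tc.
  rewrite big_geq// addr0; apply: le_powR => //.
  by rewrite expr0 mulr1 in tc.
rewrite big_mkcond big_nat_recr//= -big_mkcond/=.
case: ifPn => [h|]; last by rewrite -leNgt addr0 => /IH.
have E : \sum_(0 <= k < K | c * 2 ^+ k < t) (2 `^ eta - 1) * (c * 2 ^+ k) `^ eta =
    (c * 2 ^+ K) `^ eta - c `^ eta.
  have -> : (c * 2 ^+ K) `^ eta - c `^ eta =
      \sum_(0 <= k < K) ((c * 2 ^+ k.+1) `^ eta - (c * 2 ^+ k) `^ eta).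
    by rewrite telescope_sumr// expr0 mulr1.
  rewrite big_nat_cond [RHS]big_nat_cond; apply: eq_big => [k|k /andP[/andP[_ kK] _]].
    rewrite andbT; case: (ltnP k K) => //= kK.
    apply: lt_trans h; rewrite ltr_pM2l// ltr_eXn2l//; lra.
  have c2 : 0 <= c * 2 ^+ k by rewrite mulr_ge0 ?exprn_ge0// ltW.
  have -> : (c * 2 ^+ k.+1) `^ eta = 2 `^ eta * (c * 2 ^+ k) `^ eta.
    by rewrite exprS mulrCA (powRM _ (ler0n _ 2) c2).
  by ring.
rewrite E addrA subrKC -[X in X + _]mul1r -mulrDl subrKC.
apply: (@le_trans _ _ ((2 * (c * 2 ^+ K)) `^ eta)).
  by apply: le_powR => //; rewrite mulrCA -exprS.
by apply: eq_le; rewrite powRM// mulr_ge0 ?exprn_ge0// ltW.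
Qed.

Lemma powRE (x t : R) : x `^ t = if x == 0 then (t == 0)%:R else expR (t * ln x).
Proof. exact: erefl. Qed.

Lemma two_powR_near1 (e : R) : 0 < e <= 1 ->
  exists eta : R, [/\ 0 < eta, eta <= 1 & 2 `^ eta = 1 + e].
Proof.
move=> /andP[e0 e1]; have l2 : 0 < ln (2 : R) by rewrite ln_gt0//; lra.
exists (ln (1 + e) / ln 2); split.
- by rewrite divr_gt0// ln_gt0//; lra.
- by rewrite ler_pdivrMr// mul1r ler_ln ?posrE//; lra.
- rewrite powRE pnatr_eq0/= divfK ?gt_eqF// lnK// posrE; lra.
Qed.

(** Gehring's argument. [left_averages_point] provides an end point [z] at which all averages to the
    left are at most [l0], so that [level_mass] applies at every level above [l0]. Integrating over
    the levels reproduces [X] on the right with a small factor, and [X] is absorbed. *)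
Lemma reverse_holder p C : 1 < p -> 0 <= C -> exists2 eta : R, 0 < eta &
  forall L v, (forall i, 0 < v i) -> Ainf p C L v ->
  forall a b c, (a <= b < c)%N -> (c <= L)%N ->
  \sum_(a <= i < b) v i `^ (1 + eta) <=
  4 * ((\sum_(a <= i < c) v i) / (c - b)%:R) `^ eta * \sum_(a <= i < c) v i.
Proof.
move=> p1 C0; set th := dens p C.
have th0 : 0 < th by exact: dens_gt0.
have th1 : th <= 1 by apply: dens_le1 => //; exact: ltW.
(* The integration over levels costs [16 / th ^ 2]: 8 from [level_mass], 2 from [geoC (1 + eta)],
   and [th ^ (- 1 - eta) <= th ^ (- 2)]. With this [eta] the product is 1 / 2. *)
have [|eta [eta0 eta1 etaE]] := @two_powR_near1 (th ^+ 2 / 32).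
  by rewrite divr_gt0 ?exprn_gt0//=; nra.
exists eta => // L v v0 A a b c abc cL; have /andP[ab bc] := abc.
have vge0 i : 0 <= v i by exact: ltW.
set V := \sum_(a <= i < c) v i; set d : R := (c - b)%:R.
have d0 : 0 < d by rewrite ltr0n subn_gt0.
have V0 : 0 < V.
  apply: lt_le_trans (v0 b) _; apply: ler_term_sum => //; exact: abc.
(* The 2 yields the strict inequality required by [left_averages_point]. *)
pose l0 := 2 * (V / d); have l00 : 0 < l0 by rewrite mulr_gt0// divr_gt0.
have [z /andP[bz zc] Hz] := @left_averages_point v l0 a b c abc vge0 (ltW l00)
  ltac:(by rewrite -/V -/d /l0 -mulrA divfK ?gt_eqF//; lra).
pose X := \sum_(a <= x < z.+1) v x `^ (1 + eta).
have X0 : 0 <= X by exact: sumr_ge0.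
apply: (@le_trans _ _ X).
  by apply: ler_sum_widen => //; exact: leqW.
have [K HK] := @expr2_unbounded R l0 V l00.
have vV x : (a <= x < z.+1)%N -> v x <= l0 * 2 ^+ K.
  move=> /andP[ax xz]; apply: le_trans (ltW HK).
  by apply: ler_term_sum => //; rewrite ax (leq_trans xz).
have Vz : \sum_(a <= x < z.+1) v x <= V by exact: ler_sum_widen.
have eE : 2 `^ eta - 1 = th ^+ 2 / 32 by rewrite etaE; ring.
have key : X <= l0 `^ eta * V + (2 `^ eta - 1) * (16 * (X / th ^+ 2)).
  have lev k : \sum_(a <= x < z.+1 | l0 * 2 ^+ k < v x) v x <=
      8 * (l0 * 2 ^+ k) * \sum_(a <= x < z.+1 | th * (l0 * 2 ^+ k) < v x) 1.
    apply: (@level_mass p C L) => //; first by rewrite mulr_gt0 ?exprn_gt0.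
      exact: leq_trans cL.
    move=> x /Hz/le_trans; apply; rewrite ler_wpM2r// ler_peMr ?(ltW l00)//.
    by rewrite exprn_ege1//; lra.
  have step x : (a <= x < z.+1)%N -> v x `^ (1 + eta) <= l0 `^ eta * v x +
      \sum_(0 <= k < K | l0 * 2 ^+ k < v x) (2 `^ eta - 1) * (l0 * 2 ^+ k) `^ eta * v x.
    move=> axz; rewrite powRD_pos// powRr1// -mulr_suml -mulrDl mulrC.
    by rewrite ler_wpM2r// geo_cover_diff// vV.
  rewrite {1}/X big_nat; apply: (le_trans (ler_sum _ step)); rewrite -big_nat.
  rewrite big_split/= -mulr_sumr lerD//; first by rewrite ler_wpM2l.
  under eq_bigr do rewrite big_mkcond.
  rewrite exchange_big/=.
  apply: (@le_trans _ _ (\sum_(0 <= k < K) (2 `^ eta - 1) * ((l0 * 2 ^+ k) `^ eta *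
      (8 * (l0 * 2 ^+ k) * \sum_(a <= x < z.+1 | th * (l0 * 2 ^+ k) < v x) 1)))).
    apply: ler_sum => k _; rewrite -big_mkcond -mulr_sumr -mulrA.
    rewrite ler_wpM2l ?subr_ge0 ?(ltW (two_powR_gt1 eta0))//.
    by rewrite ler_wpM2l.
  rewrite -mulr_sumr ler_wpM2l ?subr_ge0 ?(ltW (two_powR_gt1 eta0))//.
  have -> : \sum_(0 <= k < K) (l0 * 2 ^+ k) `^ eta *
      (8 * (l0 * 2 ^+ k) * \sum_(a <= x < z.+1 | th * (l0 * 2 ^+ k) < v x) 1) =
    8 * \sum_(a <= x < z.+1) \sum_(0 <= k < K | l0 * 2 ^+ k < v x / th)
       (l0 * 2 ^+ k) `^ (1 + eta).
    under [in RHS]eq_bigr do rewrite big_mkcond.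
    rewrite exchange_big/= mulr_sumr; apply: eq_bigr => k _.
    have lk : 0 < l0 * 2 ^+ k by rewrite mulr_gt0 ?exprn_gt0.
    rewrite -big_mkcond/= powRD_pos// powRr1 ?(ltW lk)//.
    have -> : \sum_(a <= i < z.+1 | l0 * 2 ^+ k < v i / th) l0 * 2 ^+ k * (l0 * 2 ^+ k) `^ eta =
        l0 * 2 ^+ k * (l0 * 2 ^+ k) `^ eta * \sum_(a <= x < z.+1 | th * (l0 * 2 ^+ k) < v x) 1.
      rewrite mulr_sumr; apply: eq_big => i; last by rewrite mulr1.
      by rewrite ltr_pdivlMr// mulrC.
    by ring.
  rewrite (_ : 16 * (X / th ^+ 2) = 8 * (2 * (X / th ^+ 2))); last by ring.
  rewrite ler_wpM2l// /X mulr_suml mulr_sumr; apply: ler_sum => x _.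
  apply: (le_trans (geo_up _ _ l00 _)); [lra|by rewrite divr_ge0// ltW|].
  apply: ler_pM => //; first by rewrite geoC_ge0//; lra.
    have h : (2 : R) `^ 1 <= 2 `^ (1 + eta) by apply: ler_powR; lra.
    rewrite powRr1// in h; rewrite /geoC ler_pdivrMr; lra.
  rewrite powR_div ?(ltW th0)// ler_wpM2l// lef_pV2 ?posrE ?powR_gt0 ?exprn_gt0//.
  rewrite -powR_mulrn ?(ltW th0)//; apply: ger_powR; first by rewrite th0.
  lra.
have {}key : X <= 2 * (l0 `^ eta * V).
  move: key; rewrite eE.
  have -> : th ^+ 2 / 32 * (16 * (X / th ^+ 2)) = X / 2.
    by field; rewrite gt_eqF.
  lra.
apply: (le_trans key); rewrite /l0 powRM ?divr_ge0 ?(ltW V0) ?(ltW d0)//.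
rewrite !mulrA ler_wpM2r ?(ltW V0)// ler_wpM2r//.
have : (2 : R) `^ eta <= 2 `^ 1 by apply: ler_powR; lra.
rewrite powRr1//; lra.
Qed.

End ReverseHolder.

(** * Openness of the one-sided Muckenhoupt condition *)

Section Openness.
Variable R : realType.
Implicit Types (w : nat -> R) (p s C eta : R) (a b c y j L : nat).

Lemma sum_nat_reflect (F : nat -> R) a b L : (b <= L)%N ->
  \sum_(a <= i < b) F (L.-1 - i)%N = \sum_(L - b <= i < L - a) F i.
Proof.
elim: b => [|b IH] bL; first by rewrite !big_geq// leq_sub2l.
have [ba|ab] := ltnP b a; first by rewrite !big_geq// leq_sub2l.
rewrite big_nat_recr//= IH; last exact: ltnW.
rewrite [RHS]big_ltn; last by nlia.
rewrite addrC (_ : (L.-1 - b)%N = (L - b.+1)%N); last by nlia.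
by congr (_ + \sum_(_ <= _ < _) _); nlia.
Qed.

Lemma sum_nat2 (F : nat -> R) y : \sum_(y <= i < y.+2) F i = F y + F y.+1.
Proof. by rewrite big_ltn// big_nat1. Qed.

Definition dualw p w : nat -> R := fun i => w i `^ (- (p - 1)^-1).

Lemma dualw_gt0 p w : (forall i, 0 < w i) -> forall i, 0 < dualw p w i.
Proof. by move=> w0 i; exact: powR_gt0. Qed.

(** The dual weight satisfies the dual condition in the opposite direction, hence the reflection in
    a window. Hoelder's inequality for [1 = w ^ (1 / p) w ^ (- 1 / p)] bounds the size of [E] by its
    two weights. *)
Lemma Ap_Ainf_dual p C L w : 1 < p -> 0 <= C -> (forall i, 0 < w i) -> Ap p C w ->
  Ainf (p / (p - 1)) (C `^ (p - 1)^-1) L (fun i => dualw p w (L.-1 - i)%N).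
Proof.
move=> p1 C0 w0 Aw a y c /andP[ay yc] cL E.
set sg := dualw p w; have sg0 : forall i, 0 < sg i by exact: dualw_gt0.
set q := p / (p - 1); have p0 : 0 < p by lra.
have q0 : 0 < q by rewrite divr_gt0//; lra.
have pq : p^-1 + q^-1 = 1 by rewrite /q; field; rewrite !gt_eqF//; lra.
pose E' := [pred i | E (L.-1 - i)%N].
pose Y := (L.-1 - y)%N; pose A := (L.-1 - a)%N; pose B := (L.-1 - c)%N.
have revE (F : nat -> R) : \sum_(y <= i < c.+1 | E i) F (L.-1 - i)%N =
    \sum_(B <= i < Y.+1 | E' i) F i.
  rewrite big_mkcond [RHS]big_mkcond.
  transitivity (\sum_(y <= i < c.+1) (fun j => if E' j then F j else 0) (L.-1 - i)%N).
    rewrite !big_nat; apply: eq_bigr => i /andP[yi ic] /=.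
    by rewrite (_ : (L.-1 - (L.-1 - i))%N = i)//; nlia.
  rewrite (@sum_nat_reflect (fun j => if E' j then F j else 0) y c.+1 L); last by nlia.
  by congr (\sum_(_ <= _ < _) _); rewrite /B /Y; nlia.
rewrite (sum_nat_reflect sg a (b := y.+1) (L := L)); last by nlia.
have -> : (L - y.+1)%N = Y by rewrite /Y; nlia.
have -> : (L - a)%N = A.+1 by rewrite /A; nlia.
rewrite (revE sg) (revE (fun=> 1)).
have -> : (c.+1 - a)%N = (A.+1 - B)%N by rewrite /A /B; nlia.
have BY : (B <= Y)%N by rewrite /B /Y; nlia.
have YA : (Y <= A)%N by rewrite /Y /A; nlia.
have := @sum_mul_le_lnorm R nat [seq i <- index_iota B Y.+1 | E' i] p q
  (fun i => w i `^ p^-1) (fun i => w i `^ (- p^-1)) p0 q0 pq.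
rewrite big_filter (eq_bigr (fun=> 1)); last first.
  by move=> i _; rewrite !ger0_norm// -powRD_pos// subrr powRr0.
set U := lnorm _ p _; set V := lnorm _ q _.
have U0 : 0 <= U by exact: lnorm_ge0.
have V0 : 0 <= V by exact: lnorm_ge0.
have UE : U `^ p = \sum_(B <= i < Y.+1 | E' i) w i.
  rewrite /U lnorm_powR ?gt_eqF// big_filter; apply: eq_bigr => i _.
  by rewrite ger0_norm// powRVK ?gt_eqF// ltW.
have VE : V `^ q = \sum_(B <= i < Y.+1 | E' i) sg i.
  rewrite /V lnorm_powR ?gt_eqF// big_filter; apply: eq_bigr => i _.
  rewrite ger0_norm// -powRrM /sg /dualw; congr (_ `^ _).
  by rewrite /q; field; rewrite !gt_eqF//; lra.
clearbody U V; set e := \sum_(_ <= _ < _ | _) 1 => He.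
have e0 : 0 <= e by exact: sumr_ge0.
have UW : U `^ q <= (\sum_(B <= i < Y.+1) w i) `^ (p - 1)^-1.
  have -> : q = p * (p - 1)^-1 by [].
  rewrite powRrM; apply: le_powR => //; first by rewrite invr_ge0; lra.
  rewrite UE big_mkcond; apply: ler_sum => i _.
  by case: ifP => _ //; exact: ltW.
have := Aw B Y A; rewrite BY YA => /(_ isT) H.
have S0 : 0 <= \sum_(Y <= i < A.+1) sg i by apply: sumr_ge0 => i _; exact: ltW.
have W0 : 0 <= \sum_(B <= i < Y.+1) w i by apply: sumr_ge0 => i _; exact: ltW.
have r0 : 0 <= (p - 1)^-1 by rewrite invr_ge0; lra.
have {}H := le_powR r0 (mulr_ge0 W0 (powR_ge0 _ _)) H.
rewrite !powRM ?ler0n// -(powRrM _ (p - 1)) mulfV ?gt_eqF ?subr_gt0// powRr1// in H.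
rewrite -powRrM -/q in H.
set S := \sum_(Y <= i < A.+1) sg i in S0 H *.
apply: (@le_trans _ _ (S * (U `^ q * V `^ q))).
  rewrite ler_wpM2l//; apply: le_trans (eq_le (powRM q U0 V0)).
  exact: le_powR.
rewrite VE; set v := \sum_(_ <= _ < _ | _) sg _.
have v0 : 0 <= v by apply: sumr_ge0 => i _; exact: ltW.
rewrite mulrA ler_wpM2r// mulrC; apply: le_trans H.
by rewrite ler_wpM2r.
Qed.

Lemma dual_reverse_holder p C : 1 < p -> 0 <= C -> exists2 eta : R, 0 < eta &
  forall w, (forall i, 0 < w i) -> Ap p C w -> forall a b c, (a < b <= c)%N ->
  \sum_(b <= i < c) dualw p w i `^ (1 + eta) <=
  4 * ((\sum_(a <= i < c) dualw p w i) / (b - a)%:R) `^ eta *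
  \sum_(a <= i < c) dualw p w i.
Proof.
move=> p1 C0; have q1 : 1 < p / (p - 1) by rewrite ltr_pdivlMr; lra.
have [eta eta0 H] := @reverse_holder R _ _ q1 (powR_ge0 C (p - 1)^-1).
exists eta => // w w0 Aw a b c /andP[ab bc].
have := H c _ (fun i => dualw_gt0 p w0 _) (@Ap_Ainf_dual p C c w p1 C0 w0 Aw)
  0%N (c - b)%N (c - a)%N ltac:(nlia) ltac:(nlia).
rewrite (sum_nat_reflect (fun i => dualw p w i `^ (1 + eta))); last by nlia.
rewrite (sum_nat_reflect (dualw p w)); last by nlia.
rewrite (_ : c - (c - b) = b)%N; last by nlia.
rewrite (_ : c - (c - a) = a)%N; last by nlia.
by rewrite (_ : c - a - (c - b) = b - a)%N ?subn0//; nlia.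
Qed.

Lemma powR_root_mul (x y s : R) : 0 < s -> 0 <= x -> 0 <= y ->
  (x * y `^ (s - 1)) `^ s^-1 = x `^ s^-1 * y `^ ((s - 1) / s).
Proof. by move=> s0 x0 y0; rewrite powRM// -powRrM. Qed.

Lemma gap_arith p s eta C (W T S h l : R) : 1 < s -> 0 < p -> 0 <= C ->
  (1 + eta) * (s - 1) = p - 1 -> 0 <= W -> 0 <= T -> 0 <= S -> 0 < h ->
  0 <= l -> l <= 6 * h -> T <= 4 * (S `^ (1 + eta) / h `^ eta) ->
  W * S `^ (p - 1) <= C * l `^ p ->
  W `^ s^-1 * T `^ ((s - 1) / s) <= (4 `^ (s - 1) * C * 6 `^ p) `^ s^-1 * h.
Proof.
move=> s1 p0 C0 se W0 T0 S0 h0 l0 lh HT HW; have s0 : 0 < s by lra.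
have sm : 0 <= s - 1 by lra.
rewrite -powR_root_mul//.
have K0 : 0 <= 4 `^ (s - 1) * C * 6 `^ p by rewrite !mulr_ge0.
have hsK : (h `^ s) `^ s^-1 = h by rewrite powRK ?gt_eqF// ltW.
rewrite -[X in _ <= _ * X]hsK -(powRM _ K0 (powR_ge0 h s)).
apply: le_powR; [by rewrite invr_ge0 ltW|by rewrite mulr_ge0|].
have hs : h `^ p / (h `^ eta) `^ (s - 1) = h `^ s.
  rewrite -powRrM -powRN -powRD_pos//; congr (_ `^ _).
  have -> : p = 1 + (1 + eta) * (s - 1) by rewrite se; lra.
  by ring.
have Hq : T `^ (s - 1) <= 4 `^ (s - 1) * (S `^ (p - 1) / (h `^ eta) `^ (s - 1)).
  apply: le_trans (le_powR sm T0 HT) _.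
  apply: eq_le; rewrite powRM ?divr_ge0//; congr (_ * _).
  by rewrite powR_div// -powRrM se.
apply: (le_trans (ler_wpM2l W0 Hq)).
rewrite (_ : W * _ = 4 `^ (s - 1) * (W * S `^ (p - 1) / (h `^ eta) `^ (s - 1))); last by ring.
rewrite -!mulrA ler_wpM2l// -hs.
rewrite (_ : C * (6 `^ p * (h `^ p / (h `^ eta) `^ (s - 1))) =
  C * (6 `^ p * h `^ p) / (h `^ eta) `^ (s - 1)); last by ring.
rewrite mulrA ler_wpM2r ?invr_ge0//.
apply: (le_trans HW); rewrite ler_wpM2l// -powRM// ?(ltW h0)//.
by apply: le_powR => //; exact: ltW.
Qed.

(** With [(1 + eta) (s - 1) = p - 1] the dual weight for [s] is the power [1 + eta] of the dual
    weight for [p]. The reverse Hoelder inequality needs extra room on the left, so it only treats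
    windows separated by a gap comparable to their size. Adjacent windows are cut dyadically: [G] is
    subadditive in each window and a separated pair at scale [h] costs [B h], so the scales form a
    geometric sum. *)
Lemma Ap_open p C : 1 < p -> 0 <= C -> exists s, exists2 C', 1 < s < p /\ 0 <= C' &
  forall w, (forall i, 0 < w i) -> Ap p C w -> Ap s C' w.
Proof.
move=> p1 C0; have [eta eta0 RH] := dual_reverse_holder p1 C0.
pose s := 1 + (p - 1) / (1 + eta).
have e1 : 0 < 1 + eta by lra.
have s1 : 1 < s by rewrite /s ltrDl divr_gt0//; lra.
have sp : s < p.
  suff : (p - 1) / (1 + eta) < p - 1 by rewrite /s; lra.
  by rewrite ltr_pdivrMr// ltr_pMr; lra.
have s0 : 0 < s by lra.
have p0 : 0 < p by lra.
have se : (1 + eta) * (s - 1) = p - 1 by rewrite /s addrAC subrr add0r mulrC divfK ?gt_eqF.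
clearbody s.
pose B0 := 4 `^ (s - 1) * C * 6 `^ p.
have B00 : 0 <= B0 by rewrite !mulr_ge0.
pose B := B0 `^ s^-1; have B1 : 0 <= B by exact: powR_ge0.
exists s, ((8 * B) `^ s); first by split; [apply/andP|exact: powR_ge0].
move=> w w0 Aw.
have wge0 i : 0 <= w i by exact: ltW.
pose sg := dualw p w; have sg0 i : 0 < sg i by exact: dualw_gt0.
have sge0 i : 0 <= sg i by exact: ltW.
pose tau i := w i `^ (- (s - 1)^-1).
have tauE i : tau i = sg i `^ (1 + eta).
  rewrite /tau /sg /dualw -powRrM; congr (_ `^ _).
  by rewrite -se; field; rewrite !gt_eqF//; lra.
have tau0 i : 0 <= tau i by exact: powR_ge0.
have RHw : forall a b c, (a < b <= c)%N -> \sum_(b <= i < c) sg i `^ (1 + eta) <=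
    4 * ((\sum_(a <= i < c) sg i) / (b - a)%:R) `^ eta * \sum_(a <= i < c) sg i :=
  RH w w0 Aw.
have Aw' : forall a y c, (a <= y <= c)%N -> (\sum_(a <= i < y.+1) w i) *
    (\sum_(y <= i < c.+1) sg i) `^ (p - 1) <= C * (c.+1 - a)%:R `^ p := Aw.
suff : forall a y c, (a <= y <= c)%N -> (\sum_(a <= i < y.+1) w i) *
    (\sum_(y <= i < c.+1) tau i) `^ (s - 1) <= (8 * B) `^ s * (c.+1 - a)%:R `^ s by [].
move: RHw Aw'; clear RH Aw; clearbody sg tau => RH Aw.
have kp : 0 < (s - 1) / s by rewrite divr_gt0//; lra.
have k1 : (s - 1) / s <= 1 by rewrite ler_pdivrMr// mul1r; lra.
pose W a b := \sum_(a <= i < b) w i.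
pose T a b := \sum_(a <= i < b) tau i.
have W0 a b : 0 <= W a b by exact: sum_nat_ge0.
have T0 a b : 0 <= T a b by exact: sum_nat_ge0.
pose G a b c d := W a b `^ s^-1 * T c d `^ ((s - 1) / s).
have gap a y b c h : (a <= y)%N -> (y < b)%N -> (b <= c)%N -> (0 < h)%N ->
    (h <= b - y)%N -> (c - a <= 6 * h)%N -> G a y.+1 b c <= B * h%:R.
  move=> ay yb bc h0 hb ch.
  have hR : 0 < h%:R :> R by rewrite ltr0n.
  have S0 : 0 <= \sum_(y <= i < c) sg i by exact: sum_nat_ge0.
  have := RH y b c; rewrite yb bc => /(_ isT).
  set S := \sum_(y <= i < c) sg i in S0 * => H.
  have {}H : T b c <= 4 * (S `^ (1 + eta) / h%:R `^ eta).
    rewrite /T; under eq_bigr do rewrite tauE; apply: (le_trans H).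
    rewrite powR_div// -!mulrA ler_wpM2l//.
    have -> : S `^ (1 + eta) = S `^ eta * S.
      have := S0; rewrite le_eqVlt => /predU1P[<-|Sp].
        by rewrite mulr0 powR0// gt_eqF.
      by rewrite powRD_pos// powRr1// mulrC.
    rewrite -mulrA ler_wpM2l// mulrC ler_wpM2l// lef_pV2 ?posrE ?powR_gt0//.
      by apply: le_powR; rewrite ?ler_nat// ltW.
    by rewrite ltr0n subn_gt0.
  have cE : c = c.-1.+1 by nlia.
  have := Aw a y c.-1; rewrite -cE ay (_ : y <= c.-1)%N; last by nlia.
  move=> /(_ isT); rewrite -/S -/(W a y.+1) => HA.
  apply: (gap_arith s1 p0 C0 se _ _ S0 hR _ _ H HA) => //.
  by rewrite -natrM ler_nat.
(* Doubling the scale adds one far piece on each side, at cost [B h] each: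
   [4 B h + 2 B h <= 4 B (2 h)]. *)
have claim j : forall y, G (y - 2 ^ j)%N y.+1 y (y + 2 ^ j).+1 <= 4 * B * (2 ^ j)%:R.
  elim: j => [|j IH] y.
    rewrite expn0 addn1.
    apply: (@le_trans _ _ (B * 1)); last by rewrite !mulr1; lra.
    have := Aw (y - 1)%N y y.+1; rewrite leq_subr leqnSn => /(_ isT) HA.
    apply: (gap_arith s1 p0 C0 se _ _ _ ltr01 _ _ _ HA) => //.
    - exact: sum_nat_ge0.
    - exact: sum_nat_ge0.
    - by rewrite mulr1 (ler_nat _ _ 6); nlia.
    (* At scale 1 the superadditivity of the power [1 + eta] replaces the reverse Hoelder
       inequality. *)
    - rewrite powR1 divr1 /T !sum_nat2 !tauE.
      apply: (@le_trans _ _ ((sg y + sg y.+1) `^ (1 + eta))); last first.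
        by rewrite ler_peMl//; lra.
      by apply: powR_superadd => //; lra.
  set h := (2 ^ j)%N; have h0 : (0 < h)%N by rewrite expn_gt0.
  have hE : (2 ^ j.+1 = h + h)%N by rewrite expnS mul2n addnn.
  rewrite hE natrD.
  have T_split : T y (y + (h + h)).+1 `^ ((s - 1) / s) <=
      T y (y + h).+1 `^ ((s - 1) / s) + T (y + h).+1 (y + (h + h)).+1 `^ ((s - 1) / s).
    rewrite {1}/T (@sum_cat _ _ y (y + h).+1)//; try nlia.
    by apply: powR_subadd => //; [exact: T0|exact: T0].
  have near := IH y; rewrite -/h in near.
  have right : G (y - h)%N y.+1 (y + h).+1 (y + (h + h)).+1 <= B * h%:R.
    by apply: gap => //; nlia.
  have nearAll : W (y - h)%N y.+1 `^ s^-1 * T y (y + (h + h)).+1 `^ ((s - 1) / s) <=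
      4 * B * h%:R + B * h%:R.
    apply: (le_trans (ler_wpM2l (powR_ge0 _ _) T_split)).
    by rewrite mulrDr lerD.
  have hR : 0 <= B * h%:R by rewrite mulr_ge0.
  (* Near the origin truncated subtraction cuts off the left window and there is no far left piece;
     for [y = h] that piece is empty and has no last point. *)
  have [hy|yh] := leqP h y; last first.
    rewrite /G (_ : (y - (h + h) = y - h)%N); last by nlia.
    by apply: (le_trans nearAll); rewrite mulrDr; lra.
  have [yh0|yh] := eqVneq y h.
    rewrite /G (_ : (y - (h + h) = y - h)%N); last by nlia.
    by apply: (le_trans nearAll); rewrite mulrDr; lra.
  have far : G (y - (h + h))%N (y - h)%N y (y + (h + h)).+1 <= B * h%:R.
    rewrite {1}(_ : (y - h = (y - h).-1.+1)%N); last by nlia.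
    by apply: gap => //; nlia.
  have W_split : W (y - (h + h))%N y.+1 `^ s^-1 <=
      W (y - (h + h))%N (y - h)%N `^ s^-1 + W (y - h)%N y.+1 `^ s^-1.
    rewrite {1}/W (@sum_cat _ _ _ (y - h)%N)//; try nlia.
    by apply: powR_subadd; rewrite ?invr_gt0 ?invf_le1 ?W0//; lra.
  apply: (le_trans (ler_wpM2r (powR_ge0 _ _) W_split)); rewrite mulrDl.
  apply: (le_trans (lerD far nearAll)); rewrite mulrDr.
  by lra.
move=> a y c /andP[ay yc].
set l := (c.+1 - a)%N; pose j := (trunc_log 2 l).+1.
have l0 : (0 < l)%N by rewrite /l; nlia.
have /andP[lj jl] : (2 ^ (trunc_log 2 l) <= l < 2 ^ j)%N by apply: trunc_log_bounds.
have Gl : G a y.+1 y c.+1 <= 8 * B * l%:R.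
  apply: (@le_trans _ _ (G (y - 2 ^ j)%N y.+1 y (y + 2 ^ j).+1)).
    apply: ler_pM => //; apply: le_powR; rewrite ?W0 ?T0 ?invr_ge0 ?(ltW kp) ?(ltW s0)//.
      by apply: ler_sum_widen => //; rewrite /l in jl; nlia.
    by apply: ler_sum_widen => //; rewrite /l in jl; nlia.
  apply: (le_trans (claim j y)).
  have : (2 ^ j)%:R <= 2 * l%:R :> R by rewrite -natrM ler_nat /j expnS leq_mul2l.
  have -> : 8 * B * l%:R = 4 * B * (2 * l%:R) by ring.
  by apply: ler_wpM2l; rewrite mulr_ge0.
rewrite -powRM ?mulr_ge0//.
apply: root_le_powR => //; first by apply: mulr_ge0 => //; exact: sum_nat_ge0.
by rewrite powR_root_mul; [exact: Gl|done|exact: sum_nat_ge0|exact: sum_nat_ge0].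
Qed.

End Openness.

(** * The vector-valued variation operator *)

Lemma two_mul_lt_add (R : realType) (l a b : R) : 2 * l < a + b -> (l < a) || (l < b).
Proof. by apply: contraTT; rewrite negb_or -!leNgt => /andP[la lb]; lra. Qed.

Section VectorOperator.
Variables (R : realType) (q rho : R) (K : finType).
Hypotheses (q1 : 1 <= q) (rho1 : 1 <= rho).
Implicit Types (f g h : K -> nat -> R) (w : nat -> R) (n N M L : nat) (lam : R).

Definition av (f : nat -> R) n N : R := (\sum_(n <= i < (n + N).+1) f i) / N.+1%:R.

Definition vnm f n : R := lnorm (index_enum K) rho (fun k => f k n).

Definition VT M f n : R := lnorm (index_enum K) rho (fun k => vari q M (av (f k) n)).

Definition supp_lt L f : Prop := forall k i, (L <= i)%N -> f k i = 0.

(** [M] truncates the variation and [L] bounds the support. The constant depends on neither, so that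
    both can be enlarged at will in the transfer to the integers. *)
Definition weakT s C w : Prop := forall M L f lam, supp_lt L f -> 0 < lam ->
  lam `^ s * \sum_(0 <= n < L | lam < VT M f n) w n <=
  C * \sum_(0 <= n < L) vnm f n `^ s * w n.

Definition strongT s C w : Prop := forall M L f, supp_lt L f ->
  \sum_(0 <= n < L) VT M f n `^ s * w n <= C * \sum_(0 <= n < L) vnm f n `^ s * w n.

Let rho0 : 0 < rho. Proof. exact: lt_le_trans rho1. Qed.
Let rhoN0 : rho != 0. Proof. by rewrite gt_eqF. Qed.

Lemma VT_ge0 M f n : 0 <= VT M f n. Proof. exact: lnorm_ge0. Qed.

Lemma vnm_ge0 f n : 0 <= vnm f n. Proof. exact: lnorm_ge0. Qed.

Lemma eq_av (f g : nat -> R) n N : (forall i, (n <= i <= n + N)%N -> f i = g i) ->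
  av f n N = av g n N.
Proof.
move=> fg; rewrite /av; congr (_ / _); rewrite !big_nat.
by apply: eq_bigr => i; rewrite ltnS; exact: fg.
Qed.

Lemma avD (f g : nat -> R) n N : av (fun i => f i + g i) n N = av f n N + av g n N.
Proof. by rewrite /av big_split/= mulrDl. Qed.

Lemma vnm_split f g h n : (forall k, f k n = g k n + h k n) ->
  vnm f n <= vnm g n + vnm h n.
Proof.
move=> fgh; apply: le_trans (lnormD _ _ _ rho1).
by apply: eq_le; apply: eq_lnorm.
Qed.

Lemma le_vari_lnorm M (F G H : K -> nat -> R) :
  (forall k N, (N <= M)%N -> F k N = G k N + H k N) ->
  lnorm (index_enum K) rho (fun k => vari q M (F k)) <=
  lnorm (index_enum K) rho (fun k => vari q M (G k)) +
  lnorm (index_enum K) rho (fun k => vari q M (H k)).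
Proof.
move=> FGH; apply: le_trans (lnormD _ _ _ rho1); apply: lnorm_le => // k.
rewrite (ger0_norm (vari_ge0 _ _ _)) ger0_norm ?addr_ge0 ?vari_ge0//.
apply: le_trans (variD _ _ _ q1).
by apply: eq_le; apply: eq_vari => N NM; exact: FGH.
Qed.

Lemma VT_split M f g h n : (forall k i, f k i = g k i + h k i) ->
  VT M f n <= VT M g n + VT M h n.
Proof.
move=> fgh; apply: le_vari_lnorm => k N _.
by rewrite -avD; apply: eq_av => i _; rewrite fgh.
Qed.

Lemma eq_VT M f g n : (forall k i, (n <= i)%N -> f k i = g k i) -> VT M f n = VT M g n.
Proof.
move=> fg; apply: eq_lnorm => k; apply: eq_vari => N _.
by apply: eq_av => i /andP[ni _]; exact: fg.
Qed.

Lemma eq_vnm f g n : (forall k, f k n = g k n) -> vnm f n = vnm g n.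
Proof. by move=> fg; exact: eq_lnorm. Qed.

Lemma vnm0 f n : (forall k, f k n = 0) -> vnm f n = 0.
Proof. by move=> f0; rewrite /vnm (@eq_lnorm _ _ _ _ _ (fun=> 0))// lnorm0. Qed.

Lemma VT0 M f n : (forall k i, (n <= i)%N -> f k i = 0) -> VT M f n = 0.
Proof.
move=> f0; rewrite (@eq_VT _ _ (fun _ _ => 0))// /VT.
rewrite (@eq_lnorm _ _ _ _ _ (fun=> 0)) ?lnorm0// => k.
by apply: vari_const => // N _; rewrite /av !big1// !mul0r.
Qed.

Lemma VT_supp M L f n : supp_lt L f -> (L <= n)%N -> VT M f n = 0.
Proof. by move=> fL Ln; apply: VT0 => k i ni; apply: fL; exact: leq_trans ni. Qed.

Lemma vnm_sum f (r : seq nat) : lnorm (index_enum K) rho (fun k => \sum_(i <- r) `|f k i|) <=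
  \sum_(i <- r) vnm f i.
Proof.
apply: le_trans (lnorm_sum _ _ _ _ rho1) _.
by apply: ler_sum => i _; rewrite lnorm_abs.
Qed.



(** Interpolation on the levels [c 2 ^ k]. The function is cut at height [lam] and [T] tested at
    [2 lam]; this 2 and the ratio of consecutive levels give [4 ^ p]. *)
Lemma marcinkiewicz_sum (p p0 p1 C0 C1 : R) (w F T : nat -> R) L :
  0 < p0 -> p0 < p -> p < p1 -> 0 <= C0 -> 0 <= C1 ->
  (forall n, 0 <= w n) -> (forall n, 0 <= F n) -> (forall n, 0 <= T n) ->
  (forall lam, 0 < lam -> lam `^ p * \sum_(0 <= n < L | 2 * lam < T n) w n <=
    \sum_(0 <= n < L) (C0 * ((lam < F n)%R%:R * lam `^ (p - p0)) * F n `^ p0 +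
                       C1 * ((F n <= lam)%R%:R * lam `^ (p - p1)) * F n `^ p1) * w n) ->
  \sum_(0 <= n < L) T n `^ p * w n <=
  4 `^ p * (C0 * geoC (p - p0) + C1 * geoC (p1 - p)) * \sum_(0 <= n < L) F n `^ p * w n.
Proof.
move=> p00 p0p pp1 C00 C10 w0 F0 T0 split_level.
have pp : 0 < p by lra.
have e0 : 0 < p - p0 by lra.
have e1 : 0 < p1 - p by lra.
apply/ler_addgt0Pr => e epos.
pose Z := \sum_(0 <= n < L) w n; have Z0 : 0 <= Z by exact: sumr_ge0.
(* With this [c], the values of [T] below [2 c] contribute at most [e] in total, because the window
   has finite weight. *)
pose c := (e / (Z + 1)) `^ p^-1 / 2.
have eZ : 0 < e / (Z + 1) by rewrite divr_gt0//; lra.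
have c0 : 0 < c by rewrite divr_gt0// powR_gt0.
have cE : (2 * c) `^ p * Z <= e.
  have -> : 2 * c = (e / (Z + 1)) `^ p^-1 by rewrite /c mulrC divfK.
  rewrite powRVK ?(gt_eqF pp) ?(ltW eZ)//.
  by rewrite mulrAC ler_pdivrMr; nra.
pose B := \sum_(0 <= n < L) T n.
have [J HJ] := @expr2_unbounded R (2 * c) B ltac:(lra).
have key n : (0 <= n < L)%N -> T n `^ p <= (2 * c) `^ p +
    \sum_(0 <= k < J) 4 `^ p * ((2 * (c * 2 ^+ k) < T n)%R%:R * (c * 2 ^+ k) `^ p).
  move=> nL; have [Tc|cT] := leP (T n) (2 * c).
    apply: (@le_trans _ _ ((2 * c) `^ p)); first exact: le_powR.
    by rewrite lerDl; apply: sumr_ge0 => k _; rewrite !mulr_ge0.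
  have TJ : T n <= 2 * c * 2 ^+ J.
    by apply: le_trans (ltW HJ); apply: ler_term_sum.
  apply: (le_trans (geo_cover (ltW pp) _ cT TJ)); first by lra.
  rewrite -[leLHS]add0r lerD// big_mkcond; apply: ler_sum => k _.
  rewrite -mulrA; case: ifP => _; rewrite ?mul0r ?mulr0// mul1r.
  apply: eq_le; rewrite -powRM ?mulr_ge0 ?exprn_ge0 ?(ltW c0)//.
  by congr (_ `^ _); rewrite exprS; ring.
apply: (@le_trans _ _ ((2 * c) `^ p * Z + 4 `^ p * \sum_(0 <= k < J)
    ((c * 2 ^+ k) `^ p * \sum_(0 <= n < L | 2 * (c * 2 ^+ k) < T n) w n))).
  apply: (@le_trans _ _ (\sum_(0 <= n < L) ((2 * c) `^ p * w n + \sum_(0 <= k < J)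
      4 `^ p * ((2 * (c * 2 ^+ k) < T n)%R%:R * (c * 2 ^+ k) `^ p) * w n))).
    rewrite big_nat [leRHS]big_nat; apply: ler_sum => n nL.
    by rewrite -mulr_suml -mulrDl ler_wpM2r// key.
  rewrite big_split/= -mulr_sumr lerD// exchange_big/= mulr_sumr; apply: ler_sum => k _.
  rewrite [in leRHS]sum_indicator !mulr_sumr; apply: eq_le; apply: eq_bigr => n _.
  by ring.
rewrite addrC lerD// -mulrA ler_wpM2l//.
apply: (@le_trans _ _ (\sum_(0 <= k < J) \sum_(0 <= n < L)
   (C0 * ((c * 2 ^+ k < F n)%R%:R * (c * 2 ^+ k) `^ (p - p0)) * F n `^ p0 +
    C1 * ((F n <= c * 2 ^+ k)%R%:R * (c * 2 ^+ k) `^ (p - p1)) * F n `^ p1) * w n)).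
  by apply: ler_sum => k _; apply: split_level; rewrite mulr_gt0 ?exprn_gt0.
rewrite exchange_big/= mulr_sumr; apply: ler_sum => n _.
rewrite -mulr_suml mulrA ler_wpM2r// big_split/= mulrDl lerD//.
  rewrite -mulr_suml -mulr_sumr -mulrA -[leRHS]mulrA ler_wpM2l//.
  rewrite -sum_indicator; have := F0 n; rewrite le_eqVlt => /predU1P[<-|Fn].
    by rewrite (@powR0 _ p0) ?(@powR0 _ p) ?gt_eqF// !mulr0.
  have -> : F n `^ p = F n `^ (p - p0) * F n `^ p0 by rewrite -powRD_pos// subrK.
  by rewrite mulrA ler_wpM2r// geo_up.
rewrite -mulr_suml -mulr_sumr -mulrA -[leRHS]mulrA ler_wpM2l//.
rewrite -sum_indicator; have := F0 n; rewrite le_eqVlt => /predU1P[<-|Fn].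
  by rewrite (@powR0 _ p1) ?(@powR0 _ p) ?gt_eqF// ?mulr0//; lra.
have -> : F n `^ p = F n `^ (- (p1 - p)) * F n `^ p1.
  by rewrite -powRD_pos// opprB subrK.
by rewrite mulrA ler_wpM2r// -[p - p1]opprB geo_down.
Qed.

Lemma marcinkiewicz (p p0 p1 C0 C1 : R) w : 0 < p0 -> p0 < p -> p < p1 ->
  0 <= C0 -> 0 <= C1 -> (forall n, 0 <= w n) -> weakT p0 C0 w -> weakT p1 C1 w ->
  strongT p (4 `^ p * (C0 * geoC (p - p0) + C1 * geoC (p1 - p))) w.
Proof.
move=> p00 p0p pp1 C00 C10 w0 W0 W1 M L f fL.
have z0 : (0 : R) `^ p0 = 0 by rewrite powR0// gt_eqF.
have z1 : (0 : R) `^ p1 = 0 by rewrite powR0// gt_eqF//; lra.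
apply: marcinkiewicz_sum => // lam lam0.
pose g k i := if lam < vnm f i then f k i else 0.
pose h k i := if lam < vnm f i then 0 else f k i.
have gL : supp_lt L g by move=> k i Li; rewrite /g fL//; case: ifP.
have hL : supp_lt L h by move=> k i Li; rewrite /h fL//; case: ifP.
have gF n : vnm g n = if lam < vnm f n then vnm f n else 0.
  case: ifPn => H; first by apply: eq_vnm => k; rewrite /g H.
  by apply: vnm0 => k; rewrite /g (negPf H).
have hF n : vnm h n = if lam < vnm f n then 0 else vnm f n.
  case: ifPn => H; first by apply: vnm0 => k; rewrite /h H.
  by apply: eq_vnm => k; rewrite /h (negPf H).
have Tgh n : VT M f n <= VT M g n + VT M h n.
  by apply: VT_split => k i; rewrite /g /h; case: ifP => _; rewrite ?addr0 ?add0r.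
have U : \sum_(0 <= n < L | 2 * lam < VT M f n) w n <=
    \sum_(0 <= n < L | lam < VT M g n) w n + \sum_(0 <= n < L | lam < VT M h n) w n.
  apply: ler_sum_predU => // n _ H; have := lt_le_trans H (Tgh n).
  exact: two_mul_lt_add.
apply: (le_trans (ler_wpM2l (powR_ge0 _ _) U)).
have pE r : lam `^ p = lam `^ (p - r) * lam `^ r by rewrite -powRD_pos// subrK.
rewrite mulrDr {1}(pE p0) (pE p1) -!mulrA.
apply: (le_trans (lerD (ler_wpM2l (powR_ge0 _ _) (W0 M L g lam gL lam0))
  (ler_wpM2l (powR_ge0 _ _) (W1 M L h lam hL lam0)))).
apply: eq_le; rewrite !mulr_sumr -big_split/=; apply: eq_bigr => n _.
rewrite gF hF; move: (vnm f n) => x; case: ltP => _ /=; rewrite ?z0 ?z1 ?mulr1n ?mulr0n; ring.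
Qed.

Lemma strongT_weakT s C w : 0 < s -> (forall n, 0 <= w n) -> strongT s C w -> weakT s C w.
Proof.
move=> s0 w0 H M L f lam fL lam0; apply: le_trans (H M L f fL).
rewrite mulr_sumr big_mkcond; apply: ler_sum => n _.
case: ifPn => [h|_]; last by rewrite mulr_ge0.
by rewrite ler_wpM2r//; apply: le_powR => //; exact: ltW.
Qed.

End VectorOperator.

(** * Runs of a set of natural numbers *)

Section Runs.
Variable P : pred nat.

(* [run_lo n] is the left end of the run of [P] containing [n], and [n] itself
   off [P]; its level sets are the runs of [P] and the points outside [P]. *)
Fixpoint run_lo n : nat :=
  if n is m.+1 then (if P m && P n then run_lo m else n) else 0%N.

Lemma run_loS n : run_lo n.+1 = if P n && P n.+1 then run_lo n else n.+1.
Proof. by []. Qed.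

Lemma run_lo_le n : (run_lo n <= n)%N.
Proof. by elim: n => // n IH; rewrite run_loS; case: ifP => // _; exact: leqW. Qed.

Lemma run_lo_homo n m : (n <= m)%N -> (run_lo n <= run_lo m)%N.
Proof.
move=> /subnK <-; elim: (m - n)%N => // k IH; apply: (leq_trans IH).
rewrite addSn run_loS; case: ifP => // _; exact: leqW (run_lo_le _).
Qed.

Lemma run_lo_out n : ~~ P n -> run_lo n = n.
Proof. by case: n => // n /negPf Pn; rewrite run_loS Pn andbF. Qed.

Lemma run_lo_next n : ~~ P n -> run_lo n.+1 = n.+1.
Proof. by move=> /negPf Pn; rewrite run_loS Pn. Qed.

Lemma run_lo_in n i : P n -> (run_lo n <= i <= n)%N -> run_lo i = run_lo n /\ P i.
Proof.
elim: n => [|n IH] Pn; first by rewrite leqn0 /= => /eqP ->.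
rewrite run_loS; case: ifPn => [/andP[Pn0 _]|Pf] /andP[h1 h2]; last first.
  have -> : i = n.+1 by apply/eqP; rewrite eqn_leq h2.
  by rewrite run_loS (negPf Pf).
move: h2; rewrite leq_eqVlt => /predU1P[->|h2]; first by rewrite run_loS Pn0 Pn.
by apply: IH => //; rewrite h1.
Qed.

Lemma run_lo_idem n : run_lo (run_lo n) = run_lo n.
Proof.
have [Pn|Pn] := boolP (P n); last by rewrite !(run_lo_out Pn).
by case: (@run_lo_in n (run_lo n) Pn _) => //; rewrite leqnn run_lo_le.
Qed.

Lemma run_lo_pred n : P n -> (0 < run_lo n)%N -> ~~ P (run_lo n).-1.
Proof.
move=> Pn l0; apply/negP => Pl.
have [h Pm] := @run_lo_in n (run_lo n) Pn ltac:(by rewrite leqnn run_lo_le).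
have := run_lo_idem n; move: l0 Pl Pm; case: (run_lo n) => // m _ /= Pm PmS.
rewrite Pm PmS /= => E; have := run_lo_le m.
by rewrite E ltnn.
Qed.

Lemma run_block L n : (forall i, P i -> (i < L)%N) -> P n ->
  exists b, [/\ (n <= b < L)%N, ~~ P b.+1,
    forall i, (run_lo i == run_lo n) = (run_lo n <= i <= b)%N &
    forall i, (run_lo n <= i <= b)%N -> P i].
Proof.
move=> PL Pn.
have exb : exists b, (n <= b)%N && ~~ P b.+1.
  exists L; rewrite (ltnW (PL _ Pn))/=; apply/negP => /PL.
  by rewrite ltnNge leqnSn.
case: (ex_minnP exb) => b /andP[nb Pb] minb.
have run i : (n <= i <= b)%N -> P i /\ run_lo i = run_lo n.
  elim: i => [|i IH] /andP[ni ib].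
    by move: ni; rewrite leqn0 => /eqP <-.
  move: ni; rewrite leq_eqVlt => /predU1P[<- //|ni].
  have [Pi loi] := IH ltac:(by rewrite -ltnS ni ltnW).
  have PiS : P i.+1.
    apply: contraT => h; have := minb i; rewrite -ltnS ni h => /(_ isT).
    by rewrite leqNgt ib.
  by rewrite run_loS Pi PiS.
have inb i : (run_lo n <= i <= b)%N -> P i /\ run_lo i = run_lo n.
  move=> /andP[li ib]; have [ni|ni] := leqP n i; first by apply: run; rewrite ni.
  by case: (@run_lo_in n i Pn _) => //; rewrite li ltnW.
exists b; split => //.
- by rewrite nb/=; apply: PL; case: (run b _) => //; rewrite nb leqnn.
- move=> i; apply/eqP/idP => [E|/inb[] //].
  rewrite -E run_lo_le/= leqNgt; apply/negP => bi.
  have := run_lo_homo bi; rewrite (run_lo_out Pb) E.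
  by apply/negP; rewrite -ltnNge ltnS (leq_trans (run_lo_le _)).
- by move=> i /inb[].
Qed.

End Runs.

Section LnormTools.
Variables (R : realType) (I : Type) (r : seq I).

(* The [t]-convexity of [l^p] for [t <= p]. *)
Lemma lnorm_convex_sum (t p C : R) (J : Type) (s : seq J) (u : I -> R) (v : J -> I -> R) :
  0 < t -> t <= p -> 0 <= C -> (forall i, 0 <= u i) -> (forall j i, 0 <= v j i) ->
  (forall i, u i `^ t <= C * \sum_(j <- s) v j i `^ t) ->
  lnorm r p u `^ t <= C * \sum_(j <- s) lnorm r p (v j) `^ t.
Proof.
move=> t0 tp C0 u0 v0 uv; have p0 : 0 < p by exact: lt_le_trans tp.
have pt1 : 1 <= p / t by rewrite ler_pdivlMr// mul1r.
have ptN : p / t != 0 by rewrite gt_eqF// divr_gt0.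
have E (x : I -> R) : (forall i, 0 <= x i) ->
    lnorm r p x `^ t = lnorm r (p / t) (fun i => x i `^ t).
  move=> x0; rewrite /lnorm -powRrM invf_div [p^-1 * t]mulrC; congr (_ `^ _).
  apply: eq_bigr => i _; rewrite !ger0_norm// -powRrM.
  by congr (_ `^ _); field; rewrite gt_eqF.
apply: (le_trans (eq_le (E u u0))).
have h1 : lnorm r (p / t) (fun i => u i `^ t) <=
    lnorm r (p / t) (fun i => C * \sum_(j <- s) v j i `^ t).
  apply: lnorm_le => [|i]; first exact: lt_le_trans pt1.
  by rewrite !ger0_norm ?mulr_ge0//; apply: sumr_ge0.
apply: (le_trans h1); rewrite lnormZ// ger0_norm//; apply: ler_wpM2l => //.
apply: (le_trans (lnorm_sum _ _ _ _ pt1)); apply: ler_sum => j _.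
exact: eq_le (esym (E _ (v0 j))).
Qed.

End LnormTools.

(** * Calderon-Zygmund decomposition *)

Lemma tailC_ge0 (R : realType) (t : R) : 1 < t -> 0 <= tailC t.
Proof.
move=> t1; have t0 : 0 < t - 1 by rewrite subr_gt0.
by apply: mulr_ge0; [apply: mulr_ge0|exact: geoC_ge0].
Qed.

Lemma powRN_scale (R : realType) (t a b : R) : 0 <= t -> 0 < a -> 0 < b -> b <= 2 * a ->
  a `^ (- t) <= 2 `^ t * b `^ (- t).
Proof.
move=> t0 a0 b0 ba; have -> : a `^ (- t) = 2 `^ t * (2 * a) `^ (- t).
  rewrite powRM ?(ltW a0)// mulrA -powRD_pos// subrr powRr0 mul1r//.
rewrite ler_wpM2l// !powRN lef_pV2 ?posrE ?powR_gt0 ?mulr_gt0//.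
by apply: le_powR => //; exact: ltW.
Qed.

Section RunGeometry.
Variables (R : realType) (w F : nat -> R) (lam C1 : R) (L : nat).
Hypotheses (w0 : forall n, 0 <= w n) (F0 : forall n, 0 <= F n) (lam0 : 0 < lam).
Hypotheses (C10 : 0 <= C1) (wA1 : A1 C1 w).
Hypothesis FL : forall n, (L <= n)%N -> F n = 0.

Let Om := msup F lam.
Let lo := run_lo Om.

(** Blocks are indexed by their left ends; a point outside [Om] is a block of its own, and an index
    that is no left end gives 0. So these sums partition the window. *)
Definition block_sum b (G : nat -> R) : R := \sum_(0 <= i < L | lo i == b) G i.

Lemma Om_lt n : Om n -> (n < L)%N.
Proof. exact: (msup_lt (ltW lam0) FL). Qed.

Lemma sum_block_sum (G : nat -> R) :
  \sum_(0 <= b < L) block_sum b G = \sum_(0 <= i < L) G i.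
Proof.
rewrite /block_sum; under eq_bigr do rewrite big_mkcond.
rewrite exchange_big/= big_nat [RHS]big_nat; apply: eq_bigr => i /andP[_ iL].
rewrite -big_mkcond/= big_mkcond (big_cat_nat (n := lo i))//=; last first.
  by apply: ltnW; apply: leq_ltn_trans iL; exact: run_lo_le.
rewrite big_nat big1 ?add0r; last first.
  by move=> b /andP[_ bl]; rewrite gtn_eqF.
rewrite big_ltn ?eqxx; last by apply: leq_ltn_trans iL; exact: run_lo_le.
rewrite big_nat big1 ?addr0// => b /andP[lb _].
by rewrite ltn_eqF.
Qed.

Lemma block_sumE n b (G : nat -> R) : (b < L)%N ->
  (forall i, (lo i == lo n) = (lo n <= i <= b)%N) ->
  block_sum (lo n) G = \sum_(lo n <= i < b.+1) G i.
Proof.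
move=> bL H; have lb : (lo n <= b)%N.
  by have := H (lo n); rewrite /lo run_lo_idem eqxx leqnn /= => <-.
rewrite /block_sum big_mkcond (big_cat_nat (n := lo n))//=; last first.
  by rewrite (leq_trans lb)// ltnW.
rewrite (big_cat_nat (n := b.+1) (m := lo n))//=; last exact: leqW.
rewrite big_nat big1 ?add0r; last first.
  by move=> i /andP[_ il]; rewrite H leqNgt il.
rewrite [X in _ + X]big_nat [X in _ + X]big1 ?addr0; last first.
  by move=> i /andP[bi _]; rewrite H leqNgt [(i <= b)%N]leqNgt bi/= andbF.
by rewrite !big_nat; apply: eq_bigr => i /andP[li ib]; rewrite H li -ltnS ib.
Qed.

(** The point just before the run is outside [Om], so averages starting there are at most [lam];
    including that point at most doubles the length. *)
Lemma run_mass_le n b : (n <= b)%N -> Om n -> (0 < lo n)%N ->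
  \sum_(lo n <= i < b.+1) F i <= 2 * (lam * (b.+1 - lo n)%:R).
Proof.
clear C10 wA1; move=> nb On l0; have := run_lo_pred On l0.
have lnb : (lo n <= b)%N by apply: leq_trans nb; exact: run_lo_le.
rewrite -/(lo n); move: l0 lnb; case: (lo n) => // m _ mb /= Hm.
have := @msupN R F lam m b.+1 Hm.
rewrite [X in X <= _ -> _]big_ltn; last exact: leqW.
move=> H.
have Fm := F0 m.
have : (b.+1 - m)%:R <= 2 * (b.+1 - m.+1)%:R :> R.
  by rewrite -natrM ler_nat; lia.
move=> h; have := ler_wpM2l (ltW lam0) h.
rewrite mulrCA; apply: le_trans; apply: le_trans H.
by rewrite lerDr.
Qed.

(** Read [w] backwards from [n]: by [A1] its averages are at most [C1 w n], and [tail_sum_le]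
    applies. For [x <= y - l] one has [n - x <= 2 (y - x)], hence the factor [2 ^ t]. *)
Lemma left_tail_weight t n l y : 1 < t -> (0 < l)%N -> (y <= n)%N -> (n < y + l)%N ->
  \sum_(0 <= x < y.+1 - l) w x * (y - x)%:R `^ (- t) <=
  2 `^ t * tailC t * C1 * w n * l%:R `^ (1 - t).
Proof.
move=> t1 l0 yn nl; have t0 : 0 <= t by exact: le_trans (ltW t1).
pose Q j := if (j <= n)%N then w (n - j)%N else 0.
have Q0 j : 0 <= Q j by rewrite /Q; case: ifP.
have QA m : \sum_(0 <= j < m) Q j <= C1 * w n * m%:R.
  have aux k : (k <= n.+1)%N -> \sum_(0 <= j < k) Q j <= C1 * w n * k%:R.
    case: k => [|k] kn; first by rewrite big_geq// mulr0.
    have -> : \sum_(0 <= j < k.+1) Q j = \sum_(0 <= j < k.+1) w (n.+1.-1 - j)%N.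
      by rewrite !big_nat; apply: eq_bigr => j /andP[_ jk]; rewrite /Q ifT// -ltnS (leq_trans jk).
    rewrite sum_nat_reflect// subn0.
    have := @wA1 (n.+1 - k.+1)%N n ltac:(lia).
    by rewrite subKn// mulrAC.
  have [mn|nm] := leqP m n.+1; first exact: aux.
  rewrite (@sum_cat _ _ 0 n.+1 m)//; last exact: ltnW.
  rewrite [X in _ + X]big_nat [X in _ + X]big1 ?addr0; last first.
    by move=> j /andP[nj _]; rewrite /Q leqNgt nj.
  apply: (le_trans (aux _ (leqnn _))).
  by rewrite ler_wpM2l ?mulr_ge0// ler_nat ltnW.
have H := @tail_sum_le R Q (C1 * w n) t l n.+1 t1 (mulr_ge0 C10 (w0 n)) Q0 QA l0.
apply: (@le_trans _ _ (2 `^ t * \sum_(l <= j < n.+1) Q j * j%:R `^ (- t))); last first.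
  apply: (le_trans (ler_wpM2l (powR_ge0 _ _) H)); apply: eq_le; ring.
apply: (@le_trans _ _ (2 `^ t * \sum_(0 <= x < y.+1 - l) (fun j => Q j * j%:R `^ (- t)) (n.+1.-1 - x)%N)).
  rewrite mulr_sumr big_nat [leRHS]big_nat; apply: ler_sum => x /andP[_ xy].
  have xn : (x <= n)%N by lia.
  rewrite /= /Q leq_subr subKn// mulrCA; apply: ler_wpM2l => //.
  have yx : 0 < (y - x)%:R :> R by rewrite ltr0n; lia.
  have nx : 0 < (n - x)%:R :> R by rewrite ltr0n; lia.
  by apply: powRN_scale; rewrite ?(ltW t1)// -natrM ler_nat; lia.
rewrite ler_wpM2l//; have yl : (y.+1 - l <= n.+1)%N by lia.
apply: (le_trans (eq_le (sum_nat_reflect (fun j => Q j * j%:R `^ (- t)) 0 yl))).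
have Qt j : 0 <= Q j * j%:R `^ (- t) by exact: mulr_ge0.
have [yl'|yl'] := leqP y.+1 l.
  by rewrite big_geq ?sum_nat_ge0//; lia.
by apply: ler_sum_widen => //; lia.
Qed.

(** The bound of [left_tail_weight] holds at every point of the run; sum it there against [F], whose
    mass is at least [lam l]. *)
Lemma run_left_tail t y b (l := (b.+1 - y)%N) : 1 < t -> (y <= b)%N ->
  lam * l%:R <= \sum_(y <= i < b.+1) F i ->
  (lam * l%:R) `^ t * \sum_(0 <= x < y.+1 - l) w x * (y - x)%:R `^ (- t) <=
  2 `^ t * tailC t * C1 * lam `^ (t - 1) * \sum_(y <= i < b.+1) F i * w i.
Proof.
move=> t1 yb mass; have l0 : (0 < l)%N by rewrite subn_gt0 ltnS.
have lR : 0 < l%:R :> R by rewrite ltr0n.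
have ll : 0 < lam * l%:R by rewrite mulr_gt0.
set X := \sum_(0 <= x < y.+1 - l) w x * (y - x)%:R `^ (- t).
have X0 : 0 <= X by apply: sumr_ge0 => i _; rewrite mulr_ge0.
set k := 2 `^ t * tailC t * C1.
have XF : X * (lam * l%:R) <= k * l%:R `^ (1 - t) * \sum_(y <= i < b.+1) F i * w i.
  apply: (le_trans (ler_wpM2l X0 mass)); rewrite !mulr_sumr big_nat [leRHS]big_nat.
  apply: ler_sum => i /andP[yi ib]; rewrite mulrC [leRHS]mulrCA.
  apply: ler_wpM2l => //.
  apply: (le_trans (@left_tail_weight t i l y t1 l0 yi _)); first by rewrite /l; lia.
  by apply: eq_le; rewrite /k; ring.
have -> : (lam * l%:R) `^ t = (lam * l%:R) `^ (t - 1) * (lam * l%:R).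
  by rewrite -{3}(powRr1 (ltW ll)) -powRD_pos// subrK.
rewrite -mulrA [X in _ * X]mulrC.
apply: (le_trans (ler_wpM2l (powR_ge0 _ _) XF)); apply: eq_le.
rewrite powRM ?(ltW lam0)//.
have E : l%:R `^ (t - 1) * l%:R `^ (1 - t) = 1 :> R.
  by rewrite -powRD_pos// addrA subrK subrr powRr0.
set S := \sum_(_ <= _ < _) _.
transitivity (k * lam `^ (t - 1) * S * (l%:R `^ (t - 1) * l%:R `^ (1 - t))); last first.
  by rewrite E mulr1.
by ring.
Qed.

Lemma run_left_double y b (l := (b.+1 - y)%N) : (y <= b)%N ->
  lam * l%:R <= \sum_(y <= i < b.+1) F i ->
  lam * \sum_(y - l <= x < y) w x <= 2 * C1 * \sum_(y <= i < b.+1) F i * w i.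
Proof.
move=> yb mass; have l0 : (0 < l)%N by rewrite subn_gt0 ltnS.
have lR : 0 < l%:R :> R by rewrite ltr0n.
set Y := \sum_(y - l <= x < y) w x.
have Y0 : 0 <= Y by exact: sumr_ge0.
have YF : Y * (lam * l%:R) <= 2 * C1 * l%:R * \sum_(y <= i < b.+1) F i * w i.
  apply: (le_trans (ler_wpM2l Y0 mass)); rewrite !mulr_sumr big_nat [leRHS]big_nat.
  apply: ler_sum => i /andP[yi ib]; rewrite mulrC [leRHS]mulrCA.
  apply: ler_wpM2l => //.
  have h : Y <= C1 * (i.+1 - (y - l))%:R * w i.
    apply: le_trans (wA1 _); last by lia.
    by apply: ler_sum_widen => //; lia.
  apply: (le_trans h); rewrite ler_wpM2r// [2 * C1]mulrC -mulrA ler_wpM2l//.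
  by rewrite -natrM ler_nat /l; lia.
rewrite -(ler_pM2r lR); apply: (le_trans (eq_le _) (le_trans YF (eq_le _))); ring.
Qed.

End RunGeometry.

Section CalderonZygmund.
Variables (R : realType) (q rho tau : R) (K : finType).
Hypotheses (tau1 : 1 < tau) (taurho : tau <= rho) (tauq : tau <= q).
Variables (w F : nat -> R) (f : K -> nat -> R) (lam : R) (L : nat).
Hypotheses (w0 : forall n, 0 <= w n) (lam0 : 0 < lam) (fL : supp_lt L f).
Hypothesis FE : forall n, F n = vnm rho f n.

Let rho1 : 1 <= rho. Proof. exact: ltW (lt_le_trans tau1 taurho). Qed.
Let q1 : 1 <= q. Proof. exact: ltW (lt_le_trans tau1 tauq). Qed.
Let rhoN0 : rho != 0. Proof. by rewrite gt_eqF// (lt_le_trans _ rho1). Qed.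
Let F0 n : 0 <= F n. Proof. by rewrite FE vnm_ge0. Qed.
Let FL n : (L <= n)%N -> F n = 0.
Proof. by move=> Ln; rewrite FE vnm0// => k; exact: fL. Qed.

Let Om := msup F lam.
Let lo := run_lo Om.
Let bs := block_sum F lam L.

(* On the run starting at the left end of the window there is no point to the
   left of the run to control its density, but nothing looks at this run either. *)
Definition cz_good k n : R :=
  if Om n then (if lo n == 0%N then 0 else bs (lo n) (f k) / bs (lo n) (fun=> 1)) else f k n.

Definition cz_bad k n : R := f k n - cz_good k n.

Lemma run_blockP n : Om n -> exists b, [/\ (n <= b < L)%N,
  forall G, bs (lo n) G = \sum_(lo n <= i < b.+1) G i,
  forall i, (lo i == lo n) = (lo n <= i <= b)%N,
  lam * (b.+1 - lo n)%:R <= \sum_(lo n <= i < b.+1) F i &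
  (0 < lo n)%N -> \sum_(lo n <= i < b.+1) F i <= 2 * (lam * (b.+1 - lo n)%:R)].
Proof.
move=> On; have [b [/andP[nb bL] Hb lob run]] := run_block (Om_lt lam0 FL) On.
have lob' : forall i, (lo i == lo n) = (lo n <= i <= b)%N by [].
exists b; split => //.
- by rewrite nb.
- by move=> G; exact: block_sumE bL lob'.
- by apply: ltW; apply: msup_tail => //; exact: leq_trans (run_lo_le _ _) nb.
- by move=> l0; exact: (run_mass_le F0 lam0 nb On l0).
Qed.

Lemma same_run_in n i : Om n -> lo i = lo n -> Om i.
Proof.
move=> On loi; have [//|Oi] := boolP (Om i).
move: loi; rewrite /lo (run_lo_out Oi) => iE.
have := @run_lo_in _ n (run_lo Om n) On; rewrite leqnn run_lo_le => /(_ isT)[_].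
by rewrite -iE (negPf Oi).
Qed.

Lemma cz_good_supp : supp_lt L cz_good.
Proof.
move=> k i Li; rewrite /cz_good ifF ?fL//.
by apply/negP => /(Om_lt lam0 FL); rewrite ltnNge Li.
Qed.

Lemma cz_bad_supp : supp_lt L cz_bad.
Proof. by move=> k i Li; rewrite /cz_bad fL// cz_good_supp// subrr. Qed.

Lemma cz_bad_out k n : ~~ Om n -> cz_bad k n = 0.
Proof. by move=> /negPf On; rewrite /cz_bad /cz_good On subrr. Qed.

Lemma bs_const n b x : (forall G, bs (lo n) G = \sum_(lo n <= i < b.+1) G i) ->
  bs (lo n) (fun=> x) = (b.+1 - lo n)%:R * x.
Proof. by move=> ->; rewrite sum_const_nat_R. Qed.

Lemma cz_good_run n : Om n -> (0 < lo n)%N ->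
  vnm rho cz_good n <= bs (lo n) F / bs (lo n) (fun=> 1).
Proof.
move=> On l0; have [b [/andP[nb bL] bsE _ _ _]] := run_blockP On.
have d0 : 0 < bs (lo n) (fun=> 1).
  rewrite (bs_const _ bsE) mulr1 ltr0n subn_gt0 ltnS.
  exact: leq_trans (run_lo_le _ _) nb.
rewrite (@eq_vnm _ _ _ _ (fun k i => (bs (lo n) (fun=> 1))^-1 * bs (lo n) (f k))); last first.
  by move=> k; rewrite /cz_good On (gtn_eqF l0) mulrC.
set d := bs (lo n) (fun=> 1) in d0 *; clearbody d.
have -> : vnm rho (fun k _ => d^-1 * bs (lo n) (f k)) n =
    d^-1 * lnorm (index_enum K) rho (fun k => bs (lo n) (f k)).
  rewrite -[in RHS](ger0_norm (_ : 0 <= d^-1)) ?invr_ge0 ?(ltW d0)//.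
  by rewrite -lnormZ.
rewrite mulrC ler_wpM2r ?invr_ge0 ?(ltW d0)//.
rewrite bsE (@eq_lnorm _ _ _ _ _ (fun k => \sum_(lo n <= i < b.+1) f k i)); last first.
  by move=> k; rewrite bsE.
under eq_bigr do rewrite FE.
exact: lnorm_sum.
Qed.

Lemma cz_good_le n : vnm rho cz_good n <= 2 * lam.
Proof.
have [On|On] := boolP (Om n); last first.
  rewrite (@eq_vnm _ _ _ _ f); last by move=> k; rewrite /cz_good (negPf On).
  have := @msupN R F lam n n.+1 On; rewrite big_nat1 subSnn mulr1 FE => H.
  by apply: (le_trans H); rewrite ler_peMl ?(ltW lam0)// ler1n.
have [l0|l0] := posnP (lo n).
  rewrite vnm0 ?mulr_ge0 ?(ltW lam0)// => k.
  by rewrite /cz_good On l0 eqxx.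
apply: (le_trans (cz_good_run On l0)).
have [b [/andP[nb bL] bsE _ _ H]] := run_blockP On.
rewrite (bs_const _ bsE) mulr1 bsE ler_pdivrMr; last first.
  by rewrite ltr0n subn_gt0 ltnS; exact: leq_trans (run_lo_le _ _) nb.
by rewrite -mulrA; exact: H.
Qed.

Lemma cz_bad_mass n : Om n -> (0 < lo n)%N ->
  bs (lo n) (vnm rho cz_bad) <= 4 * (lam * bs (lo n) (fun=> 1)).
Proof.
move=> On l0; have [b [/andP[nb bL] bsE lob _ H]] := run_blockP On.
have d0 : 0 < bs (lo n) (fun=> 1).
  rewrite (bs_const _ bsE) mulr1 ltr0n subn_gt0 ltnS.
  exact: leq_trans (run_lo_le _ _) nb.
have {}H := H l0.
have gE i : (lo n <= i < b.+1)%N -> vnm rho cz_bad i <= F i + bs (lo n) F / bs (lo n) (fun=> 1).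
  move=> li; have loi : lo i = lo n by apply/eqP; rewrite lob -ltnS.
  have Oi : Om i by exact: (same_run_in On loi).
  apply: (@le_trans _ _ (vnm rho f i + vnm rho (fun k j => - cz_good k j) i)).
    exact: vnm_split.
  rewrite -FE lerD2l; have -> : vnm rho (fun k j => - cz_good k j) i = vnm rho cz_good i.
    by rewrite /vnm lnormN.
  by have := cz_good_run Oi; rewrite loi; exact.
rewrite bsE big_nat; apply: (le_trans (ler_sum _ gE)); rewrite -big_nat big_split/=.
rewrite sum_const_nat_R -(mulr1 (_ - _)%:R) -(bs_const _ bsE) -!bsE.
rewrite mulrCA mulfV ?gt_eqF// mulr1.
move: H; rewrite -bsE -(mulr1 (_ - _)%:R) -(bs_const _ bsE).
move: (bs (lo n) F) (bs (lo n) (fun=> 1)) => x y; lra.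
Qed.

Lemma cz_bad_mean k n : Om n -> (0 < lo n)%N -> bs (lo n) (cz_bad k) = 0.
Proof.
move=> On l0; have [b [/andP[nb bL] bsE lob _ _]] := run_blockP On.
have d0 : bs (lo n) (fun=> 1) != 0.
  rewrite (bs_const _ bsE) mulr1 pnatr_eq0 -lt0n subn_gt0 ltnS.
  exact: leq_trans (run_lo_le _ _) nb.
rewrite bsE big_nat (eq_bigr (fun i => f k i - bs (lo n) (f k) / bs (lo n) (fun=> 1))).
  rewrite -big_nat sumrB sum_const_nat_R -(mulr1 (_ - _)%:R) -(bs_const _ bsE) -bsE.
  by rewrite mulrCA mulfV// mulr1 subrr.
move=> i li; have loi : lo i = lo n by apply/eqP; rewrite lob -ltnS.
have Oi : Om i by exact: (same_run_in On loi).
by rewrite /cz_bad /cz_good Oi loi (gtn_eqF l0).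
Qed.

(** Complete runs have mean zero and [cz_bad] vanishes off the runs. Runs to the right of a point
    outside [Om] do not start at 0, so the exceptional convention in [cz_good] does not
    interfere. *)
Lemma cz_bad_prefix k x m : ~~ Om x -> (x <= m)%N ->
  \sum_(x <= i < lo m) cz_bad k i = 0.
Proof.
move=> Ox; elim: m => [|m IH] xm.
  by move: xm; rewrite leqn0 => /eqP ->; rewrite big_geq.
move: xm; rewrite leq_eqVlt => /predU1P[<-|]; first by rewrite /lo (run_lo_out Ox) big_geq.
rewrite ltnS => xm; have xlo : (x <= lo m)%N.
  by rewrite -(run_lo_out Ox); exact: run_lo_homo.
rewrite {1}/lo run_loS -/lo; case: ifPn => [_|Hn]; first exact: IH.
rewrite (@sum_cat _ _ x (lo m) m.+1)//; last exact: leqW (run_lo_le _ _).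
rewrite IH// add0r; have [Om_m|Om_m] := boolP (Om m); last first.
  by rewrite /lo (run_lo_out Om_m) big_nat1 cz_bad_out.
have [b [/andP[mb bL] bsE lob _ _]] := run_blockP Om_m.
have bm : b = m.
  apply/eqP; rewrite eqn_leq mb andbT leqNgt; apply/negP => lmb.
  have : lo m.+1 == lo m by rewrite lob lmb andbT; exact: leqW (run_lo_le _ _).
  rewrite {1}/lo run_loS (negPf Hn) => /eqP E.
  by have := run_lo_le Om m; rewrite -/lo -E ltnn.
have lm0 : (0 < lo m)%N.
  rewrite lt0n; apply/negP => /eqP l0.
  have := @run_lo_in _ m 0 Om_m; rewrite -/lo l0 leq0n => /(_ isT)[_ O0].
  by move: xlo Ox; rewrite l0 leqn0 => /eqP ->; rewrite O0.
by have := cz_bad_mean k Om_m lm0; rewrite bsE bm.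
Qed.

(** Data for [frac_controls]: bad mass on the run starting at [y], and distance to it. The defaults
    cover [N = 0], where the label is [x] itself and the sum is 0. *)
Let bh (k : K) (x y : nat) : R := if (x < y)%N then bs y (fun i => `|cz_bad k i|) else 0.
Let bd (x y : nat) : R := if (x < y)%N then (y - x)%:R else 1.

Lemma block_sum_ge0 y (G : nat -> R) : (forall i, 0 <= G i) -> 0 <= bs y G.
Proof. by move=> G0; exact: sumr_ge0. Qed.

Lemma block_sum_supp y (G : nat -> R) : (L <= y)%N -> bs y G = 0.
Proof.
move=> Ly; rewrite /bs /block_sum big_nat_cond big1// => i /andP[/andP[_ iL] /eqP loi].
by have := run_lo_le Om i; move: loi; rewrite /lo => ->; rewrite leqNgt (leq_trans iL).
Qed.

Lemma block_sum_part y a c (G : nat -> R) : (forall i, 0 <= G i) ->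
  (forall i, (L <= i)%N -> G i = 0) ->
  (forall i, (a <= i < c)%N -> lo i = y) -> \sum_(a <= i < c) G i <= bs y G.
Proof.
move=> G0 GL ac; apply: (@le_trans _ _ (\sum_(a <= i < c) (if (i < L)%N && (lo i == y) then G i else 0))).
  rewrite big_nat [leRHS]big_nat; apply: ler_sum => i /ac ->; rewrite eqxx andbT.
  by case: ltnP => // /GL ->.
have bsE : \sum_(0 <= i < L) (if (i < L)%N && (lo i == y) then G i else 0) = bs y G.
  rewrite /bs /block_sum [RHS]big_mkcond/= big_nat [RHS]big_nat.
  by apply: eq_bigr => i /andP[_ ->].
rewrite -bsE; have [cL|Lc] := leqP c L.
  by apply: ler_sum_widen => // i; case: ifP.
apply: le_trans (ler_sum_widen _ (leq0n a) (leqnn c)) _; first by move=> i; case: ifP.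
rewrite (@sum_cat _ _ 0 L c)//; last exact: ltnW.
rewrite [X in _ + X]big_nat [X in _ + X]big1 ?addr0; last first.
  by move=> i /andP[Li _]; rewrite ltnNge Li.
by [].
Qed.

(** By cancellation on earlier runs the sum up to [x + N] only sees the current run, and [N.+1] is
    at least the distance to its start. Since the runs are no longer than their distance to [x], the
    time spent in one of them is at most [bd]. *)
Lemma cz_bad_vari k x M : ~~ Om x ->
  (forall n, Om n -> (x < lo n)%N -> bs (lo n) (fun=> 1) <= (lo n - x)%:R) ->
  vari q M (av (cz_bad k) x) `^ tau <=
  fracC tau * \sum_(0 <= y < L) (bh k x y / bd x y) `^ tau.
Proof.
move=> Ox far; have lox : lo x = x by exact: run_lo_out.
have bad0 i : (L <= i)%N -> `|cz_bad k i| = 0.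
  by move=> Li; rewrite cz_bad_supp// normr0.
pose c N := lo (x + N)%N.
pose S N := \sum_(x <= i < (x + N).+1) cz_bad k i.
have cx N : (x <= c N)%N by rewrite -{1}lox; apply: run_lo_homo; rewrite leq_addr.
have cx0 N : c N = x -> N = 0%N.
  move=> cN; case: N cN => // N; rewrite /c addnS => E.
  have := @run_lo_homo Om x.+1 (x + N).+1 ltac:(by rewrite ltnS leq_addr).
  by rewrite -/lo E {1}/lo (run_lo_next Ox) ltnn.
have h0 b : 0 <= bh k x b by rewrite /bh; case: ifP => // _; exact: block_sum_ge0.
have d0 b : 0 < bd x b by rewrite /bd; case: ifP => // xb; rewrite ltr0n subn_gt0.
have tau0 : tau != 0 by rewrite gt_eqF// (lt_trans _ tau1).
have part N N' : (N <= N')%N -> c N = c N' -> (x < c N)%N ->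
    \sum_((x + N) <= i < (x + N').+1) `|cz_bad k i| <= bh k x (c N).
  move=> NN' cc xc; rewrite /bh xc; apply: block_sum_part => // i /andP[h1 h2].
  apply/eqP; rewrite eqn_leq -{1}/(c N) {1}cc /c !run_lo_homo//.
have [|||om [om1 om2]] := @frac_controls R tau (ltW tau1) 0 M S c (bh k x) (bd x) h0 d0.
- by move=> N N' _ NN' _; apply: run_lo_homo; rewrite leq_add2l.
- move=> N _; have cle : (c N <= x + N)%N by exact: run_lo_le.
  have [xc|cx'] := ltnP x (c N); last first.
    have cE : c N = x by apply/eqP; rewrite eqn_leq cx' cx.
    rewrite (cx0 _ cE) /S addn0 big_nat1 cz_bad_out// normr0 h0; split => //.
    by rewrite /bd /c addn0 lox ltnn.
  split; last by rewrite /bd xc ler_nat; nlia.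
  rewrite /S (@sum_cat _ _ x (c N) _) ?(ltnW xc)// ?(leqW cle)//.
  rewrite cz_bad_prefix ?leq_addr// add0r; apply: (le_trans (ler_norm_sum _ _ _)).
  rewrite /bh xc; apply: block_sum_part => // i /andP[h1 h2].
  have [On|On] := boolP (Om (x + N)%N).
    by have [] := @run_lo_in Om (x + N)%N i On ltac:(rewrite -/lo -/(c N) h1; exact: h2).
  have cN : c N = (x + N)%N by exact: (run_lo_out On).
  by have -> : i = (x + N)%N by apply/eqP; rewrite eqn_leq -ltnS h2 -cN h1.
- move=> N N' _ NN' _ cc; have [xc|cx'] := ltnP x (c N); last first.
    have cE : c N = x by apply/eqP; rewrite eqn_leq cx' cx.
    have -> : N' = 0%N by apply: cx0; rewrite -cc.
    by rewrite big_geq// h0 sub0n ltW.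
  split.
    apply: le_trans (part _ _ NN' cc xc).
    have -> : \sum_(N <= m < N') `|S m.+1 - S m| = \sum_(N <= m < N') `|cz_bad k (x + m.+1)%N|.
      apply: eq_bigr => m _; congr `|_|; rewrite /S addnS big_nat_recr/=; last by nlia.
      by rewrite addrAC subrr add0r.
    rewrite -(big_add1 _ _ N N'.+1 xpredT (fun m => `|cz_bad k (x + m)%N|)).
    have -> : \sum_(N.+1 <= i < N'.+1) `|cz_bad k (x + i)%N| =
        \sum_(x + N.+1 <= i < (x + N').+1) `|cz_bad k i|.
      rewrite -addnS [in RHS]addnC [(x + _)%N in RHS]addnC big_addn addnK.
      by apply: eq_bigr => i _; rewrite addnC.
    by apply: ler_sum_widen => //; rewrite leq_add2l.
  rewrite /bd xc; have [On|On] := boolP (Om (x + N)%N); last first.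
    move: cc; rewrite {1}/c /lo (run_lo_out On) => cc.
    have -> : N' = N.
      apply/eqP; rewrite eqn_leq NN' andbT -(leq_add2l x) leqNgt; apply/negP => h.
      have := @run_lo_homo Om (x + N).+1 (x + N')%N h.
      by rewrite (run_lo_next On) -/lo -/(c N') -cc ltnn.
    by rewrite subnn ler0n.
  apply: le_trans (far _ On xc).
  have [b [/andP[nb bL] bsE lob _ _]] := run_blockP On.
  rewrite (bs_const _ bsE) mulr1 ler_nat.
  have := lob (x + N')%N; rewrite -/(c N') -/(c N) cc eqxx => /esym/andP[_ h].
  have := run_lo_le Om (x + N)%N; rewrite -/lo -/(c N) -cc; nlia.
have ctrl : controls tau M (av (cz_bad k) x) om.
  by move=> N N' /andP[NN' N'M]; exact: om1.
apply: (le_trans (vari_controls (ltW tau1) tauq ctrl)).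
have /andP[om00 _] := om2 0%N ltac:(by []).
have /andP[_ omM] := om2 M ltac:(by rewrite leqnn).
apply: (@le_trans _ _ (om M)); first by rewrite gerBl.
apply: (le_trans omM); apply: ler_wpM2l; first exact: fracC_ge0.
have hL y : (L <= y)%N -> (bh k x y / bd x y) `^ tau = 0.
  by move=> Ly; rewrite /bh block_sum_supp// if_same mul0r powR0.
have [cL|Lc] := leqP (c M).+1 L; first exact: ler_sum_widen.
rewrite (@sum_cat _ _ 0 L (c M).+1)//; last exact: ltnW.
rewrite [X in _ + X]big_nat [X in _ + X]big1 ?addr0// => y /andP[Ly _].
exact: hL.
Qed.

Lemma cz_bad_VT x M : ~~ Om x ->
  (forall n, Om n -> (x < lo n)%N -> bs (lo n) (fun=> 1) <= (lo n - x)%:R) ->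
  VT q rho M cz_bad x `^ tau <= fracC tau *
  \sum_(0 <= y < L) (if (x < y)%N then bs y (vnm rho cz_bad) / (y - x)%:R else 0) `^ tau.
Proof.
move=> Ox far; have tau0 : 0 < tau by exact: lt_trans tau1.
have bh0 k y : 0 <= bh k x y.
  by rewrite /bh; case: ifP => // _; apply: block_sum_ge0 => i; exact: normr_ge0.
have bd0 y : 0 <= bd x y by rewrite /bd; case: ifP => // _; exact: ler0n.
have H := @lnorm_convex_sum R K (index_enum K) tau rho (fracC tau) nat (index_iota 0 L)
  (fun k => vari q M (av (cz_bad k) x)) (fun y k => bh k x y / bd x y) tau0 taurho
  (fracC_ge0 _) (fun k => vari_ge0 _ _ _) (fun y k => divr_ge0 (bh0 k y) (bd0 y))
  (fun k => cz_bad_vari k M Ox far).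
apply: (le_trans H); apply: ler_wpM2l; first exact: fracC_ge0.
apply: ler_sum => y _; apply: le_powR; rewrite ?lnorm_ge0 ?(ltW tau0)//.
rewrite /bh /bd; case: ifPn => xy; last first.
  rewrite (@eq_lnorm _ _ _ _ _ (fun=> 0)) ?lnorm0// => k; by rewrite mul0r.
rewrite (@eq_lnorm _ _ _ _ _ (fun k => (y - x)%:R^-1 * bs y (fun i => `|cz_bad k i|))); last first.
  by move=> k; rewrite mulrC.
rewrite lnormZ// ger0_norm ?invr_ge0 ?ler0n// mulrC ler_wpM2r ?invr_ge0 ?ler0n//.
apply: (le_trans (lnorm_sum _ _ _ _ rho1)).
by apply: ler_sum => i _; rewrite lnorm_abs.
Qed.

(** Points left of a run by less than its length, to which [cz_bad_vari] does not apply. No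
    neighbourhood on the right of a run is removed, since the averages look to the right. *)
Definition cz_near x := `[< exists n, [/\ Om n, (x < lo n)%N &
  (lo n - x)%:R < bs (lo n) (fun=> 1)] >].

Variable C1 : R.
Hypotheses (C10 : 0 <= C1) (wA1 : A1 C1 w).

Let run_start y := Om y && (lo y == y).

Lemma run_start_lo n : Om n -> run_start (lo n).
Proof.
move=> On; rewrite /run_start /lo run_lo_idem eqxx andbT.
by have [] := @run_lo_in Om n (run_lo Om n) On ltac:(by rewrite leqnn run_lo_le).
Qed.

Lemma cz_near_mass : lam * \sum_(0 <= x < L | cz_near x) w x <=
  2 * C1 * \sum_(0 <= i < L) F i * w i.
Proof.
pose G x y := if [&& run_start y, (x < y)%N & (y - x)%:R < bs y (fun=> 1)] then w x else 0.
have G0 x y : 0 <= G x y by rewrite /G; case: ifP.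
apply: (@le_trans _ _ (lam * \sum_(0 <= x < L) \sum_(0 <= y < L) G x y)).
  rewrite ler_pM2l// big_mkcond; apply: ler_sum => x _.
  case: ifPn => [/asboolP[n [On xn h]]|_]; last exact: sumr_ge0.
  have st := run_start_lo On; have lL : (0 <= lo n < L)%N.
    by case/andP: st => /(Om_lt lam0 FL).
  apply: le_trans (ler_term_sum (G0 x) lL).
  by rewrite /G st xn h.
rewrite exchange_big/= mulr_sumr -(sum_block_sum F lam L (fun i => F i * w i)) mulr_sumr.
apply: ler_sum => y _; have [st|st] := boolP (run_start y); last first.
  rewrite big1 ?mulr0; last by move=> x _; rewrite /G (negPf st).
  rewrite mulr_ge0 ?mulr_ge0//; apply: block_sum_ge0 => i; exact: mulr_ge0.
have /andP[Oy /eqP loy] := st.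
have [b [/andP[yb bL] bsE _ mass _]] := run_blockP Oy.
rewrite loy in bsE mass.
have -> : block_sum F lam L y (fun i => F i * w i) = \sum_(y <= i < b.+1) F i * w i by exact: bsE.
apply: (@le_trans _ _ (lam * \sum_(y - (b.+1 - y) <= x < y) w x)); last first.
  by apply: run_left_double => //; exact: ltW.
rewrite ler_pM2l//.
have Gx x : G x y <= if (y - (b.+1 - y) <= x < y)%N then w x else 0.
  rewrite /G bsE sum_const_nat_R mulr1 ltr_nat; case: ifPn => [/and3P[_ xy h]|_]; last by case: ifP.
  by rewrite ifT//; apply/andP; split => //; nlia.
apply: (le_trans (ler_sum _ (fun x _ => Gx x))).
have [yL|yL] := ltnP y L; last by move: (leq_trans yL yb); rewrite leqNgt bL.
rewrite (@sum_cat _ _ 0 y L)// ?(ltnW yL)// [X in _ + X]big_nat [X in _ + X]big1 ?addr0; last first.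
  by move=> x /andP[yx _]; rewrite ifF// [(x < y)%N]ltnNge yx andbF.
rewrite (@sum_cat _ _ 0 (y - (b.+1 - y)) y)// ?leq_subr//.
rewrite [X in X + _]big_nat [X in X + _]big1 ?add0r; last first.
  by move=> x /andP[_ xy]; rewrite ifF// leqNgt xy.
rewrite !big_nat; apply: ler_sum => x ->; exact: lexx.
Qed.

(** Chebyshev's inequality with exponent [tau]. A run of length [l] carries bad mass at most
    [4 lam l], and its effect at distances at least [l] decays like [(y - x) ^ (- tau)]; as
    [tau > 1], this is summable against [w] by [run_left_tail]. *)
Lemma cz_bad_sum M : lam * \sum_(0 <= x < L | [&& ~~ Om x, ~~ cz_near x & lam < VT q rho M cz_bad x]) w x <=
  fracC tau * (4 `^ tau * (2 `^ tau * tailC tau * C1)) * \sum_(0 <= i < L) F i * w i.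
Proof.
have tau0 : 0 < tau by exact: lt_trans tau1.
pose E x := [&& ~~ Om x, ~~ cz_near x & lam < VT q rho M cz_bad x]; under eq_bigl do rewrite -/(E _).
pose H x y := (if (x < y)%N then bs y (vnm rho cz_bad) / (y - x)%:R else 0) `^ tau * w x.
have H0 x y : 0 <= H x y by exact: mulr_ge0.
rewrite -(ler_pM2l (powR_gt0 (tau - 1) lam0)).
have -> : lam `^ (tau - 1) * (lam * \sum_(0 <= x < L | E x) w x) =
    \sum_(0 <= x < L | E x) lam `^ tau * w x.
  by rewrite -mulr_sumr mulrA -{2}(powRr1 (ltW lam0)) -powRD_pos// subrK.
apply: (@le_trans _ _ (fracC tau * \sum_(0 <= y < L) \sum_(0 <= x < L | E x) H x y)).
  rewrite exchange_big/= mulr_sumr; apply: ler_sum => x /and3P[Ox nx bx].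
  rewrite -mulr_suml mulrA ler_wpM2r//.
  apply: (@le_trans _ _ (VT q rho M cz_bad x `^ tau)).
    by apply: le_powR; rewrite ?(ltW tau0) ?(ltW lam0)// ltW.
  apply: cz_bad_VT => // n On xn; rewrite leNgt; apply/negP => h.
  by move/asboolP: nx; apply; exists n.
rewrite -mulrA mulrCA ler_wpM2l ?fracC_ge0//.
rewrite -(sum_block_sum F lam L (fun i => F i * w i)) !mulr_sumr.
apply: ler_sum => y _; have [st|st] := boolP (run_start y); last first.
  rewrite big1; last first.
    move=> x _; rewrite /H; case: ifPn => _; last by rewrite powR0 ?mul0r ?gt_eqF.
    rewrite /bs /block_sum big1 ?mul0r ?powR0 ?mul0r ?gt_eqF// => i /eqP loi.
    have [Oi|Oi] := boolP (Om i); first by move: (run_start_lo Oi); rewrite /lo loi (negPf st).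
    by rewrite vnm0// => k; exact: cz_bad_out.
  have S0 : 0 <= block_sum F lam L y (fun i => F i * w i).
    by apply: block_sum_ge0 => i; exact: mulr_ge0.
  have T0 := tailC_ge0 tau1; by repeat (apply: mulr_ge0 => //).
have /andP[Oy /eqP loy] := st.
have [b [/andP[yb bL] bsE _ mass _]] := run_blockP Oy.
rewrite loy in bsE mass.
have -> : block_sum F lam L y (fun i => F i * w i) = \sum_(y <= i < b.+1) F i * w i by exact: bsE.
set l := (b.+1 - y)%N in mass *; have l0 : (0 < l)%N by rewrite subn_gt0 ltnS.
have bl : bs y (fun=> 1) = l%:R by rewrite bsE sum_const_nat_R mulr1.
have := run_left_tail w0 F0 lam0 C10 wA1 tau1 yb mass; rewrite -/l => T.
apply: (@le_trans _ _ (4 `^ tau * ((lam * l%:R) `^ tau *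
    \sum_(0 <= x < y.+1 - l) w x * (y - x)%:R `^ (- tau)))); last first.
  apply: (le_trans (ler_wpM2l (powR_ge0 _ _) T)); apply: eq_le; ring.
rewrite mulrA mulr_sumr.
pose I x := if (x < y.+1 - l)%N then 4 `^ tau * (lam * l%:R) `^ tau * (w x * (y - x)%:R `^ (- tau)) else 0.
have I0 x : 0 <= I x by rewrite /I; case: ifP => // _; rewrite !mulr_ge0.
apply: (@le_trans _ _ (\sum_(0 <= x < L) I x)).
  rewrite big_mkcond; apply: ler_sum => x _; case: ifPn => // /and3P[Ox nx _].
  rewrite /H; case: ifPn => xy; last by rewrite powR0 ?gt_eqF// mul0r.
  have y0 : (0 < lo y)%N by rewrite loy; exact: leq_ltn_trans xy.
  have far : (l <= y - x)%N.
    rewrite leqNgt; apply/negP => h; move/asboolP: nx; apply; exists y.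
    by rewrite loy bl ltr_nat.
  rewrite /I ifT; last by clear -xy far; lia.
  have := cz_bad_mass Oy y0; rewrite loy bl => m.
  have yx : 0 < (y - x)%:R :> R by rewrite ltr0n subn_gt0.
  have b0 : 0 <= bs y (vnm rho cz_bad) by apply: block_sum_ge0 => i; exact: vnm_ge0.
  rewrite powR_div ?ler0n// -powRN -mulrA [_ * w x]mulrC ler_wpM2r ?mulr_ge0//.
  rewrite -powRM ?mulr_ge0 ?(ltW lam0) ?ler0n//.
  by apply: le_powR; rewrite ?(ltW tau0).
rewrite /I -big_mkcond/=; have [cL|Lc] := leqP (y.+1 - l) L.
  rewrite big_mkcond (@sum_cat _ _ 0 (y.+1 - l) L)// [X in _ + X]big_nat [X in _ + X]big1 ?addr0; last first.
    by move=> x /andP[h _]; rewrite ltnNge h.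
  by rewrite !big_nat; apply: ler_sum => x /andP[_ ->].
by exfalso; clear -yb bL Lc; lia.
Qed.

End CalderonZygmund.

Lemma powR_le_mul (R : realType) (s x y : R) : 1 <= s -> 0 <= x -> x <= y ->
  x `^ s <= y `^ (s - 1) * x.
Proof.
move=> s1; rewrite le_eqVlt => /predU1P[<- _|x0 xy].
  by rewrite mulr0 powR0// gt_eqF// (lt_le_trans _ s1).
have -> : x `^ s = x `^ (s - 1) * x by rewrite -{3}(powRr1 (ltW x0)) -powRD_pos// subrK.
by rewrite ler_pM2r//; apply: le_powR => //; rewrite subr_ge0.
Qed.

Lemma scaled_sum4 (R : realType) (lam a1 a2 a3 a4 x1 x2 x3 x4 S : R) :
  lam * a1 <= x1 * S -> lam * a2 <= x2 * S -> lam * a3 <= x3 * S -> lam * a4 <= x4 * S ->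
  2 * lam * (a1 + (a2 + (a3 + a4))) <= 2 * (x1 + x2 + x3 + x4) * S.
Proof. by move=> h1 h2 h3 h4; rewrite !mulrDl !mulrDr; lra. Qed.

(** The terms stand for [Om] (with [8 = 2 * 4] from [weak_maximal]), [cz_near], the bad part and the
    good part; the outer 2 comes from testing at [2 lam]. In the last term [1 + 16 C1] bounds the
    weighted sum of the good part, which is at most [2 lam] on [Om], a set of weight at most
    [8 C1 S / lam]. *)
Definition czC (R : realType) (tau s Cs C1 : R) : R :=
  2 * (8 * C1 + 2 * C1 + fracC tau * (4 `^ tau * (2 `^ tau * tailC tau * C1)) +
       Cs * (2 `^ (s - 1) * (1 + 16 * C1))).

Lemma cz_weakT (R : realType) (q rho tau s Cs C1 : R) (K : finType) (w : nat -> R) :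
  1 < tau -> tau <= rho -> tau <= q -> 1 <= s -> 0 <= Cs -> 0 <= C1 ->
  (forall n, 0 <= w n) -> A1 C1 w -> weakT q rho K s Cs w ->
  weakT q rho K 1 (czC tau s Cs C1) w.
Proof.
move=> tau1 taurho tauq s1 Cs0 C10 w0 wA1 Ws M L f lam2 fL lam20.
set lam := lam2 / 2; have lam0 : 0 < lam by rewrite divr_gt0.
have lamE : lam2 = 2 * lam by rewrite /lam; field.
clearbody lam; rewrite {lam2 lam20}lamE.
have rho1 : 1 <= rho by exact: ltW (lt_le_trans tau1 taurho).
have q1 : 1 <= q by exact: ltW (lt_le_trans tau1 tauq).
pose F := vnm rho f; have F0 n : 0 <= F n by exact: vnm_ge0.
have FL n : (L <= n)%N -> F n = 0 by move=> Ln; apply: vnm0 => // k; exact: fL.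
have FE n : F n = vnm rho f n by [].
pose g := cz_good F f lam L; pose b := cz_bad F f lam L.
set S := \sum_(0 <= n < L) F n * w n.
have -> : \sum_(0 <= n < L) vnm rho f n `^ 1 * w n = S.
  by apply: eq_bigr => n _; rewrite powRr1.
have S0 : 0 <= S by apply: sumr_ge0 => i _; exact: mulr_ge0.
have maxw : lam * \sum_(0 <= n < L | msup F lam n) w n <= 8 * C1 * S.
  have H := weak_maximal (lexx 1) C10 w0 F0 FL lam0 (A1_Bp w0 C10 wA1).
  rewrite !powRr1 ?(ltW lam0)// in H; apply: (le_trans H); rewrite /S.
  under eq_bigr do rewrite powRr1//.
  by apply: eq_le; ring.
have nearw : lam * \sum_(0 <= x < L | cz_near F lam L x) w x <= 2 * C1 * S.
  exact: (cz_near_mass tau1 taurho w0 lam0 fL FE C10 wA1).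
have badw := @cz_bad_sum R q rho tau K tau1 taurho tauq w F f lam L w0 lam0 fL FE C1 C10 wA1 M.
have gw : \sum_(0 <= n < L) vnm rho g n * w n <= (1 + 16 * C1) * S.
  apply: (@le_trans _ _ (S + 2 * (lam * \sum_(0 <= n < L | msup F lam n) w n))).
    rewrite /S [X in _ * (_ * X)]big_mkcond/= !mulr_sumr -big_split/=; apply: ler_sum => n _.
    case: ifPn => On; last first.
      have gE : vnm rho g n = F n.
        by apply: eq_vnm => k; rewrite /g /cz_good (negPf On).
      by rewrite !mulr0 addr0 gE lexx.
    apply: (@le_trans _ _ (2 * lam * w n)); last by rewrite mulrA lerDr mulr_ge0.
    by apply: (ler_wpM2r (w0 n)); exact: (cz_good_le tau1 taurho lam0 fL FE).
  move: maxw S0; clear -C10; move: (lam * _) => x; nra.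
have goodw : lam * \sum_(0 <= n < L | lam < VT q rho M g n) w n <=
    Cs * (2 `^ (s - 1) * (1 + 16 * C1)) * S.
  have gL : supp_lt L g by exact: (cz_good_supp tau1 taurho lam0 fL FE).
  have H := Ws M L g lam gL lam0.
  rewrite -(ler_pM2l (powR_gt0 (s - 1) lam0)) [leLHS]mulrA.
  have -> : lam `^ (s - 1) * lam = lam `^ s.
    by rewrite -{2}(powRr1 (ltW lam0)) -powRD_pos// subrK.
  apply: (le_trans H); rewrite -!mulrA [leRHS]mulrCA; apply: (ler_wpM2l Cs0).
  rewrite [leRHS]mulrA -powRM ?(ltW lam0)//.
  apply: (@le_trans _ _ ((2 * lam) `^ (s - 1) * \sum_(0 <= n < L) vnm rho g n * w n)).
    rewrite mulr_sumr; apply: ler_sum => n _; rewrite mulrA; apply: (ler_wpM2r (w0 n)).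
    exact: powR_le_mul s1 (vnm_ge0 rho g n) (cz_good_le tau1 taurho lam0 fL FE n).
  by rewrite [2 * lam]mulrC ler_wpM2l.
have cover : \sum_(0 <= n < L | 2 * lam < VT q rho M f n) w n <=
   \sum_(0 <= n < L | msup F lam n) w n + (\sum_(0 <= n < L | cz_near F lam L n) w n +
   (\sum_(0 <= n < L | [&& ~~ msup F lam n, ~~ cz_near F lam L n & lam < VT q rho M b n]) w n +
    \sum_(0 <= n < L | lam < VT q rho M g n) w n)).
  apply: (le_trans (@ler_sum_predU _ w _ (msup F lam) (fun n => ~~ msup F lam n && (2 * lam < VT q rho M f n)) _ w0 _)).
    by move=> i _ ->; rewrite andbT orbN.
  rewrite lerD2l.
  apply: (le_trans (@ler_sum_predU _ w _ (cz_near F lam L) (fun n => [&& ~~ msup F lam n, ~~ cz_near F lam L n & (2 * lam < VT q rho M f n)]) _ w0 _)).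
    by move=> i _ /andP[-> ->]; rewrite andbT orbN.
  rewrite lerD2l; apply: ler_sum_predU => // i _ /and3P[-> -> h] /=.
  have := @VT_split R q rho K q1 rho1 M f b g i _ => /(_ (fun k j => esym (subrK _ _))) h2.
  exact: two_mul_lt_add (lt_le_trans h h2).
have lam2 : 0 <= 2 * lam by rewrite mulr_ge0// ltW.
rewrite (powRr1 lam2); apply: (le_trans (ler_wpM2l lam2 cover)).
exact: scaled_sum4 maxw nearw badw goodw.
Qed.

(** * The good-lambda inequality *)

Section ShiftedAverages.
Variable R : realType.
Implicit Types (f H : nat -> R) (x y z l n m N M : nat) (q r : R).

Lemma sum_blocks H y l n :
  \sum_(0 <= b < n) \sum_(y + b * l <= i < y + b.+1 * l) H i = \sum_(y <= i < y + n * l) H i.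
Proof.
elim: n => [|n IH]; first by rewrite !big_geq// mul0n addn0.
rewrite big_nat_recr//= IH -sum_cat// ?leq_addr//.
by rewrite leq_add2l leq_mul2r leqnSn orbT.
Qed.

(** Each window consists of three consecutive blocks; for each of the three positions the blocks
    tile an interval. *)
Lemma sum_windows H y l n G : (forall i, 0 <= H i) ->
  (forall m, \sum_(y <= i < y + m) H i <= G * m%:R) ->
  \sum_(0 <= b < n) \sum_(y + b * l <= i < y + (b + 3) * l) H i <= 3 * (G * ((n + 3) * l)%:R).
Proof.
move=> H0 HG.
have E b : \sum_(y + b * l <= i < y + (b + 3) * l) H i =
    \sum_(0 <= j < 3) \sum_((y + j * l) + b * l <= i < (y + j * l) + b.+1 * l) H i.
  rewrite [RHS]big_ltn// [X in _ = _ + X]big_ltn// [X in _ = _ + (_ + X)]big_nat1.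
  rewrite (_ : y + (b + 3) * l = y + 2 * l + b.+1 * l)%N; last by lia.
  rewrite (_ : y + 2 * l + b * l = y + 1 * l + b.+1 * l)%N; last by lia.
  rewrite (_ : y + 1 * l + b * l = y + 0 * l + b.+1 * l)%N; last by lia.
  rewrite (_ : y + 0 * l + b * l = y + b * l)%N; last by lia.
  by rewrite -!sum_cat//; lia.
under eq_bigr do rewrite E.
rewrite exchange_big/=.
have -> : 3 * (G * ((n + 3) * l)%:R) = \sum_(0 <= j < 3) G * ((n + 3) * l)%:R.
  by rewrite sum_const_nat_R.
rewrite big_nat [leRHS]big_nat.
apply: ler_sum => j /andP[_ j3]; rewrite sum_blocks; apply: le_trans (HG _).
by apply: ler_sum_widen => //; nia.
Qed.

Definition shift_diff f x z N : R :=
  \sum_(x <= i < z) f i - \sum_((x + N).+1 <= i < (z + N).+1) f i.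

Lemma av_shift f x z N : (x <= z)%N ->
  av f x N = av f z N + shift_diff f x z N / N.+1%:R.
Proof.
move=> xz; rewrite /av /shift_diff -mulrDl; congr (_ / _).
have := @sum_cat R f x z (z + N).+1 xz ltac:(lia).
rewrite (@sum_cat R f x (x + N).+1 (z + N).+1); try lia.
move: (\sum_(x <= i < (x + N).+1) f i) (\sum_((x + N).+1 <= i < (z + N).+1) f i)
  (\sum_(x <= i < z) f i) (\sum_(z <= i < (z + N).+1) f i) => a b c d; lra.
Qed.

(** For [N] in [[b l, b.+1 l)], the first sum bounds the fixed part of [shift_diff] and the second
    its moving part, twice because an increment involves [f] at two points. The length [3 l] is due
    to [z <= x + 2 l]. Block 0 is void: the comparison starts at time [l]. *)
Definition shift_size f x l (b : nat) : R :=
  if b == 0%N then 0 else \sum_(x <= i < x + 2 * l) `|f i| +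
                          2 * \sum_(x + b * l <= i < x + (b + 3) * l) `|f i|.

Definition shift_len l (b : nat) : R := if b == 0%N then 1 else (b * l)%:R.

Lemma shift_size_ge0 f x l b : 0 <= shift_size f x l b.
Proof.
by rewrite /shift_size; case: eqP => // _; rewrite addr_ge0 ?mulr_ge0 ?sum_nat_ge0.
Qed.

Lemma shift_len_gt0 l b : (0 < l)%N -> 0 < shift_len l b.
Proof. by move=> l0; rewrite /shift_len; case: eqP => // /eqP b0; rewrite ltr0n muln_gt0 lt0n b0. Qed.

Lemma shift_diff_vari q r f x z l M : 1 <= r -> r <= q -> (0 < l)%N ->
  (x < z <= x + 2 * l)%N ->
  vari q M (fun N => (fun n => shift_diff f x z n / n.+1%:R) (maxn (minn l M) N)) `^ r <=
  fracC r * \sum_(0 <= b < (M %/ l).+1) (shift_size f x l b / shift_len l b) `^ r.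
Proof.
move=> r1 rq l0 /andP[xz zx]; have q1 : 1 <= q by exact: le_trans rq.
have rN0 : r != 0 by rewrite gt_eqF// (lt_le_trans _ r1).
have [lM|Ml] := leqP l M; last first.
  rewrite vari_const ?powR0//.
    by rewrite mulr_ge0 ?fracC_ge0// sumr_ge0.
  by move=> N NM; rewrite maxn0 (maxn_idPl NM).
have f0 i : 0 <= `|f i| by exact: normr_ge0.
have [|||om [om1 om2]] := @frac_controls R r r1 l M (shift_diff f x z) (fun N => N %/ l)%N
  (shift_size f x l) (shift_len l) (shift_size_ge0 f x l) (fun b => shift_len_gt0 b l0).
- by move=> N N' _ NN' _; exact: leq_div2r.
- move=> N /andP[lN _]; have b0 : (0 < N %/ l)%N by rewrite divn_gt0.
  have dl : (N %/ l * l <= N)%N by exact: leq_divM.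
  have dl' : (N < (N %/ l).+1 * l)%N by exact: ltn_ceil.
  rewrite /shift_size /shift_len (gtn_eqF b0); split; last by rewrite ler_nat; exact: leqW.
  apply: (le_trans (ler_normB _ _)); apply: lerD.
    apply: (le_trans (ler_norm_sum _ _ _)); exact: ler_sum_widen.
  apply: (le_trans (ler_norm_sum _ _ _)).
  apply: (@le_trans _ _ (\sum_(x + N %/ l * l <= i < x + (N %/ l + 3) * l) `|f i|)).
    by apply: ler_sum_widen => //; clear -dl dl' zx xz; nia.
  by rewrite ler_peMl ?sum_nat_ge0// ler1n.
- move=> N N' lN NN' _ cc; have b0 : (0 < N %/ l)%N by rewrite divn_gt0.
  have dl : (N %/ l * l <= N)%N by exact: leq_divM.
  have dl' : (N' < (N %/ l).+1 * l)%N by rewrite cc; exact: ltn_ceil.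
  rewrite /shift_size /shift_len (gtn_eqF b0); split; last first.
    by rewrite ler_nat; clear -dl dl' b0; nia.
  have step m : `|shift_diff f x z m.+1 - shift_diff f x z m| <= `|f (x + m).+1| + `|f (z + m).+1|.
    have E : shift_diff f x z m.+1 - shift_diff f x z m = f (x + m).+1 - f (z + m).+1.
      rewrite /shift_diff !addnS.
      have h1 := @sum_cat R f (x + m).+1 (x + m).+2 (z + m).+2 ltac:(lia) ltac:(lia).
      have h2 := @sum_cat R f (x + m).+1 (z + m).+1 (z + m).+2 ltac:(lia) ltac:(lia).
      move: h1 h2; rewrite !big_nat1 => ->.
      move: (\sum_((x + m).+2 <= i < (z + m).+2) f i) (\sum_(x <= i < z) f i)
        (\sum_((x + m).+1 <= i < (z + m).+1) f i) => a b c; lra.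
    by rewrite E; exact: ler_normB.
  apply: (le_trans (ler_sum _ (fun m _ => step m))); rewrite big_split/= mulr2n mulrDl mul1r.
  have part y : (x <= y <= x + 2 * l)%N ->
      \sum_(N <= m < N') `|f (y + m).+1| <= \sum_(x + N %/ l * l <= i < x + (N %/ l + 3) * l) `|f i|.
    move=> /andP[xy yx].
    have -> : \sum_(N <= m < N') `|f (y + m).+1| = \sum_(y.+1 + N <= i < y.+1 + N') `|f i|.
      rewrite ![(y.+1 + _)%N]addnC big_addn addnK.
      by apply: eq_bigr => m _; rewrite addnS addnC.
    by apply: ler_sum_widen => //; clear -dl dl' xy yx; nia.
  apply: le_trans (lerD (part x _) (part z _)) _; rewrite ?leqnn ?leq_addr ?(ltnW xz) ?zx//.
  by rewrite lerDr sum_nat_ge0.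
have ctrl : controls r M (fun N => (fun n => shift_diff f x z n / n.+1%:R) (maxn l N)) (fun N => om (maxn l N)).
  move=> N N' /andP[NN' N'M]; apply: om1; rewrite ?leq_maxl// ?geq_max ?lM ?N'M//.
  by rewrite leq_max leqnn /= leq_max NN' orbT.
apply: (le_trans (vari_controls r1 rq ctrl)).
have /andP[om00 _] := om2 (maxn l 0) ltac:(by rewrite leq_maxl geq_max lM).
have /andP[_ omM] := om2 (maxn l M) ltac:(by rewrite leq_maxl geq_max lM leqnn).
by apply: le_trans omM; rewrite gerBl.
Qed.

End ShiftedAverages.

Section ShiftedNorm.
Variables (R : realType) (q rho r : R) (K : finType).
Hypotheses (r1 : 1 < r) (rrho : r <= rho) (rq : r <= q).

(** The 12 is 3 from the overlap of the windows times 4 from [n + 3 <= 4 n]; [4 ^ r] and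
    [3 ^ (r - 1)] come from [window_power]. *)
Definition shiftC : R := fracC r * (tailC r * (4 `^ r * (1 + 12 * 3 `^ (r - 1)))).

Lemma shiftC_ge0 : 0 <= shiftC.
Proof.
have T0 := tailC_ge0 r1; have F0 : 0 <= fracC r by exact: fracC_ge0.
have P0 : 0 <= (3 : R) `^ (r - 1) by exact: powR_ge0.
have Q0 : 0 <= (4 : R) `^ r by exact: powR_ge0.
have S0 : 0 <= 1 + 12 * (3 : R) `^ (r - 1) by lra.
by rewrite /shiftC; repeat (apply: mulr_ge0 => //).
Qed.

Lemma sum_nat_powR_le (p : R) (u : nat -> R) a b : 1 <= p -> (forall i, 0 <= u i) ->
  (\sum_(a <= i < b) u i) `^ p <= (b - a)%:R `^ (p - 1) * \sum_(a <= i < b) u i `^ p.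
Proof.
move=> p1 u0; have := @powR_sum_le R nat (index_iota a b) p u p1.
rewrite size_iota; under eq_bigr do rewrite (ger0_norm (u0 _)).
by under [in X in _ <= X -> _]eq_bigr do rewrite (ger0_norm (u0 _)).
Qed.

Lemma window_power (A B l t G W : R) : 0 <= A -> 0 <= B -> 0 < l -> 0 < t -> 0 <= G -> 0 <= W ->
  A `^ r <= (2 * l) `^ r * G -> B `^ r <= (3 * l) `^ (r - 1) * W ->
  ((A + 2 * B) / (t * l)) `^ r <= 4 `^ r * (G + 3 `^ (r - 1) * (W / l)) * t `^ (- r).
Proof.
move=> A0 B0 l0 t0 G0 W0 HA HB; have r0 : 0 <= r by exact: ltW (lt_trans ltr01 r1).
have tl : 0 <= t * l by rewrite mulr_ge0 ?ltW.
have AB : 0 <= A + 2 * B by rewrite addr_ge0 ?mulr_ge0.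
have lE : l `^ r = l `^ (r - 1) * l by rewrite -{3}(powRr1 (ltW l0)) -powRD_pos// subrK.
have lp : 0 < l `^ r by exact: powR_gt0.
have lp1 : 0 < l `^ (r - 1) by exact: powR_gt0.
have tp : 0 < t `^ r by exact: powR_gt0.
have -> : ((A + 2 * B) / (t * l)) `^ r = (A + 2 * B) `^ r / (t `^ r * l `^ r).
  by rewrite powR_div// [(t * l) `^ r]powRM// ltW.
rewrite powRN ler_pdivrMr; last by rewrite mulr_gt0.
have -> : 4 `^ r * (G + 3 `^ (r - 1) * (W / l)) / t `^ r * (t `^ r * l `^ r) =
    4 `^ r * (l `^ r * G + l `^ (r - 1) * (3 `^ (r - 1) * W)).
  by rewrite lE; field; rewrite !gt_eqF.
apply: (le_trans (powR_add_le r0 A0 (mulr_ge0 _ B0))) => //.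
have -> : 4 = 2 * 2 :> R by lra.
rewrite [(2 * 2) `^ r]powRM// -mulrA ler_wpM2l// mulrDr; apply: lerD.
  by apply: (le_trans HA); rewrite powRM ?(ltW l0)// -mulrA.
rewrite powRM// ler_wpM2l//; apply: (le_trans HB).
by rewrite powRM ?(ltW l0)//; apply: eq_le; ring.
Qed.

Variables (f : K -> nat -> R) (x z l M : nat) (G : R).
Hypotheses (l0 : (0 < l)%N) (xz : (x < z <= x + 2 * l)%N) (G0 : 0 <= G).
Hypothesis HG : forall m, \sum_(x <= i < x + m) vnm rho f i `^ r <= G * m%:R.

Lemma shift_size_norm b : (0 < b)%N ->
  lnorm (index_enum K) rho (fun k => shift_size (f k) x l b / shift_len R l b) <=
  (\sum_(x <= i < x + 2 * l) vnm rho f i +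
   2 * \sum_(x + b * l <= i < x + (b + 3) * l) vnm rho f i) / (b%:R * l%:R).
Proof.
move=> b0; have rho1 : 1 <= rho by exact: ltW (lt_le_trans r1 rrho).
have rhoN : rho != 0 by rewrite gt_eqF// (lt_le_trans _ rho1).
rewrite /shift_size /shift_len (gtn_eqF b0) -natrM.
set d : R := (b * l)%:R.
rewrite (@eq_lnorm _ _ _ _ _ (fun k => d^-1 * (\sum_(x <= i < x + 2 * l) `|f k i| +
    2 * \sum_(x + b * l <= i < x + (b + 3) * l) `|f k i|))); last by move=> k; rewrite mulrC.
rewrite lnormZ// ger0_norm ?invr_ge0 ?ler0n// mulrC ler_wpM2r ?invr_ge0 ?ler0n//.
apply: (le_trans (lnormD _ _ _ rho1)); apply: lerD; first exact: vnm_sum.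
rewrite lnormZ// ger0_norm// ler_wpM2l//; exact: vnm_sum.
Qed.

(** Hoelder's inequality turns window sums into sums of [r]-th powers, bounded on average by [G],
    and [tail_sum_le] sums the factors [b ^ (- r)]. This is where the maximal function of [r]-th
    powers enters. *)
Lemma shift_diff_vnorm :
  lnorm (index_enum K) rho (fun k => vari q M (fun N =>
     (fun n => shift_diff (f k) x z n / n.+1%:R) (maxn (minn l M) N))) `^ r <= shiftC * G.
Proof.
have r0 : 0 < r by exact: lt_trans r1.
have lR : 0 < l%:R :> R by rewrite ltr0n.
pose F := vnm rho f; have F0 i : 0 <= F i by exact: vnm_ge0.
have Fr0 i : 0 <= F i `^ r by exact: powR_ge0.
pose W b := \sum_(x + b * l <= i < x + (b + 3) * l) F i `^ r.
have W0 b : 0 <= W b by exact: sumr_ge0.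
pose Q b := if b == 0%N then 0 else 4 `^ r * (G + 3 `^ (r - 1) * (W b / l%:R)).
have Q'0 b : 0 <= 4 `^ r * (G + 3 `^ (r - 1) * (W b / l%:R)).
  have X0 : 0 <= W b / l%:R by apply: divr_ge0 => //; exact: ler0n.
  have Y0 : 0 <= 3 `^ (r - 1) * (W b / l%:R) by exact: mulr_ge0.
  by apply: mulr_ge0 => //; exact: addr_ge0.
have Q0 b : 0 <= Q b by rewrite /Q; case: ifP.
set A := 4 `^ r * (1 + 12 * 3 `^ (r - 1)) * G.
have p30 : 0 <= (3 : R) `^ (r - 1) by exact: powR_ge0.
have A0 : 0 <= A.
  have S0 : 0 <= 1 + 12 * (3 : R) `^ (r - 1) by lra.
  by rewrite /A; repeat (apply: mulr_ge0 => //).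
have QA n : \sum_(0 <= b < n) Q b <= A * n%:R.
  case: n => [|n]; first by rewrite big_geq// mulr0.
  apply: (@le_trans _ _ (\sum_(0 <= b < n.+1) 4 `^ r * (G + 3 `^ (r - 1) * (W b / l%:R)))).
    by apply: ler_sum => b _; rewrite /Q; case: ifP.
  rewrite -mulr_sumr /A -!mulrA ler_wpM2l// big_split/= sum_const_nat_R subn0 -mulr_sumr -mulr_suml.
  have H := @sum_windows R (fun i => F i `^ r) x l n.+1 G Fr0 HG.
  have H2 : (\sum_(0 <= b < n.+1) W b) / l%:R <= 12 * (G * n.+1%:R).
    rewrite ler_pdivrMr//; apply: (le_trans H).
    have -> : 12 * (G * n.+1%:R) * l%:R = 3 * (G * (4 * n.+1 * l)%:R) by rewrite !natrM; ring.
    by rewrite ler_pM2l// ler_wpM2l// ler_nat leq_mul2r; apply/orP; right; clear; lia.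
  have H3 := ler_wpM2l p30 H2.
  rewrite mulrDl mul1r; apply: lerD; first by rewrite mulrC.
  by apply: (le_trans H3); apply: eq_le; ring.
have T := @tail_sum_le R Q A r 1 (M %/ l).+1 r1 A0 Q0 QA isT.
rewrite powR1 mulr1 in T.
have key := @lnorm_convex_sum R K (index_enum K) r rho (fracC r) nat (index_iota 0 (M %/ l).+1)
  (fun k => vari q M (fun N => (fun n => shift_diff (f k) x z n / n.+1%:R) (maxn (minn l M) N)))
  (fun b k => shift_size (f k) x l b / shift_len R l b) r0 rrho (fracC_ge0 _)
  (fun k => vari_ge0 _ _ _)
  (fun b k => divr_ge0 (shift_size_ge0 _ _ _ _) (ltW (shift_len_gt0 R b l0)))
  (fun k => shift_diff_vari (f k) M (ltW r1) rq l0 xz).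
apply: (le_trans key); rewrite /shiftC -mulrA ler_wpM2l ?fracC_ge0//.
have -> : tailC r * (4 `^ r * (1 + 12 * 3 `^ (r - 1))) * G = tailC r * A by rewrite /A; ring.
apply: le_trans T.
rewrite big_ltn// [X in X `^ _ + _](_ : _ = 0); last first.
  rewrite (@eq_lnorm _ _ _ _ _ (fun=> 0)); first by rewrite lnorm0// gt_eqF// (lt_le_trans r0 rrho).
  by move=> k; rewrite /shift_size mul0r.
rewrite powR0 ?gt_eqF// add0r big_nat [leRHS]big_nat; apply: ler_sum => b /andP[b0 _].
have bR : 0 < b%:R :> R by rewrite ltr0n.
rewrite /Q (gtn_eqF b0).
have F1 : 0 <= \sum_(x <= i < x + 2 * l) F i by exact: sumr_ge0.
have F2 : 0 <= \sum_(x + b * l <= i < x + (b + 3) * l) F i by exact: sumr_ge0.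
apply: le_trans (window_power F1 F2 lR bR G0 (W0 b) _ _).
- apply: le_powR; [exact: ltW|exact: lnorm_ge0|exact: shift_size_norm].
- apply: (le_trans (sum_nat_powR_le _ _ (ltW r1) F0)).
  rewrite addKn natrM; apply: (le_trans (ler_wpM2l (powR_ge0 _ _) (HG _))).
  have l2 : 0 < 2 * l%:R :> R by rewrite mulr_gt0.
  have E : (2 * l%:R) `^ r = (2 * l%:R) `^ (r - 1) * (2 * l%:R) :> R.
    by rewrite -{3}(powRr1 (ltW l2)) -powRD_pos// subrK.
  by rewrite natrM E; apply: eq_le; ring.
- apply: (le_trans (sum_nat_powR_le _ _ (ltW r1) F0)).
  have -> : (x + (b + 3) * l - (x + b * l) = 3 * l)%N by clear; lia.
  by rewrite natrM; exact: lexx.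
Qed.

End ShiftedNorm.

Lemma powR_le_inj (R : realType) (p x y : R) : 0 < p -> 0 <= x -> 0 <= y ->
  x `^ p <= y `^ p -> x <= y.
Proof.
move=> p0 x0 y0 xy; rewrite -(@powRK _ p x) ?gt_eqF//.
by apply: powR_le_root.
Qed.

Lemma lnorm_vari_le (R : realType) (I : Type) (s : seq I) (q p : R) M (a : I -> nat -> R) (b : I -> R) :
  0 < p -> (forall k, vari q M (a k) <= b k) ->
  lnorm s p (fun k => vari q M (a k)) <= lnorm s p b.
Proof.
move=> p0 ab; apply: (lnorm_le _ p0) => k; have v0 := vari_ge0 q M (a k).
by rewrite !ger0_norm ?(le_trans v0).
Qed.

Lemma three_mul_lt_add (R : realType) (l a b g s : R) :
  3 * l < a -> b <= l -> s <= l -> a <= g + (b + s) -> l < g.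
Proof. lra. Qed.

Section GoodLambdaLocal.
Variables (R : realType) (q rho r C0 : R) (K : finType).
Hypotheses (r1 : 1 < r) (rrho : r <= rho) (rq : r <= q) (C00 : 0 <= C0).
Hypothesis weak0 : weakT q rho K r C0 (fun=> 1).
Variables (f : K -> nat -> R) (L M : nat) (lam del : R).
Hypotheses (fL : supp_lt L f) (lam0 : 0 < lam) (del0 : 0 <= del).
Hypothesis delS : shiftC r * del <= 1.

Let rho1 : 1 <= rho. Proof. exact: ltW (lt_le_trans r1 rrho). Qed.
Let q1 : 1 <= q. Proof. exact: ltW (lt_le_trans r1 rq). Qed.
Let r0 : 0 < r. Proof. exact: lt_trans r1. Qed.
Let rho0 : 0 < rho. Proof. exact: lt_le_trans rho1. Qed.

Definition exceptional x :=
  (3 * lam < VT q rho M f x) && ~~ msup (fun i => vnm rho f i `^ r) (del * lam `^ r) x.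

(* Up to time [l] the averages only see [f] on [[y, y + 3l)]. From time [l] on they are
   compared with the averages at [z], where the variation is at most [lam]; the difference
   [shift_diff] is small because the maximal function is small at [x]. *)
Lemma exceptional_split x y z l : (0 < l)%N -> (x < z <= x + 2 * l)%N -> (y <= x < y + l)%N ->
  VT q rho M f z <= lam -> exceptional x ->
  lam < VT q rho M (fun k i => if (y <= i < y + 3 * l)%N then f k i else 0) x.
Proof.
move=> l0 xz /andP[yx xy] Tz /andP[Tx nx].
set g := fun k i => _.
have HG m : \sum_(x <= i < x + m) vnm rho f i `^ r <= del * lam `^ r * m%:R.
  by have := msupN (x + m) nx; rewrite addKn.
have G0 : 0 <= del * lam `^ r by exact: mulr_ge0.
have S := @shift_diff_vnorm R q rho r K r1 rrho rq f x z l M _ l0 xz G0 HG.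
set s := lnorm _ _ _ in S; have s0 : 0 <= s by exact: lnorm_ge0.
have slam : s <= lam.
  apply: (powR_le_inj r0 s0 (ltW lam0)); apply: (le_trans S).
  by rewrite mulrA ler_piMl.
have first_part : lnorm (index_enum K) rho (fun k => vari q M (av (f k) x \o minn l)) <= VT q rho M g x.
  apply: (lnorm_vari_le _ rho0) => k.
  rewrite (@eq_vari _ _ _ _ (av (g k) x \o minn l)).
    apply: vari_comp => // [i j ij|N NM]; first by rewrite leq_min geq_minl (leq_trans (geq_minr _ _)).
    exact: leq_trans (geq_minr _ _) NM.
  move=> N _ /=; apply: eq_av => i /andP[xi iN]; rewrite /g ifT//.
  have := geq_minl l N; move: iN; move: (minn l N) => m h1 h2.
  by apply/andP; split; clear -yx xy xi h1 h2; lia.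
have second_part : lnorm (index_enum K) rho (fun k => vari q M (av (f k) x \o maxn (minn l M))) <=
    VT q rho M f z + s.
  have H := @le_vari_lnorm R q rho K q1 rho1 M (fun k => av (f k) x \o maxn (minn l M))
    (fun k => av (f k) z \o maxn (minn l M))
    (fun k N => (fun n => shift_diff (f k) x z n / n.+1%:R) (maxn (minn l M) N)) _.
  apply: (le_trans (H _)) => [k N _ /=|].
    by apply: av_shift; case/andP: xz => /ltnW.
  rewrite lerD2r; apply: (lnorm_vari_le _ rho0) => k.
  apply: vari_comp => // [i j ij|N NM]; last by rewrite geq_max geq_minr NM.
  by rewrite geq_max leq_maxl (leq_trans ij)// leq_maxr.
have split_T : VT q rho M f x <= VT q rho M g x + (VT q rho M f z + s).
  apply: le_trans (lerD first_part second_part); apply: le_trans (lnormD _ _ _ rho1).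
  apply: (lnorm_vari_le _ rho0) => k.
  exact: vari_split.
exact: three_mul_lt_add Tx Tz slam split_T.
Qed.

(** Let [y] be the leftmost exceptional point of the piece. The others lie in [[y, y + l)], so one
    truncation of [f], to [[y, y + 3 l)], serves all of them in the unweighted weak type; the
    maximal function at [y] bounds its sum of [r]-th powers by [del lam ^ r * 3 l]. *)
Lemma exceptional_card z l : (0 < l)%N -> VT q rho M f z <= lam ->
  \sum_(z.+1 - 2 * l <= x < z.+1 - l | exceptional x) 1 <= 3 * C0 * del * l%:R.
Proof.
move=> l0 Tz; pose P x := (z.+1 - 2 * l <= x < z.+1 - l)%N && exceptional x.
have [[y0 Py0]|noP] := pselect (exists x, P x); last first.
  rewrite big_nat_cond big1 ?mulr_ge0// ?ler0n// => x xP; exfalso; apply: noP; exists x.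
  exact: xP.
have [y /andP[/andP[zy yz] Ey] ymin] := ex_minnP (ex_intro P y0 Py0).
pose g k i := if (y <= i < y + 3 * l)%N then f k i else 0.
pose L' := (L + z.+1)%N.
have gL : supp_lt L' g.
  move=> k i Li; rewrite /g fL ?if_same//.
  by apply: leq_trans Li; rewrite leq_addr.
have W := weak0 M gL lam0.
have lr : 0 < lam `^ r by exact: powR_gt0.
rewrite -(ler_pM2l lr); apply: (@le_trans _ _ (lam `^ r * \sum_(0 <= n < L' | lam < VT q rho M g n) 1)).
  rewrite ler_pM2l// big_mkcond [leRHS]big_mkcond/=.
  apply: (@le_trans _ _ (\sum_(z.+1 - 2 * l <= x < z.+1 - l) if lam < VT q rho M g x then 1 else 0)).
    rewrite big_nat [leRHS]big_nat; apply: ler_sum => x xr; case: ifPn => Ex; last by case: ifP.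
    have yx : (y <= x)%N by apply: ymin; rewrite /P xr Ex.
    rewrite (_ : (lam < VT q rho M g x) = true)//.
    apply: exceptional_split Tz Ex => //; clear -xr yx zy yz l0; lia.
  apply: ler_sum_widen => //; [by move=> i; case: ifP|rewrite /L'; clear; lia].
apply: (le_trans W).
have -> : lam `^ r * (3 * C0 * del * l%:R) = C0 * (del * lam `^ r * (3 * l)%:R).
  by rewrite natrM; ring.
apply: ler_wpM2l => //.
have /andP[_ ny] := Ey.
have HG := msupN (y + 3 * l) ny; rewrite addKn in HG.
apply: le_trans HG.
have gE n : vnm rho g n `^ r * 1 = if (y <= n < y + 3 * l)%N then vnm rho f n `^ r else 0.
  rewrite mulr1; case: ifPn => h.
    have -> : vnm rho g n = vnm rho f n by apply: eq_vnm => k; rewrite /g h.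
    by [].
  have -> : vnm rho g n = 0 by apply: vnm0 => // k; rewrite /g (negPf h).
  by rewrite powR0 ?gt_eqF.
under eq_bigr do rewrite gE.
apply: (@le_trans _ _ (\sum_(0 <= n < L' + (y + 3 * l))
   if (y <= n < y + 3 * l)%N then vnm rho f n `^ r else 0)).
  by apply: ler_sum_widen; rewrite ?leq_addr// => i; case: ifP.
have h1 : (y <= y + 3 * l)%N by exact: leq_addr.
rewrite (@sum_cat _ _ 0 y) ?leq_addl//; last by apply: leq_trans h1 _; exact: leq_addl.
rewrite (@sum_cat _ _ y (y + 3 * l)) ?leq_addl//.
rewrite [X in X + _]big_nat [X in X + _]big1 ?add0r; last first.
  by move=> i /andP[_ iy]; rewrite leqNgt iy.
rewrite [X in _ + X]big_nat [X in _ + X]big1 ?addr0; last first.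
  by move=> i /andP[iy _]; rewrite [(i < _)%N]ltnNge iy andbF.
by rewrite !big_nat; apply: ler_sum => i ->.
Qed.

End GoodLambdaLocal.

Lemma sum_pred1_le (R : realType) (t n : nat) : \sum_(0 <= j < n) ((j == t)%:R : R) <= 1.
Proof.
suff -> : \sum_(0 <= j < n) ((j == t)%:R : R) = (t < n)%N%:R by case: (t < n)%N.
elim: n => [|n IH]; first by rewrite big_geq.
by rewrite big_nat_recr//= IH ltnS; case: ltngtP => _; rewrite ?addr0 ?add0r.
Qed.

Section GoodLambdaGlobal.
Variables (R : realType) (q rho r C0 : R) (K : finType).
Hypotheses (r1 : 1 < r) (rrho : r <= rho) (rq : r <= q) (C00 : 0 <= C0).
Hypothesis weak0 : weakT q rho K r C0 (fun=> 1).
Variables (f : K -> nat -> R) (L M : nat) (lam del : R).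
Hypotheses (fL : supp_lt L f) (lam0 : 0 < lam) (del0 : 0 <= del).
Hypothesis delS : shiftC r * del <= 1.
Hypothesis delC : 3 * C0 * del < 1.
Variables (w : nat -> R) (eta : R).
Hypotheses (w0 : forall i, 0 < w i) (eta0 : 0 < eta).
Hypothesis RH : forall a b c, (a <= b < c)%N ->
  \sum_(a <= i < b) w i `^ (1 + eta) <=
  4 * ((\sum_(a <= i < c) w i) / (c - b)%:R) `^ eta * \sum_(a <= i < c) w i.

Let wge0 i : 0 <= w i. Proof. exact: ltW. Qed.
Let T := VT q rho M f.
Let E := exceptional q rho r f M lam del.

Definition kap (e : R) : R := (4 * e `^ eta) `^ (1 + eta)^-1.

(** Hoelder's inequality on the sparse set, then [RH]. The powers of [c - b] cancel, and [kap e]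
    tends to 0 with [e]. *)
Lemma weight_of_sparse (Q : pred nat) e a b c : (a <= b < c)%N -> 0 <= e ->
  \sum_(a <= i < b | Q i) 1 <= e * (c - b)%:R ->
  \sum_(a <= i < b | Q i) w i <= kap e * \sum_(a <= i < c) w i.
Proof.
move=> abc e0 Qe; have W0 : 0 <= \sum_(a <= i < c) w i by exact: sumr_ge0.
have eta1 : 0 < 1 + eta by rewrite addr_gt0.
have X0 : 0 <= 4 * e `^ eta by rewrite mulr_ge0.
have cb : 0 < (c - b)%:R :> R by rewrite ltr0n subn_gt0; case/andP: abc.
have S0 : 0 <= \sum_(a <= i < b | Q i) w i by exact: sumr_ge0.
apply: (@powR_le_inj R (1 + eta)) => //; first by rewrite mulr_ge0// powR_ge0.
rewrite [leRHS]powRM ?powR_ge0// powRVK ?gt_eqF//.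
have := @powR_sum_le R nat [seq i <- index_iota a b | Q i] (1 + eta) w ltac:(by rewrite lerDl ltW).
rewrite !big_filter; under eq_bigr do rewrite ger0_norm//.
under [in X in _ <= X -> _]eq_bigr do rewrite ger0_norm//.
have -> : (size [seq i <- index_iota a b | Q i])%:R = \sum_(a <= i < b | Q i) (1 : R).
  by rewrite size_filter -sum1_count natr_sum.
rewrite [1 + eta - 1]addrC addKr => H; apply: (le_trans H).
have H1 : \sum_(a <= i < b | Q i) w i `^ (1 + eta) <= \sum_(a <= i < b) w i `^ (1 + eta).
  by rewrite big_mkcond; apply: ler_sum => i _; case: ifP.
apply: (le_trans (ler_wpM2l (powR_ge0 _ _) (le_trans H1 (RH abc)))).
have N0 : 0 <= \sum_(a <= i < b | Q i) (1 : R) by exact: sumr_ge0.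
apply: (le_trans (ler_wpM2r _ (le_powR (ltW eta0) N0 Qe))).
  by rewrite !mulr_ge0.
have -> : (e * (c - b)%:R) `^ eta = e `^ eta * (c - b)%:R `^ eta by rewrite powRM.
have -> : ((\sum_(a <= i < c) w i) / (c - b)%:R) `^ eta =
  (\sum_(a <= i < c) w i) `^ eta / (c - b)%:R `^ eta by rewrite powR_div.
have P0 : (c - b)%:R `^ eta != 0 :> R by rewrite gt_eqF ?powR_gt0.
move: W0; rewrite le_eqVlt => /predU1P[<-|W0]; first by rewrite !mulr0 mulr_ge0// mulr_ge0.
rewrite powRD_pos// powRr1 ?(ltW W0)//.
by apply: eq_le; field.
Qed.

Lemma exceptional_gt x : E x -> lam < T x.
Proof. by case/andP => + _; apply: le_lt_trans; rewrite ler_peMl ?(ltW lam0)// ler1n. Qed.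

(* Whitney pieces [2^j <= z - x < 2^(j+1)] of a run ending at [z]. On each of them the
   exceptional set is sparse, and the reverse Hoelder inequality, with the next piece
   as the right part, turns this into a weighted bound; the piece [j = 0] is not
   exceptional at all because its only point would be counted by less than 1. *)
Lemma exceptional_run a z (e := 6 * C0 * del) : (a <= z)%N -> T z <= lam ->
  \sum_(a <= x < z | E x) w x <= 2 * kap e * \sum_(a <= x < z) w x.
Proof.
move=> az Tz; have e0 : 0 <= e by rewrite /e !mulr_ge0.
have k0 : 0 <= kap e by exact: powR_ge0.
pose t x := trunc_log 2 (z - x).
have tb x : (x < z)%N -> (2 ^ t x <= z - x < 2 ^ (t x).+1)%N.
  by move=> xz; apply: trunc_log_bounds => //; rewrite subn_gt0.
have card := exceptional_card r1 rrho rq C00 weak0 fL lam0 del0 delS _ Tz.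
(* The interval used for piece [j] only meets the pieces [j] and [j - 1], so a point is charged by
   the indices [t x] and [(t x).+1]; this is the factor 2 in the conclusion. *)
pose A j x := (((j == t x)%:R + (j == (t x).+1)%:R) * w x : R).
have A0 j x : 0 <= A j x by rewrite mulr_ge0// addr_ge0// ler0n.
have piece j : \sum_(a <= x < z | E x && (t x == j)) w x <= kap e * \sum_(a <= x < z) A j x.
  have [j0|j0] := posnP j.
    rewrite big_nat_cond big1 ?mulr_ge0 ?sumr_ge0// => x /andP[/andP[ax xz] /andP[Ex /eqP tx]].
    exfalso; have := card 1%N isT; rewrite muln1 mulr1 subn1 /= => H.
    have := tb x xz; rewrite tx j0 expn0 expn1 => h.
    have xE : x = z.-1 by clear -h xz; lia.
    have : 1 <= \sum_(z.+1 - 2 <= x < z | E x) (1 : R).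
      rewrite big_mkcond /=; apply: le_trans (ler_term_sum (n := x) _ _); first by rewrite Ex.
        by move=> i; case: ifP.
      by rewrite xz andbT xE; clear; lia.
    by move=> H2; have := le_lt_trans (le_trans H2 H) delC; rewrite ltxx.
  pose l2 := (2 ^ j.-1)%N; have l2E : (2 ^ j = 2 * l2)%N by rewrite -expnS prednK.
  have l20 : (0 < l2)%N by rewrite expn_gt0.
  have tE x : (x < z)%N -> t x = j -> (2 * l2 <= z - x < 2 * (2 * l2))%N.
    by move=> xz tx; have := tb x xz; rewrite tx expnS l2E.
  have [aa|aa] := leqP (z.+1 - 2 * l2) (maxn a (z.+1 - 2 * (2 * l2))).
    rewrite big_nat_cond big1 ?mulr_ge0 ?sumr_ge0// => x /andP[/andP[ax xz] /andP[Ex /eqP tx]].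
    exfalso; have := tE x xz tx; move: aa; rewrite leq_max; clear -ax xz; lia.
  have H := card (2 * l2)%N ltac:(by rewrite muln_gt0).
  have [aa1 aa2] : (a < z.+1 - 2 * l2)%N /\ (z.+1 - 2 * (2 * l2) < z.+1 - 2 * l2)%N.
    by move: aa; rewrite gtn_max => /andP.
  set a' := maxn a (z.+1 - 2 * (2 * l2)) in aa.
  have S : \sum_(a' <= x < z.+1 - 2 * l2 | E x) w x <= kap e * \sum_(a' <= x < z.+1 - l2) w x.
    apply: weight_of_sparse => //.
      rewrite (ltnW aa)/=; clear -aa1 l20; lia.
    apply: (@le_trans _ _ (\sum_(z.+1 - 2 * (2 * l2) <= x < z.+1 - 2 * l2 | E x) 1)).
      rewrite big_mkcond [leRHS]big_mkcond/=; apply: ler_sum_widen => //.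
        by move=> i; case: ifP.
      exact: leq_maxr.
    apply: (le_trans H); have -> : (z.+1 - l2 - (z.+1 - 2 * l2) = l2)%N by clear -aa1; lia.
    by rewrite natrM /e; apply: eq_le; ring.
  apply: (le_trans _ (le_trans S _)).
    rewrite big_nat_cond [leRHS]big_mkcond/=.
    apply: (@le_trans _ _ (\sum_(a <= x < z) if (a' <= x < z.+1 - 2 * l2)%N && E x then w x else 0)).
      rewrite -big_nat_cond big_mkcond big_nat [leRHS]big_nat; apply: ler_sum => x /andP[ax xz].
      case: ifPn => [/andP[Ex /eqP tx]|_]; last by case: ifP.
      rewrite Ex andbT ifT//; have := tE x xz tx; rewrite /a' geq_max ax /=; clear -xz; lia.
    have h1 : (a <= a')%N by exact: leq_maxl.
    have h2 : (z.+1 - 2 * l2 <= z)%N by clear -l20; lia.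
    rewrite (@sum_cat _ _ a a')//; last exact: leq_trans (ltnW aa) h2.
    rewrite (@sum_cat _ _ a' (z.+1 - 2 * l2))// ?(ltnW aa)//.
    rewrite [X in X + _]big_nat [X in X + _]big1 ?add0r; last first.
      by move=> i /andP[_ iy]; rewrite leqNgt iy.
    rewrite [X in _ + X]big_nat [X in _ + X]big1 ?addr0; last first.
      by move=> i /andP[iy _]; rewrite [(i < _)%N]ltnNge iy andbF.
    by rewrite !big_nat; apply: ler_sum => i ->.
  rewrite ler_wpM2l//; apply: (@le_trans _ _ (\sum_(a' <= x < z.+1 - l2) A j x)).
    rewrite big_nat [leRHS]big_nat; apply: ler_sum => x /andP[ax xz].
    rewrite /A ler_peMl//.
    have h : (l2 <= z - x < 4 * l2)%N.
      move: ax; rewrite geq_max => /andP[_ ax]; clear -ax xz aa1 l20; lia.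
    have [h2|h2] := leqP (2 * l2) (z - x).
      have -> : t x = j.
        apply: trunc_log_eq => //; rewrite expnS l2E h2 /=.
        by case/andP: h => _; rewrite (mulnA 2 2 l2).
      by rewrite eqxx lerDl ler0n.
    have -> : t x = j.-1.
      by apply: trunc_log_eq => //; rewrite prednK// l2E h2 andbT; case/andP: h.
    by rewrite prednK// eqxx lerDr ler0n.
  apply: ler_sum_widen => //; first exact: leq_maxl.
  clear -l20; lia.
apply: (@le_trans _ _ (\sum_(0 <= j < z) \sum_(a <= x < z | E x && (t x == j)) w x)).
  rewrite (exchange_big_dep (fun x => E x))/=; last by move=> j x _ /andP[].
  rewrite big_nat_cond [leRHS]big_nat_cond; apply: ler_sum => x /andP[/andP[ax xz] Ex].
  have tz : (t x < z)%N.
    have /andP[h _] := tb x xz; apply: leq_trans (ltn_expl (t x) (ltnSn 1)) _.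
    exact: leq_trans h (leq_subr _ _).
  rewrite big_mkcond/=; apply: le_trans (ler_term_sum (n := t x) _ _).
  - by rewrite Ex eqxx.
  - by move=> i; case: ifP.
  - by [].
apply: (le_trans (ler_sum _ (fun j _ => piece j))).
rewrite -mulr_sumr exchange_big/=.
have -> : 2 * kap e * \sum_(a <= x < z) w x = kap e * (2 * \sum_(a <= x < z) w x) by ring.
apply: (ler_wpM2l k0); rewrite mulr_sumr; apply: ler_sum => x _.
rewrite /A -mulr_suml ler_wpM2r// big_split/=.
exact: lerD (sum_pred1_le _ _ _) (sum_pred1_le _ _ _).
Qed.

(** Exceptional points have [T > lam]. The point following a run of this set has [T <= lam] and
    plays the role of [z] in [exceptional_run]; the last run ends before [L], where [T] vanishes. *)
Lemma exceptional_mass : \sum_(0 <= x < L | E x) w x <=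
  2 * kap (6 * C0 * del) * \sum_(0 <= x < L | lam < T x) w x.
Proof.
have k0 : 0 <= 2 * kap (6 * C0 * del) by rewrite mulr_ge0// powR_ge0.
pose P x := lam < T x.
have EP x : E x -> P x by exact: exceptional_gt.
suff H n : forall m, (m <= n)%N -> ~~ P m ->
    \sum_(0 <= x < m | E x) w x <= 2 * kap (6 * C0 * del) * \sum_(0 <= x < m | P x) w x.
  have TL : T L = 0.
    by apply: VT_supp fL (leqnn L); [exact: ltW (lt_le_trans r1 rq)|exact: ltW (lt_le_trans r1 rrho)].
  by apply: (H L) => //; rewrite /P TL -leNgt ltW.
elim: n => [|n IH] m.
  by rewrite leqn0 => /eqP -> _; rewrite !big_geq// mulr0.
case: m => [|m] mn Pm; first by rewrite !big_geq// mulr0.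
have [Pm'|Pm'] := boolP (P m); last first.
  rewrite !(big_mkcond (fun x => E x)) !(big_mkcond (fun x => P x)) !big_nat_recr//= -!big_mkcond.
  rewrite (negPf Pm') ifF ?addr0; last by apply/negP => /EP; rewrite (negPf Pm').
  exact: IH.
pose a := run_lo P m; have am : (a <= m)%N by exact: run_lo_le.
have Pin i : (a <= i <= m)%N -> P i by move=> h; have [] := run_lo_in Pm' h.
rewrite big_mkcond [X in _ * X]big_mkcond /= (@sum_cat _ _ 0 a m.+1)// ?leqW//.
rewrite [X in _ * X](@sum_cat _ _ 0 a m.+1)// ?leqW// mulrDr; apply: lerD; last first.
  rewrite -big_mkcond; apply: (le_trans (exceptional_run (leqW am) _)).
    by rewrite leNgt.
  apply: ler_wpM2l => //; rewrite !big_nat; apply: ler_sum => i h.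
  by rewrite Pin.
rewrite -!big_mkcond; have [a0|a0] := posnP a; first by rewrite a0 !big_geq// mulr0.
have Pa : ~~ P a.-1 by exact: run_lo_pred.
have an : (a.-1 <= n)%N by rewrite -ltnS prednK//; exact: leq_trans am (ltnW mn).
rewrite -(prednK a0) !(big_mkcond (fun x => E x)) !(big_mkcond (fun x => P x)) !big_nat_recr//= -!big_mkcond.
rewrite (negPf Pa) ifF ?addr0; last by apply/negP => /EP; rewrite (negPf Pa).
exact: IH.
Qed.

Lemma good_lambda_step : \sum_(0 <= x < L | 3 * lam < T x) w x <=
  \sum_(0 <= x < L | msup (fun i => vnm rho f i `^ r) (del * lam `^ r) x) w x +
  2 * kap (6 * C0 * del) * \sum_(0 <= x < L | lam < T x) w x.
Proof.
apply: le_trans (lerD (lexx _) exceptional_mass); apply: ler_sum_predU => // x _ Tx.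
by rewrite /E /exceptional Tx /= orbN.
Qed.

End GoodLambdaGlobal.

(** Iterate from [x] down to [x / 3 ^ n]: the a priori bound stays below [x ^ P W] while its
    coefficient is [2 ^ (- n)]. The a priori bound takes the place of a supremum over [x], whose
    finiteness would be needed for absorption. *)
Lemma halving_bound (R : realType) (phi : R -> R) (A P W : R) : 0 <= A -> 0 <= P -> 0 <= W ->
  (forall x, 0 < x -> phi (3 * x) <= A + 2^-1 * phi x) ->
  (forall x, 0 < x -> phi x <= x `^ P * W) -> forall x, 0 < x -> phi x <= 2 * A.
Proof.
move=> A0 P0 W0 step bnd.
have H n : forall x, 0 < x -> 2 ^+ n * (phi x - 2 * A) <= x `^ P * W.
  elim: n => [|n IH] x x0; first by rewrite mul1r; have := bnd x x0; lra.
  have x3 : 0 < x / 3 by rewrite divr_gt0.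
  have := step _ x3; rewrite mulrCA divff// mulr1 => Hx.
  have := IH _ x3; have : (x / 3) `^ P * W <= x `^ P * W.
    rewrite ler_wpM2r//; apply: le_powR => //; lra.
  have h : phi x - 2 * A <= 2^-1 * (phi (x / 3) - 2 * A) by lra.
  have p2 : 0 <= (2 : R) ^+ n by rewrite exprn_ge0.
  have := ler_wpM2l p2 h; rewrite exprS; lra.
move=> x x0; rewrite leNgt; apply/negP => h.
have h' : 0 < phi x - 2 * A by rewrite subr_gt0.
have [n h2] := expr2_unbounded (x `^ P * W) h'.
by move: (le_lt_trans (H n x x0) h2); rewrite mulrC ltxx.
Qed.

Lemma small_parameter (R : realType) (c s del m t : R) : 0 <= c -> 0 <= s -> 0 < del ->
  del * (6 * (c + 1) * (s + 1)) = m -> m <= 1 -> m <= t ->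
  [/\ s * del <= 1, 3 * c * del < 1 & 6 * c * del <= t].
Proof.
move=> c0 s0 d0 E m1 mt.
have h1 : 0 <= c * del by rewrite mulr_ge0// ltW.
have h2 : 0 <= s * del by rewrite mulr_ge0// ltW.
have h3 : 0 <= c * del * s by rewrite mulr_ge0.
by split; lra.
Qed.

Lemma good_lambda_arith (R : realType) (X T3 Sm T1 p3 k D B S : R) : 0 <= X -> 0 < p3 -> 0 < D ->
  0 <= T1 -> T3 <= Sm + k * T1 -> D * X * Sm <= B * S -> k <= 2^-1 / p3 ->
  p3 * X * T3 <= p3 * (B / D) * S + 2^-1 * (X * T1).
Proof.
move=> X0 p30 D0 T10 HT HS Hk; have pX : 0 <= p3 * X by rewrite mulr_ge0// ltW.
apply: (le_trans (ler_wpM2l pX HT)); rewrite mulrDr; apply: lerD.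
  rewrite -!mulrA (ler_pM2l p30) mulrCA -ler_pdivrMl ?invr_gt0// invrK.
  by rewrite mulrA.
have XT : 0 <= X * T1 by rewrite mulr_ge0.
have : p3 * k <= 2^-1 by rewrite mulrC -ler_pdivlMr.
move=> h; have := ler_wpM2r XT h; apply: le_trans; apply: eq_le; ring.
Qed.

Lemma powR_scaled (R : realType) (d x r P : R) : 0 <= d -> 0 < r ->
  (d * x `^ r) `^ (P / r) = d `^ (P / r) * x `^ P.
Proof. by move=> d0 r0; rewrite powRM// -powRrM mulrCA divff ?mulr1// gt_eqF. Qed.

Lemma good_lambda (R : realType) (q rho r C0 P Cw : R) :
  1 < r -> r <= rho -> r <= q -> 0 <= C0 -> r <= P -> 0 <= Cw ->
  exists2 C : R, 0 <= C & forall (K : finType) (w : nat -> R), (forall n, 0 < w n) ->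
    weakT q rho K r C0 (fun=> 1) -> Bp (P / r) Cw w -> weakT q rho K P C w.
Proof.
move=> r1 rrho rq C00 rP Cw0.
have r0 : 0 < r by exact: lt_trans r1.
have P0 : 0 < P by exact: lt_le_trans rP.
have Pr1 : 1 <= P / r by rewrite ler_pdivlMr// mul1r.
(* [P / r] may equal 1, where [reverse_holder] does not apply, so the exponent of [Bp] is raised by
   1. *)
have Pr2 : 1 < P / r + 1 by rewrite ltrDr (lt_le_trans ltr01).
have [eta eta0 RHall] := reverse_holder Pr2 Cw0.
have S0 := shiftC_ge0 r1.
have e1 : 0 < 1 + eta by rewrite addr_gt0.
(* Solves [kap tt = 1 / (4 * 3 ^ P)]. After multiplication by [3 ^ P], caused by [3 lam] against
   [lam], the absorbed term has coefficient 1 / 2. *)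
pose tt : R := ((4 * 3 `^ P)^-1 `^ (1 + eta) / 4) `^ eta^-1.
have p3 : 0 < (3 : R) `^ P by exact: powR_gt0.
have tt0 : 0 < tt by rewrite powR_gt0// divr_gt0// powR_gt0// invr_gt0 mulr_gt0.
pose m : R := Num.min 1 tt.
have m0 : 0 < m by rewrite lt_min ltr01.
have m1 : m <= 1 by rewrite ge_min lexx.
have mt : m <= tt by rewrite ge_min lexx orbT.
pose d : R := 6 * (C0 + 1) * (shiftC r + 1).
have d0 : 0 < d by rewrite /d !mulr_gt0//; lra.
pose del : R := m / d.
have del0 : 0 < del by rewrite divr_gt0.
have delE : del * d = m by rewrite /del divfK// gt_eqF.
have [delS delC delk] : [/\ shiftC r * del <= 1, 3 * C0 * del < 1 & 6 * C0 * del <= tt].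
  exact: small_parameter C00 S0 del0 delE m1 mt.
have kE : 2 * kap eta (6 * C0 * del) <= 2^-1 / 3 `^ P.
  have : kap eta (6 * C0 * del) <= (4 * 3 `^ P)^-1.
    have t4 : 0 <= (4 * 3 `^ P : R)^-1 by rewrite invr_ge0 mulr_ge0// ltW.
    apply: powR_le_root => //; first by rewrite mulr_ge0.
    rewrite -ler_pdivlMl// [leRHS]mulrC.
    have -> : (4 * 3 `^ P)^-1 `^ (1 + eta) / 4 = tt `^ eta.
      by rewrite /tt powRVK ?gt_eqF// divr_ge0// powR_ge0.
    by apply: (le_powR (ltW eta0) _ delk); apply: mulr_ge0 (ltW del0); exact: mulr_ge0.
  move=> hk; rewrite (_ : 2^-1 / 3 `^ P = 2 * (4 * 3 `^ P)^-1); last by field; rewrite gt_eqF.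
  by rewrite ler_pM2l.
pose A0 := 3 `^ P * (2 * (4 `^ (P / r) * Cw) / del `^ (P / r)).
have A00 : 0 <= A0.
  by rewrite /A0; apply: mulr_ge0 => //; apply: divr_ge0 => //; do 2 apply: mulr_ge0 => //.
exists (2 * A0); first by rewrite mulr_ge0.
move=> K w w0 W0 Bw M L f lam fL lam0.
have wge0 n : 0 <= w n by exact: ltW.
have Bw2 : Bp (P / r + 1) Cw w.
  by apply: Bp_exponent Bw => //; rewrite lerDl.
have RH a b c : (a <= b < c)%N -> \sum_(a <= i < b) w i `^ (1 + eta) <=
  4 * ((\sum_(a <= i < c) w i) / (c - b)%:R) `^ eta * \sum_(a <= i < c) w i.
  by move=> abc; apply: (RHall c w w0 _ a b c abc (leqnn c)); apply: Bp_Ainf Bw2; exact: ltW.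
set S := \sum_(0 <= n < L) vnm rho f n `^ P * w n.
have S00 : 0 <= S by apply: sumr_ge0 => i _; rewrite mulr_ge0.
pose phi (x : R) := x `^ P * \sum_(0 <= n < L | x < VT q rho M f n) w n.
suff : phi lam <= 2 * (A0 * S) by rewrite mulrA.
have W00 : 0 <= \sum_(0 <= n < L) w n by exact: sumr_ge0.
apply: (@halving_bound R phi (A0 * S) P (\sum_(0 <= n < L) w n)) => //.
- by rewrite mulr_ge0.
- move=> x x0; have X3 : (3 * x) `^ P = 3 `^ P * x `^ P by rewrite powRM// ltW.
  have G := @good_lambda_step R q rho r C0 K r1 rrho rq C00 W0 f L M x del fL x0 (ltW del0) delS delC w eta w0 eta0 RH.
  have dx : 0 < del * x `^ r by rewrite mulr_gt0// powR_gt0.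
  have Hm := @weak_maximal R (P / r) Cw w (fun i => vnm rho f i `^ r) (del * x `^ r) L Pr1 Cw0 wge0
    (fun i => powR_ge0 _ _) _ dx Bw.
  have Hr i : (L <= i)%N -> vnm rho f i `^ r = 0.
    move=> Li; have rho1 : 1 <= rho by exact: ltW (lt_le_trans r1 rrho).
    by rewrite (vnm0 rho1) ?powR0 ?gt_eqF// => k; exact: fL.
  have {}Hm := Hm Hr.
  have SE : \sum_(0 <= n < L) (vnm rho f n `^ r) `^ (P / r) * w n = S.
    by apply: eq_bigr => n _; rewrite -powRrM mulrCA divff ?mulr1// gt_eqF.
  have DE : (del * x `^ r) `^ (P / r) = del `^ (P / r) * x `^ P.
    exact: powR_scaled (ltW del0) r0.
  move: Hm; rewrite SE DE => Hm; rewrite /phi X3.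
  apply: (good_lambda_arith (powR_ge0 _ _) p3 (powR_gt0 _ del0) _ G Hm kE).
  exact: sumr_ge0.
move=> x x0; rewrite /phi ler_wpM2l// big_mkcond; apply: ler_sum => i _.
by case: ifP.
Qed.

(** * Dyadic martingales and Lepingle's inequality *)

Section DyadicAverages.
Variables (R : realType) (f : nat -> R).
Implicit Types (j m n i J : nat).

Definition dyav j m : R := (\sum_(m * 2 ^ j <= i < m.+1 * 2 ^ j) f i) / (2 ^ j)%:R.

Definition dyE j n : R := dyav j (n %/ 2 ^ j).

Lemma expn2_R j : 0 < (2 ^ j)%:R :> R. Proof. by rewrite ltr0n expn_gt0. Qed.

Lemma sum_dyadic (G : nat -> R) l n :
  \sum_(0 <= m < n) \sum_(m * l <= i < m.+1 * l) G i = \sum_(0 <= i < n * l) G i.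
Proof. by have := sum_blocks G 0 l n; rewrite add0n. Qed.

Lemma block_div j m n : (m * 2 ^ j <= n < m.+1 * 2 ^ j)%N -> (n %/ 2 ^ j = m)%N.
Proof.
move=> /andP[mn nm]; apply/eqP; rewrite eqn_leq -ltnS ltn_divLR ?expn_gt0// nm /=.
by rewrite leq_divRL ?expn_gt0.
Qed.

Lemma dyav_mul j m : \sum_(m * 2 ^ j <= i < m.+1 * 2 ^ j) f i = (2 ^ j)%:R * dyav j m.
Proof. by rewrite mulrC divfK// gt_eqF// expn2_R. Qed.

Lemma dyavS j m : dyav j.+1 m = (dyav j (2 * m) + dyav j (2 * m).+1) / 2.
Proof.
have e1 : (m * 2 ^ j.+1 = 2 * m * 2 ^ j)%N by rewrite expnS; lia.
have e2 : (m.+1 * 2 ^ j.+1 = (2 * m).+2 * 2 ^ j)%N by rewrite expnS; lia.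
rewrite /dyav e1 e2 (@sum_cat _ _ _ ((2 * m).+1 * 2 ^ j)); try (rewrite leq_mul2r; lia).
rewrite expnS natrM; field; rewrite gt_eqF// expn2_R.
Qed.

Lemma div_coarser j j' n n' : (j <= j')%N -> (n %/ 2 ^ j = n' %/ 2 ^ j)%N ->
  (n %/ 2 ^ j' = n' %/ 2 ^ j')%N.
Proof. by move=> /subnKC <- h; rewrite expnD !divnMA h. Qed.

Lemma dyE_same j n n' : (n %/ 2 ^ j = n' %/ 2 ^ j)%N -> dyE j n = dyE j n'.
Proof. by rewrite /dyE => ->. Qed.

Section Jumps.
Variables (lam : R) (J : nat).
Hypothesis lam0 : 0 <= lam.

(* Going down the dyadic tree from level [J], a jump is recorded each time the average
   moves away from the value at the previous jump by more than [lam]. *)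
Fixpoint jump_state i n : R * nat :=
  if i is i'.+1 then
    let s := jump_state i' n in
    let b := dyE (J - i') n in
    if lam < `|b - s.1| then (b, s.2.+1) else s
  else (0, 0%N).

(** Step [i] of [jump_state] looks at level [J - i], so this counts the jumps recorded at the levels
    from [J] down to [j]. *)
Definition jumps j n := (jump_state (J - j).+1 n).2.

Lemma jump_stateS i n : jump_state i.+1 n =
  if lam < `|dyE (J - i) n - (jump_state i n).1|
  then (dyE (J - i) n, (jump_state i n).2.+1) else jump_state i n.
Proof. by []. Qed.

Lemma jump_state_same i n n' : (n %/ 2 ^ (J - i) = n' %/ 2 ^ (J - i))%N ->
  jump_state i.+1 n = jump_state i.+1 n'.
Proof.
elim: i => [|i IH] h; first by rewrite !jump_stateS (dyE_same h).
have IHs : jump_state i.+1 n = jump_state i.+1 n'.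
  by apply: IH; apply: div_coarser h; rewrite leq_sub2l.
by rewrite [LHS]jump_stateS [RHS]jump_stateS (dyE_same h) IHs.
Qed.

Lemma jump_state_homo i i' n : (i <= i')%N ->
  ((jump_state i n).2 <= (jump_state i' n).2)%N /\
  ((jump_state i n).2 = (jump_state i' n).2 -> (jump_state i n).1 = (jump_state i' n).1).
Proof.
move=> /subnK <-; elim: (i' - i)%N => [|k [IH1 IH2]]; first by [].
rewrite addSn jump_stateS; case: ifPn => _; last by [].
split; first exact: leqW.
by move=> /= h; move: IH1; rewrite h ltnn.
Qed.

Lemma jump_state_near i n : `|dyE (J - i) n - (jump_state i.+1 n).1| <= lam.
Proof.
rewrite jump_stateS; case: ifPn => /=; first by rewrite subrr normr0.
by rewrite -leNgt.
Qed.

Lemma jumps_nonincreasing j j' n : (j <= j')%N -> (jumps j' n <= jumps j n)%N.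
Proof. by move=> jj; case: (@jump_state_homo (J - j').+1 (J - j).+1 n); rewrite ?ltnS ?leq_sub2l. Qed.

(** Without a jump in between, both averages would be within [lam] of the same reference value. *)
Lemma jumps_gt j j' n : (j <= j' <= J)%N -> 2 * lam < `|dyE j n - dyE j' n| ->
  (jumps j' n < jumps j n)%N.
Proof.
move=> /andP[jj' j'J] h; rewrite ltn_neqAle jumps_nonincreasing// andbT; apply/negP => /eqP E.
have [_ /(_ E) E1] := @jump_state_homo (J - j').+1 (J - j).+1 n ltac:(by rewrite ltnS leq_sub2l).
have h1 := jump_state_near (J - j) n; have h2 := jump_state_near (J - j') n.
rewrite !subKn ?(leq_trans jj')// in h1 h2; rewrite E1 in h2.
move: h; rewrite ltNge => /negP; apply.
have -> : dyE j n - dyE j' n = (dyE j n - (jump_state (J - j).+1 n).1) -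
  (dyE j' n - (jump_state (J - j).+1 n).1) by ring.
apply: (le_trans (ler_normB _ _)); rewrite mulr_natl mulr2n; exact: lerD.
Qed.

Lemma jumps_large j n : (j <= J)%N -> lam < `|dyE j n| -> (0 < jumps j n)%N.
Proof.
move=> jJ h; rewrite lt0n; apply/negP => /eqP E.
have [_ /(_ (esym E)) E1] := @jump_state_homo 0 (J - j).+1 n ltac:(by []).
have := jump_state_near (J - j) n; rewrite subKn// -E1 subr0 leNgt.
by rewrite h.
Qed.

Lemma block_energy j m r (b := dyav j m) :
  \sum_(m * 2 ^ j <= i < m.+1 * 2 ^ j) (f i - r) ^+ 2 =
  \sum_(m * 2 ^ j <= i < m.+1 * 2 ^ j) (f i - b) ^+ 2 + (2 ^ j)%:R * (b - r) ^+ 2.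
Proof.
have E i : (f i - r) ^+ 2 = (f i - b) ^+ 2 + (2 * (b - r) * f i + ((b - r) ^+ 2 - 2 * (b - r) * b)) by ring.
under eq_bigr do rewrite E.
rewrite big_split/= big_split/= -mulr_sumr dyav_mul sum_const_nat_R -/b.
have -> : (m.+1 * 2 ^ j - m * 2 ^ j = 2 ^ j)%N by rewrite mulSn addnK.
by move: ((2 ^ j)%:R : R) => x; congr (_ + _); ring.
Qed.

(** On a dyadic block, replacing the reference value [r] by the mean [b] lowers the sum of squares
    by [2 ^ j (b - r) ^ 2], more than [lam ^ 2] per point, which pays for recording the jump. So the
    total energy never increases, and jumps are counted against the sum of squares of [f]. *)
Definition jump_energy i n : R := (f n - (jump_state i n).1) ^+ 2 + lam ^+ 2 * (jump_state i n).2%:R.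

Lemma jump_energy_step i : (i <= J)%N ->
  \sum_(0 <= n < 2 ^ J) jump_energy i.+1 n <= \sum_(0 <= n < 2 ^ J) jump_energy i n.
Proof.
move=> iJ; set j := (J - i)%N.
have EJ : (2 ^ J = 2 ^ i * 2 ^ j)%N by rewrite -expnD subnKC.
rewrite EJ -!sum_dyadic; apply: ler_sum => m _.
set n0 := (m * 2 ^ j)%N.
have n0j : (n0 %/ 2 ^ j = m)%N by rewrite mulnK ?expn_gt0.
have st n : (m * 2 ^ j <= n < m.+1 * 2 ^ j)%N -> jump_state i n = jump_state i n0.
  move=> /block_div nj; case: i @j iJ {EJ} n0 n0j nj => // i j iJ n0 n0j nj.
  by apply: jump_state_same; apply: (@div_coarser j); [rewrite leq_sub2l|rewrite nj n0j].
have st1 n : (m * 2 ^ j <= n < m.+1 * 2 ^ j)%N -> jump_state i.+1 n = jump_state i.+1 n0.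
  by move=> /block_div nj; apply: jump_state_same; rewrite nj n0j.
rewrite big_nat [leRHS]big_nat.
rewrite (eq_bigr (fun n => (f n - (jump_state i.+1 n0).1) ^+ 2 + lam ^+ 2 * (jump_state i.+1 n0).2%:R)); last first.
  by move=> n /st1 h; rewrite /jump_energy h.
rewrite [leRHS](eq_bigr (fun n => (f n - (jump_state i n0).1) ^+ 2 + lam ^+ 2 * (jump_state i n0).2%:R)); last first.
  by move=> n /st h; rewrite /jump_energy h.
have := jump_stateS i n0; move: (jump_state i.+1 n0) => s1; rewrite -/j => s1E.
rewrite -!big_nat !big_split/= !sum_const_nat_R {}s1E; case: ifPn => // h.
rewrite /=; set r := (jump_state i n0).1 in h *.
rewrite [in leRHS](block_energy j m r) /dyE n0j -/(dyav j m).
have -> : (m.+1 * 2 ^ j - m * 2 ^ j = 2 ^ j)%N by rewrite mulSn addnK.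
rewrite -addrA lerD2l -natr1; move: h; rewrite -/j /dyE n0j => h.
have h2 : lam ^+ 2 <= (dyav j m - r) ^+ 2.
  by rewrite -[leRHS]real_normK ?num_real// lerXn2r ?nnegrE// ltW.
have := ler_wpM2l (ltW (expn2_R j)) h2; lra.
Qed.

Lemma sum_jumps_le : lam ^+ 2 * \sum_(0 <= n < 2 ^ J) (jumps 0 n)%:R <=
  \sum_(0 <= n < 2 ^ J) f n ^+ 2.
Proof.
have H i : (i <= J.+1)%N -> \sum_(0 <= n < 2 ^ J) jump_energy i n <= \sum_(0 <= n < 2 ^ J) f n ^+ 2.
  elim: i => [|i IH] iJ.
    by apply: ler_sum => n _; rewrite /jump_energy/= subr0 mulr0 addr0.
  by apply: le_trans (jump_energy_step _) (IH _); rewrite // ltnW.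
apply: le_trans (H J.+1 (leqnn _)); rewrite mulr_sumr; apply: ler_sum => n _.
by rewrite /jump_energy /jumps subn0 lerDr sqr_ge0.
Qed.

End Jumps.
End DyadicAverages.

Section DyadicVariation.
Variables (R : realType) (q : R).
Hypothesis q2 : 2 < q.

Definition dyadicC : R := 2 * 4 `^ q * geoC (q - 2) + 1.

Lemma threshold_level (lam x : R) K : x <= 2 * lam -> 2 * (lam / 2 ^+ K) < x ->
  exists2 l, (l <= K)%N & 2 * (lam / 2 ^+ l) < x <= 4 * (lam / 2 ^+ l).
Proof.
move=> x0 xK; have exl : exists l, 2 * (lam / 2 ^+ l) < x by exists K.
have [[|l] Hl lmin] := ex_minnP exl; first by move: Hl; rewrite expr0 divr1 ltNge x0.
exists l.+1; first exact: lmin.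
rewrite Hl /=; have : ~~ (2 * (lam / 2 ^+ l) < x) by apply/negP => /lmin; rewrite ltnn.
rewrite -leNgt => h; apply: (le_trans h); rewrite exprS invfM.
apply: eq_le; field; by rewrite expf_neq0// pnatr_eq0.
Qed.

Let q1 : 1 <= q. Proof. by apply: ltW; apply: lt_trans q2; rewrite ltr1n. Qed.

Let q0 : 0 <= q. Proof. exact: le_trans q1. Qed.

(* Lepingle's inequality: an increment of size about [2^-l lam] is paid for by a jump of
   that size, and the levels beyond [K] by the crude error term. *)
Lemma dyE_vari_le (f : nat -> R) (lam : R) J M K n : 0 < lam -> (M <= J)%N ->
  jumps f lam J 0 n = 0%N ->
  vari q M (fun j => dyE f j n) `^ q <=
  \sum_(0 <= l < K.+1) (4 * (lam / 2 ^+ l)) `^ q * (jumps f (lam / 2 ^+ l) J 0 n)%:R +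
  M%:R * (2 * (lam / 2 ^+ K)) `^ q.
Proof.
move=> lam0 MJ n0.
have lamK l : 0 < lam / 2 ^+ l by rewrite divr_gt0// exprn_gt0.
have small j : (j <= J)%N -> `|dyE f j n| <= lam.
  move=> jJ; rewrite leNgt; apply/negP => /(jumps_large (ltW lam0) jJ) h.
  have := jumps_nonincreasing f lam J n (leq0n j); rewrite n0 leqn0 => /eqP jE.
  by rewrite jE in h.
pose om j : R := j%:R * (2 * (lam / 2 ^+ K)) `^ q -
  \sum_(0 <= l < K.+1) (4 * (lam / 2 ^+ l)) `^ q * (jumps f (lam / 2 ^+ l) J j n)%:R.
have ctrl : controls q M (fun j => dyE f j n) om.
  move=> j j' /andP[jj' j'M]; have j'J := leq_trans j'M MJ.
  move: jj'; rewrite leq_eqVlt => /predU1P[<-|jj'].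
    by rewrite !subrr normr0 powR0// gt_eqF//; exact: lt_le_trans q1.
  pose D l : R := (4 * (lam / 2 ^+ l)) `^ q *
    ((jumps f (lam / 2 ^+ l) J j n)%:R - (jumps f (lam / 2 ^+ l) J j' n)%:R).
  have D0 l : 0 <= D l.
    by rewrite mulr_ge0// subr_ge0 ler_nat jumps_nonincreasing// ltnW.
  have -> : om j' - om j = (j' - j)%:R * (2 * (lam / 2 ^+ K)) `^ q + \sum_(0 <= l < K.+1) D l.
    rewrite /om /D; under [in RHS]eq_bigr do rewrite mulrBr.
    by rewrite sumrB natrB ?(ltnW jj')//; ring.
  have Dsum : 0 <= \sum_(0 <= l < K.+1) D l by exact: sumr_ge0.
  have [small_gap|big_gap] := leP `|dyE f j' n - dyE f j n| (2 * (lam / 2 ^+ K)).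
    apply: (@le_trans _ _ ((2 * (lam / 2 ^+ K)) `^ q)); first exact: le_powR.
    by rewrite -[leLHS]addr0 lerD// ler_peMl// ler1n subn_gt0.
  have gap2 : `|dyE f j' n - dyE f j n| <= 2 * lam.
    apply: (le_trans (ler_normB _ _)); rewrite mulr_natl mulr2n.
    by rewrite lerD ?small// (leq_trans (ltnW jj')).
  have [l lK /andP[h1 h2]] := threshold_level gap2 big_gap.
  have jl : (jumps f (lam / 2 ^+ l) J j' n < jumps f (lam / 2 ^+ l) J j n)%N.
    by apply: jumps_gt; rewrite ?(ltW (lamK l)) ?(ltnW jj')// distrC.
  apply: (@le_trans _ _ (D l)); last first.
    rewrite -[leLHS]add0r lerD ?mulr_ge0 ?ler0n//.
    by apply: (@ler_term_sum _ D); rewrite ?ltnS.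
  apply: (@le_trans _ _ ((4 * (lam / 2 ^+ l)) `^ q)); first by apply: le_powR => //.
  by rewrite ler_peMr// -natrB ?ler1n ?subn_gt0// ltnW.
apply: (le_trans (vari_controls q1 (lexx q) ctrl)).
rewrite /om mul0r sub0r opprK addrC lerD2l gerBl; apply: sumr_ge0 => l _.
by rewrite mulr_ge0// ler0n.
Qed.

Lemma inv_powRN (x p : R) : 0 <= x -> x^-1 `^ (- p) = x `^ p.
Proof. by move=> x0; rewrite -(powR_inv1 x0) -powRrM mulrNN mul1r. Qed.

Lemma dyadic_weak (f : nat -> R) (lam : R) J M : 0 < lam -> (M <= J)%N ->
  lam ^+ 2 * \sum_(0 <= n < 2 ^ J | lam < vari q M (fun j => dyE f j n)) 1 <=
  dyadicC * \sum_(0 <= n < 2 ^ J) f n ^+ 2.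
Proof.
move=> lam0 MJ; have lam2 : 0 < lam ^+ 2 by rewrite exprn_gt0.
set S := \sum_(0 <= n < 2 ^ J) f n ^+ 2.
have S0 : 0 <= S by apply: sumr_ge0 => i _; exact: sqr_ge0.
have lamK l : 0 < lam / 2 ^+ l by rewrite divr_gt0// exprn_gt0.
(* [K] is so large that the error term of [dyE_vari_le] is at most half of [lam ^ q]. *)
have [K HK] := @expr2_unbounded R 1 (2 * 2 `^ q * M%:R) ltr01.
rewrite mul1r in HK.
have tail : 2 * (M%:R * (2 * (lam / 2 ^+ K)) `^ q) <= lam `^ q.
  have p0 : 1 <= (2 : R) ^+ K by rewrite exprn_ege1// ler1n.
  have p1 : 0 < (2 : R) ^+ K by exact: lt_le_trans p0.
  rewrite mulrA [2 * (_ / _)]mulrA powR_div ?mulr_ge0 ?(ltW lam0) ?(ltW p1)//.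
  rewrite powRM ?(ltW lam0)// mulrA ler_pdivrMr ?powR_gt0//.
  have -> : 2 * M%:R * (2 `^ q * lam `^ q) = lam `^ q * (2 * 2 `^ q * M%:R) by ring.
  rewrite ler_wpM2l//; apply: (le_trans (ltW HK)).
  by rewrite -[leLHS](powRr1 (ltW p1)); apply: ler_powR.
pose P n := lam < vari q M (fun j => dyE f j n).
pose Q n := (0 < jumps f lam J 0 n)%N.
have H1 : lam ^+ 2 * \sum_(0 <= n < 2 ^ J | Q n) 1 <= S.
  apply: le_trans (sum_jumps_le f J (ltW lam0)); rewrite ler_pM2l// big_mkcond.
  by apply: ler_sum => n _; rewrite /Q; case: (jumps f lam J 0 n) => //= c; rewrite ler1n.
have H2 : lam `^ q * \sum_(0 <= n < 2 ^ J | P n && ~~ Q n) 1 <=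
    2 * (4 `^ q * (geoC (q - 2) * lam `^ (q - 2)) * S).
  apply: (@le_trans _ _ (\sum_(0 <= n < 2 ^ J) 2 * \sum_(0 <= l < K.+1)
      (4 * (lam / 2 ^+ l)) `^ q * (jumps f (lam / 2 ^+ l) J 0 n)%:R)).
    rewrite mulr_sumr big_mkcond; apply: ler_sum => n _; case: ifPn => [/andP[Pn Qn]|_]; last first.
      by rewrite mulr_ge0// sumr_ge0// => l _; rewrite mulr_ge0// ler0n.
    have n0 : jumps f lam J 0 n = 0%N by apply/eqP; rewrite -leqn0 leqNgt.
    have V := dyE_vari_le K lam0 MJ n0.
    have lV : lam `^ q <= vari q M (fun j => dyE f j n) `^ q.
      by apply: le_powR => //; exact: ltW.
    have := le_trans lV V; rewrite mulr1; move: tail; clear.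
    move: (\sum_(_ <= _ < _) _) (M%:R * _) (lam `^ q) => a b c; lra.
  rewrite -mulr_sumr ler_pM2l// exchange_big/=.
  have -> : 4 `^ q * (geoC (q - 2) * lam `^ (q - 2)) * S =
    4 `^ q * S * (geoC (q - 2) * lam `^ (q - 2)) by ring.
  (* Counting jumps of size [lam / 2 ^ l] costs [(lam / 2 ^ l) ^ (- 2)], which leaves the powers
     [(lam / 2 ^ l) ^ (q - 2)]: a convergent geometric series since [q > 2]. *)
  have G := @geo_sum_down R (q - 2) lam^-1 K.+1 ltac:(by rewrite subr_gt0) ltac:(by rewrite invr_gt0).
  rewrite inv_powRN ?(ltW lam0)// in G.
  have G0 : 0 <= 4 `^ q * S by rewrite mulr_ge0.
  apply: le_trans (ler_wpM2l G0 G); rewrite mulr_sumr; apply: ler_sum => l _.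
  have -> : lam^-1 * 2 ^+ l = (lam / 2 ^+ l)^-1 by rewrite invfM invrK.
  rewrite inv_powRN ?(ltW (lamK l))// -mulr_sumr powRM ?(ltW (lamK l))//.
  have -> : (lam / 2 ^+ l) `^ q = (lam / 2 ^+ l) `^ (q - 2) * (lam / 2 ^+ l) ^+ 2.
    by rewrite -(@powR_mulrn _ _ 2) ?(ltW (lamK l))// -powRD_pos// subrK.
  have := sum_jumps_le f J (ltW (lamK l)); rewrite -/S => H.
  have := ler_wpM2l (powR_ge0 4 q) (ler_wpM2l (powR_ge0 (lam / 2 ^+ l) (q - 2)) H).
  by rewrite [4 `^ q * S * _]mulrAC !mulrA.
have H3 : lam ^+ 2 * \sum_(0 <= n < 2 ^ J | P n && ~~ Q n) 1 <= 2 * 4 `^ q * geoC (q - 2) * S.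
  have lq : 0 < lam `^ (q - 2) by exact: powR_gt0.
  rewrite -(ler_pM2l lq) mulrA.
  have -> : lam `^ (q - 2) * lam ^+ 2 = lam `^ q.
    by rewrite -(@powR_mulrn _ _ 2) ?(ltW lam0)// -powRD_pos// subrK.
  by apply: (le_trans H2); apply: eq_le; ring.
have cover : \sum_(0 <= n < 2 ^ J | P n) (1 : R) <=
    \sum_(0 <= n < 2 ^ J | Q n) 1 + \sum_(0 <= n < 2 ^ J | P n && ~~ Q n) 1.
  by apply: (@ler_sum_predU _ (fun=> 1)) => // i _ ->; case: (Q i).
apply: (le_trans (ler_wpM2l (ltW lam2) cover)); rewrite mulrDr /dyadicC mulrDl mul1r addrC.
exact: lerD.
Qed.

End DyadicVariation.

(** * The square function *)

Lemma sum_shift (R : realType) (F : nat -> R) i A :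
  \sum_(i <= m < A + i) F m = \sum_(0 <= m < A) F (m + i)%N.
Proof. by have := @big_addn R 0 +%R 0 (A + i) i xpredT F; rewrite add0n addnK. Qed.

Lemma count_interval (R : realType) (P : pred nat) a b lo hi :
  (forall n, (a <= n < b)%N -> P n -> (lo <= n < hi)%N) ->
  \sum_(a <= n < b) ((P n)%:R : R) <= (hi - lo)%:R.
Proof.
move=> H; apply: (@le_trans _ _ (\sum_(a <= n < b) ((lo <= n < hi)%N%:R : R))).
  rewrite big_nat [leRHS]big_nat; apply: ler_sum => n nab.
  by case Pn : (P n); rewrite ?ler0n// (H _ nab Pn).
have [hl|lh] := leqP hi lo.
  rewrite big1 ?ler0n// => n _; have -> : (lo <= n < hi)%N = false by lia.
  by [].
apply: (@le_trans _ _ (\sum_(0 <= n < b + hi) ((lo <= n < hi)%N%:R : R))).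
  by apply: ler_sum_widen => //; exact: leq_addr.
rewrite (@sum_cat _ _ 0 lo)//; last by lia.
rewrite (@sum_cat _ _ lo hi)// ?(ltnW lh)// ?leq_addl//.
rewrite [X in X + _]big_nat [X in X + _]big1 ?add0r; last first.
  by move=> i /andP[_ iy]; rewrite leqNgt iy.
rewrite [X in _ + X]big_nat [X in _ + X]big1 ?addr0; last first.
  by move=> i /andP[iy _]; rewrite [(i < hi)%N]ltnNge iy andbF.
rewrite big_nat (eq_bigr (fun=> 1)); last by move=> i ->.
by rewrite -big_nat sum_const_nat_R mulr1.
Qed.

Lemma sum_window_supp (R : realType) (G : nat -> R) a b W : (forall i, 0 <= G i) ->
  (forall i, (W <= i)%N -> G i = 0) ->
  \sum_(a <= i < b) G i <= \sum_(0 <= i < W) (a <= i < b)%N%:R * G i.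
Proof.
move=> G0 GW; pose H i := (a <= i < b)%N%:R * G i.
have H0 i : 0 <= H i by rewrite mulr_ge0// ler0n.
have -> : \sum_(a <= i < b) G i = \sum_(a <= i < b) H i.
  by rewrite !big_nat; apply: eq_bigr => i ab; rewrite /H ab mul1r.
apply: (@le_trans _ _ (\sum_(0 <= i < b + W) H i)).
  by apply: ler_sum_widen => //; exact: leq_addr.
rewrite (@sum_cat _ _ 0 W)// ?leq_addl// [X in _ + X]big_nat [X in _ + X]big1 ?addr0//.
by move=> i /andP[Wi _]; rewrite /H GW// mulr0.
Qed.

Lemma sqr_sum_nat_le (R : realType) (u : nat -> R) a b l : (b - a <= l)%N -> (forall i, 0 <= u i) ->
  (\sum_(a <= i < b) u i) ^+ 2 <= l%:R * \sum_(a <= i < b) u i ^+ 2.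
Proof.
move=> bal u0; have := @sum_nat_powR_le R 2 u a b (ler1n _ 2) u0.
rewrite powR_mulrn ?sumr_ge0//; have -> : 2 - 1 = 1 :> R by ring.
rewrite powRr1 ?ler0n// => h; apply: (le_trans h).
under eq_bigr do rewrite powR_mulrn//.
by rewrite ler_wpM2r ?sumr_ge0 ?ler_nat// => i _; exact: sqr_ge0.
Qed.

Section SquareFunction.
Variables (R : realType) (f : nat -> R) (J : nat).
Hypothesis fJ : forall i, (2 ^ J <= i)%N -> f i = 0.
Implicit Types (j k m n i l t s N M : nat).

Definition dd k n : R := dyE f k n - dyE f k.+1 n.

Let W := (2 ^ J)%N.

Definition energy (g : nat -> R) : R := \sum_(0 <= n < W) g n ^+ 2.

Lemma energy_ge0 g : 0 <= energy g.
Proof. by apply: sumr_ge0 => i _; exact: sqr_ge0. Qed.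

Lemma sum_by_blocks (G : nat -> R) k A :
  \sum_(0 <= n < A * 2 ^ k) G (n %/ 2 ^ k)%N = (2 ^ k)%:R * \sum_(0 <= m < A) G m.
Proof.
rewrite -sum_dyadic mulr_sumr; apply: eq_bigr => m _.
rewrite big_nat (eq_bigr (fun=> G m)); last by move=> i /block_div ->.
by rewrite -big_nat sum_const_nat_R mulSn addnK.
Qed.

Lemma sum_pairs (G : nat -> R) A :
  \sum_(0 <= m < A * 2) G m = \sum_(0 <= m < A) (G (2 * m)%N + G (2 * m).+1).
Proof.
rewrite -sum_dyadic; apply: eq_bigr => m _.
rewrite (_ : m.+1 * 2 = (m * 2).+2)%N; last by lia.
by rewrite big_ltn// big_nat1 mulnC.
Qed.

Lemma dyE_div k n : dyE f k.+1 n = dyav f k.+1 (n %/ 2 ^ k %/ 2).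
Proof. by rewrite /dyE expnSr divnMA. Qed.

Lemma dyE0 n : dyE f 0 n = f n.
Proof. by rewrite /dyE /dyav expn0 divn1 !muln1 big_nat1 divr1. Qed.

Lemma ddE k n : dd k n = dyav f k (n %/ 2 ^ k) - dyav f k.+1 (n %/ 2 ^ k %/ 2).
Proof. by rewrite /dd dyE_div. Qed.

Lemma dd_same k n n' : (n %/ 2 ^ k = n' %/ 2 ^ k)%N -> dd k n = dd k n'.
Proof. by rewrite !ddE => ->. Qed.

Lemma half_double m : (2 * m %/ 2 = m)%N /\ ((2 * m).+1 %/ 2 = m)%N.
Proof. by split; lia. Qed.

(** Orthogonality on each pair of sibling blocks: [x ^ 2 + y ^ 2 = 2 m ^ 2 + (x - m) ^ 2 + (y - m) ^
    2] for the mean [m] of [x] and [y]. *)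
Lemma energy_dd k : (k < J)%N -> energy (dyE f k) = energy (dyE f k.+1) + energy (dd k).
Proof.
move=> kJ; have WE : (W = 2 ^ (J - k.+1) * 2 * 2 ^ k)%N.
  by rewrite -expnSr -expnD -subSn// addnC subnKC// ltnW.
rewrite /energy WE.
under [X in _ = X + _]eq_bigr do rewrite dyE_div.
under [X in _ = _ + X]eq_bigr do rewrite ddE.
rewrite (sum_by_blocks (fun m => dyav f k m ^+ 2)).
rewrite (sum_by_blocks (fun m => dyav f k.+1 (m %/ 2) ^+ 2)).
rewrite (sum_by_blocks (fun m => (dyav f k m - dyav f k.+1 (m %/ 2)) ^+ 2)).
rewrite -mulrDr; congr (_ * _); rewrite !sum_pairs -big_split/=; apply: eq_bigr => m _.
have [-> ->] := half_double m; rewrite dyavS; by field.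
Qed.

Lemma sum_energy_dd : \sum_(0 <= k < J) energy (dd k) <= energy f.
Proof.
have H i : (i <= J)%N -> \sum_(0 <= k < i) energy (dd k) = energy f - energy (dyE f i).
  elim: i => [|i IH] iJ.
    rewrite big_geq//; have -> : energy (dyE f 0) = energy f by apply: eq_bigr => n _; rewrite dyE0.
    by rewrite subrr.
  rewrite big_nat_recr//= IH ?(ltnW iJ)// (energy_dd iJ); ring.
by rewrite H// gerBl energy_ge0.
Qed.

Lemma dyE_supp k n : (k <= J)%N -> (W <= n)%N -> dyE f k n = 0.
Proof.
move=> kJ Wn; rewrite /dyE /dyav big_nat big1 ?mul0r// => i /andP[h _]; apply: fJ.
apply: leq_trans h; have WE : (2 ^ J = 2 ^ (J - k) * 2 ^ k)%N by rewrite -expnD subnK.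
by rewrite WE leq_mul2r leq_divRL ?expn_gt0// -WE Wn orbT.
Qed.

Lemma dd_supp k n : (k < J)%N -> (W <= n)%N -> dd k n = 0.
Proof. by move=> kJ Wn; rewrite /dd !dyE_supp ?subrr// ltnW. Qed.

Lemma dyE_sum j n : (j <= J)%N -> dyE f j n = \sum_(j <= k < J) dd k n + dyE f J n.
Proof.
move=> jJ; have -> : \sum_(j <= k < J) dd k n = \sum_(j <= k < J) (- dyE f k.+1 n - - dyE f k n).
  by apply: eq_bigr => k _; rewrite /dd; ring.
by rewrite telescope_sumr//; ring.
Qed.

Lemma shifts_sum (F : nat -> R) j : (j < J)%N -> \sum_(0 <= k < J) F k =
  \sum_(0 <= s < J) (if (j + s < J)%N then F (j + s)%N else 0) +
  \sum_(0 <= t < J) (if (t < j)%N then F (j - t.+1)%N else 0).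
Proof.
move=> jJ; rewrite (@sum_cat _ _ 0 j J)// ?(ltnW jJ)// addrC; congr (_ + _).
  rewrite (@sum_cat _ (fun s => if (j + s < J)%N then F (j + s)%N else 0) 0 (J - j) J)// ?leq_subr//.
  rewrite [X in _ = _ + X]big_nat [X in _ = _ + X]big1 ?addr0; last first.
    by move=> i /andP[h _]; rewrite ifF// ltnNge -leq_subLR h.
  rewrite -{1}[j]add0n big_addn !big_nat; apply: eq_bigr => i /andP[_ iJ].
  by rewrite addnC -ltn_subRL iJ.
rewrite (@sum_cat _ (fun t => if (t < j)%N then F (j - t.+1)%N else 0) 0 j J)// ?(ltnW jJ)//.
rewrite [X in _ = _ + X]big_nat [X in _ = _ + X]big1 ?addr0; last first.
  by move=> i /andP[h _]; rewrite ltnNge h.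
rewrite big_nat_rev /= add0n !big_nat; apply: eq_bigr => i /andP[_ ij].
by rewrite ij.
Qed.

(** The subtracted term is the conditional expectation of [dd k] at the scale of [N]: [dd k] itself
    if that scale is at most [k], and 0 by cancellation otherwise. *)
Definition dev k N n : R :=
  av (dd k) n N - (if (trunc_log 2 N.+1 <= k)%N then dd k n else 0).

(* The average at time [N] minus the conditional expectation at the dyadic scale [2^j] of
   [N], split according to the distance between [j] and the scale of the martingale
   difference. *)
Definition up_dev s n N : R :=
  if (trunc_log 2 N.+1 + s < J)%N then dev (trunc_log 2 N.+1 + s) N n else 0.

(* [dd k] is constant on blocks of length [2^k], so averages of length at most [2^(j+1)]
   differ from it only near the right end of a block. *)
Definition edge_size j k n : R :=
  if (2 ^ k < n %% 2 ^ k + 2 ^ j.+1)%N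
  then 2 * (`|dd k n| + `|dd k (n + 2 ^ k)| + `|dd k (n + 2 * 2 ^ k)|) else 0.

Lemma edge_size_ge0 j k n : 0 <= edge_size j k n.
Proof. by rewrite /edge_size; case: ifP => // _; rewrite mulr_ge0 ?addr_ge0. Qed.

Lemma dd_edge j k n i : (j <= k)%N -> (i < 2 ^ j.+1)%N ->
  `|dd k (n + i) - dd k n| <= edge_size j k n.
Proof.
move=> jk ij; rewrite /edge_size; have k0 : (0 < 2 ^ k)%N by rewrite expn_gt0.
have nE := divn_eq n (2 ^ k); have rk := ltn_pmod n k0.
set r := (n %% 2 ^ k)%N in nE rk *; set a := (n %/ 2 ^ k)%N in nE.
have blk b x : (b * 2 ^ k <= x < b.+1 * 2 ^ k)%N -> (x %/ 2 ^ k = b)%N by exact: block_div.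
case: ifPn => [_|]; last first.
  rewrite -leqNgt => h; have -> : dd k (n + i) = dd k n.
    by apply: dd_same; apply: blk; rewrite -/a mulSn; clear -h ij nE; lia.
  by rewrite subrr normr0.
have ik : (i < 2 * 2 ^ k)%N.
  by apply: leq_trans ij _; rewrite -expnS leq_pexp2l.
have na : (n %/ 2 ^ k = a)%N by [].
have n1 : ((n + 2 ^ k) %/ 2 ^ k = a.+1)%N by apply: blk; rewrite !mulSn; clear -nE rk; lia.
have n2 : ((n + 2 * 2 ^ k) %/ 2 ^ k = a.+2)%N by apply: blk; rewrite !mulSn; clear -nE rk; lia.
apply: (le_trans (ler_normB _ _)).
have h0 : `|dd k (n + i)| <= `|dd k n| + `|dd k (n + 2 ^ k)| + `|dd k (n + 2 * 2 ^ k)|.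
  have [i1|i1] := ltnP (r + i) (2 ^ k).
    have -> : dd k (n + i) = dd k n.
      by apply: dd_same; rewrite na; apply: blk; rewrite mulSn; clear -nE i1; lia.
    by rewrite -addrA lerDl addr_ge0.
  have [i2|i2] := ltnP (r + i) (2 * 2 ^ k).
    have -> : dd k (n + i) = dd k (n + 2 ^ k).
      by apply: dd_same; rewrite n1; apply: blk; rewrite !mulSn; clear -nE i1 i2; lia.
    by rewrite addrAC lerDr addr_ge0.
  have -> : dd k (n + i) = dd k (n + 2 * 2 ^ k).
    by apply: dd_same; rewrite n2; apply: blk; rewrite !mulSn; clear -nE i2 ik rk; lia.
  by rewrite lerDr addr_ge0.
rewrite mulr_natl mulr2n; apply: lerD h0 _.
by rewrite -addrA lerDl addr_ge0.
Qed.

(** The label of [N] is its dyadic scale [j]. A sum of at most [2 ^ j.+1] terms of size [edge_size]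
    is divided by at least [2 ^ j]; the quotient 2 is squared to 4. *)
Lemma up_dev_controls s n M : (M.+1 < 2 ^ J)%N ->
  vari 2 M (up_dev s n) `^ 2 <=
  fracC 2 * \sum_(0 <= j < J) (if (j + s < J)%N then 4 * edge_size j (j + s) n ^+ 2 else 0).
Proof.
move=> MJ; pose c N := trunc_log 2 N.+1.
have cb N : (2 ^ c N <= N.+1 < 2 ^ (c N).+1)%N by exact: trunc_log_bounds.
have cJ N : (N <= M)%N -> (c N < J)%N.
  move=> NM; rewrite -(ltn_exp2l _ _ (ltnSn 1)); case/andP: (cb N) => h _.
  by apply: leq_ltn_trans h _; apply: leq_ltn_trans MJ; rewrite ltnS.
pose S N := if (c N + s < J)%N then \sum_(n <= i < n + N.+1) (dd (c N + s) i - dd (c N + s) n) else 0.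
pose h j := if (j + s < J)%N then (2 ^ j.+1)%:R * edge_size j (j + s) n else 0.
pose d j : R := (2 ^ j)%:R.
have h0 j : 0 <= h j by rewrite /h; case: ifP => // _; rewrite mulr_ge0 ?ler0n ?edge_size_ge0.
have d0 j : 0 < d j by exact: expn2_R.
have SE N : up_dev s n N = S N / N.+1%:R.
  rewrite /up_dev /S -/(c N); case: ifP => _; last by rewrite mul0r.
  have -> : \sum_(n <= i < n + N.+1) (dd (c N + s) i - dd (c N + s) n) =
      \sum_(n <= i < n + N.+1) dd (c N + s) i - N.+1%:R * dd (c N + s) n.
    by rewrite big_split/= (sum_const_nat_R (- dd (c N + s) n)) addKn mulrN.
  rewrite /dev /av -/(c N) leq_addr mulrBl addnS; congr (_ - _).
  by rewrite mulrAC mulfV ?mul1r// pnatr_eq0.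
have [|||om [om1 om2]] := @frac_controls R 2 (ler1n _ 2) 0 M S c h d h0 d0.
- by move=> N N' _ NN' _; apply: leq_trunc_log.
- move=> N _; have /andP[b1 b2] := cb N; split; last by rewrite ler_nat.
  rewrite /S /h; case: ifP => _; last by rewrite normr0.
  apply: (le_trans (ler_norm_sum _ _ _)).
  apply: (@le_trans _ _ (\sum_(n <= i < n + N.+1) edge_size (c N) (c N + s) n)).
    rewrite big_nat [leRHS]big_nat; apply: ler_sum => i /andP[ni iN].
    rewrite -{1}(subnKC ni); apply: dd_edge; first exact: leq_addr.
    by clear -ni iN b2; lia.
  rewrite sum_const_nat_R addKn ler_wpM2r ?edge_size_ge0// ler_nat; exact: ltnW.
- move=> N N' _ NN' _ cc; have /andP[b1 _] := cb N; have /andP[_ b2] := cb N'.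
  rewrite -cc in b2.
  have len : (N' - N <= 2 ^ c N)%N by move: b2; rewrite expnS; clear -b1; lia.
  split; last by rewrite ler_nat.
  apply: (@le_trans _ _ (\sum_(N <= m < N') (if (c N + s < J)%N then edge_size (c N) (c N + s) n else 0))).
    rewrite big_nat [leRHS]big_nat; apply: ler_sum => m /andP[Nm mN'].
    have cm : c m = c N.
      apply/eqP; rewrite eqn_leq; apply/andP; split; last exact: leq_trunc_log.
      by rewrite cc; apply: leq_trunc_log; exact: ltnW.
    have cm1 : c m.+1 = c N.
      apply/eqP; rewrite eqn_leq; apply/andP; split; last by apply: leq_trunc_log; exact: leqW.
      by rewrite cc; apply: leq_trunc_log.
    rewrite /S cm cm1; case: ifP => _; last by rewrite subrr normr0.
    have e1 : (n <= n + m.+1)%N by exact: leq_addr.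
    have e2 : (n + m.+1 <= n + m.+2)%N by rewrite leq_add2l.
    rewrite [X in `|X - _|](sum_cat _ e1 e2) addrAC subrr add0r [(n + m.+2)%N]addnS big_nat1.
    by apply: dd_edge; [exact: leq_addr|clear -mN' b2; lia].
  rewrite sum_const_nat_R /h; case: ifP => _; last by rewrite mulr0.
  rewrite ler_wpM2r ?edge_size_ge0// ler_nat; apply: leq_trans len _.
  by rewrite leq_exp2l.
have ctrl : controls 2 M (up_dev s n) om.
  by move=> N N' /andP[NN' N'M]; rewrite !SE; exact: om1.
apply: (le_trans (vari_controls (ler1n _ 2) (lexx 2) ctrl)).
have /andP[om00 _] := om2 0%N ltac:(by []).
have /andP[_ omM] := om2 M ltac:(by rewrite leqnn).
apply: (@le_trans _ _ (om M)); first by rewrite gerBl.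
apply: (le_trans omM); apply: ler_wpM2l; first exact: fracC_ge0.
have T0 j : 0 <= (h j / d j) `^ 2 by exact: powR_ge0.
apply: (le_trans (ler_sum_widen T0 (leqnn 0) (cJ M (leqnn M)))).
apply: ler_sum => j _; rewrite /h /d; case: ifP => _; last by rewrite mul0r powR0.
have e0 := edge_size_ge0 j (j + s) n.
rewrite expnS natrM.
have -> : 2 * (2 ^ j)%:R * edge_size j (j + s) n / (2 ^ j)%:R = 2 * edge_size j (j + s) n.
  by field; rewrite gt_eqF// expn2_R.
rewrite powR_mulrn ?mulr_ge0// exprMn; apply: eq_le; ring.
Qed.

Lemma sqr_sum3_le (x y z : R) : 0 <= x -> 0 <= y -> 0 <= z ->
  (2 * (x + y + z)) ^+ 2 <= 12 * (x ^+ 2 + y ^+ 2 + z ^+ 2).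
Proof.
move=> x0 y0 z0; have h1 := sqr_ge0 (x - y); have h2 := sqr_ge0 (y - z); have h3 := sqr_ge0 (x - z).
nra.
Qed.

(** In each block of length [2 ^ k] at most [2 ^ j.+1] points are within reach of the right end, a
    fraction [2 ^ (1 - s)]. The 72 is this 2, times 12 from [sqr_sum3_le], times 3 for the three
    blocks involved. *)
Lemma edge_energy j s : (j + s < J)%N ->
  (2 ^ s)%:R * energy (edge_size j (j + s)) <= 72 * energy (dd (j + s)).
Proof.
set k := (j + s)%N => kJ; have k0 : (0 < 2 ^ k)%N by rewrite expn_gt0.
have WE : W = (2 ^ (J - k) * 2 ^ k)%N by rewrite -expnD subnK// ltnW.
set A := (2 ^ (J - k))%N in WE.
pose de m : R := dd k (m * 2 ^ k) ^+ 2.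
have de0 m : 0 <= de m by exact: sqr_ge0.
have deE n : dd k n ^+ 2 = de (n %/ 2 ^ k)%N.
  by congr (_ ^+ 2); apply: dd_same; rewrite mulnK.
have deA m : (A <= m)%N -> de m = 0.
  by move=> Am; rewrite /de dd_supp ?expr0n// WE leq_mul2r Am orbT.
pose D := \sum_(0 <= m < A) de m.
have eE : energy (dd k) = (2 ^ k)%:R * D.
  by rewrite /energy WE /D -sum_by_blocks; apply: eq_bigr => n _; exact: deE.
have sh i : \sum_(0 <= m < A) de (m + i)%N <= D.
  have -> : \sum_(0 <= m < A) de (m + i)%N = \sum_(i <= m < A + i) de m.
    by rewrite sum_shift.
  rewrite /D; have [iA|Ai] := leqP i A; last first.
    by rewrite big_nat big1 ?sumr_ge0// => m /andP[im _]; apply: deA; exact: leq_trans (ltnW Ai) im.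
  rewrite (@sum_cat _ _ i A)// ?leq_addr// [X in _ + X]big_nat [X in _ + X]big1 ?addr0.
    exact: ler_sum_widen.
  by move=> m /andP[Am _]; exact: deA.
pose g m := 12 * (de m + de (m + 1)%N + de (m + 2)%N).
have g0 m : 0 <= g m by rewrite /g mulr_ge0// !addr_ge0.
have gD : \sum_(0 <= m < A) g m <= 36 * D.
  rewrite -mulr_sumr !big_split/=; have := sh 1%N; have := sh 2%N; rewrite -/D.
  move: (\sum_(0 <= i < A) de (i + 1)%N) (\sum_(0 <= i < A) de (i + 2)%N) => a b; lra.
have pt n : edge_size j k n ^+ 2 <= (2 ^ k < n %% 2 ^ k + 2 ^ j.+1)%N%:R * g (n %/ 2 ^ k)%N.
  rewrite /edge_size; case: ifP => _; last by rewrite expr0n mul0r.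
  rewrite mul1r; apply: (le_trans (sqr_sum3_le _ _ _)) => //.
  have e b : ((n + b * 2 ^ k) %/ 2 ^ k = n %/ 2 ^ k + b)%N by rewrite addnC divnMDl// addnC.
  rewrite !real_normK ?num_real// !deE (e 2) /g -(e 1%N) mul1n.
  exact: lexx.
have cnt m : \sum_(m * 2 ^ k <= n < m.+1 * 2 ^ k) ((2 ^ k < n %% 2 ^ k + 2 ^ j.+1)%N%:R : R) <= (2 ^ j.+1)%:R.
  apply: (le_trans (@count_interval _ _ _ _ (m.+1 * 2 ^ k - 2 ^ j.+1) (m.+1 * 2 ^ k) _)).
    move=> n nr h; have /andP[h1 h2] := nr; rewrite h2 andbT.
    have := divn_eq n (2 ^ k); rewrite (block_div nr); move: h h1 h2; rewrite mulSn.
    move: (n %% 2 ^ k)%N (2 ^ j.+1)%N (m * 2 ^ k)%N (2 ^ k)%N => r e u v; clear; lia.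
  by rewrite ler_nat; clear; lia.
apply: (@le_trans _ _ ((2 ^ s)%:R * \sum_(0 <= m < A) (2 ^ j.+1)%:R * g m)).
  rewrite ler_wpM2l ?ler0n// /energy WE -sum_dyadic; apply: ler_sum => m _.
  apply: (le_trans (ler_sum _ (fun n _ => pt n))).
  rewrite big_nat (eq_bigr (fun n => (2 ^ k < n %% 2 ^ k + 2 ^ j.+1)%N%:R * g m)); last first.
    by move=> n /block_div ->.
  by rewrite -big_nat -mulr_suml ler_wpM2r.
rewrite -mulr_sumr eE; apply: (@le_trans _ _ ((2 ^ s)%:R * ((2 ^ j.+1)%:R * (36 * D)))).
  by rewrite ler_wpM2l ?ler0n// ler_wpM2l// ler0n.
rewrite /k expnD expnS !natrM; apply: eq_le; ring.
Qed.

Lemma up_dev_energy s M : (M.+1 < 2 ^ J)%N ->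
  (2 ^ s)%:R * \sum_(0 <= n < W) vari 2 M (up_dev s n) `^ 2 <= fracC 2 * (288 * energy f).
Proof.
move=> MJ.
apply: (@le_trans _ _ ((2 ^ s)%:R * \sum_(0 <= n < W) fracC 2 * \sum_(0 <= j < J)
    (if (j + s < J)%N then 4 * edge_size j (j + s) n ^+ 2 else 0))).
  by rewrite ler_wpM2l ?ler0n//; apply: ler_sum => n _; exact: up_dev_controls.
rewrite -mulr_sumr mulrCA ler_wpM2l ?fracC_ge0// exchange_big/= mulr_sumr.
apply: (@le_trans _ _ (\sum_(0 <= j < J) if (j + s < J)%N then 288 * energy (dd (j + s)) else 0)).
  apply: ler_sum => j _; case: ifPn => js; last by rewrite big1 ?mulr0.
  rewrite -mulr_sumr mulrCA; have := edge_energy js; rewrite /energy; lra.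
rewrite -big_mkcond/=; apply: (@le_trans _ _ (288 * \sum_(0 <= k < J) energy (dd k))); last first.
  exact: (ler_wpM2l (ler0n _ _) sum_energy_dd).
rewrite mulr_sumr big_mkcond/=.
apply: (@le_trans _ _ (\sum_(s <= k < J + s) if (k < J)%N then 288 * energy (dd k) else 0)).
  by rewrite sum_shift.
have e0 k : 0 <= 288 * energy (dd k) by exact: (mulr_ge0 (ler0n _ _) (energy_ge0 _)).
apply: (@le_trans _ _ (\sum_(0 <= k < J + s) if (k < J)%N then 288 * energy (dd k) else 0)).
  by apply: ler_sum_widen => // k; case: ifP.
rewrite (@sum_cat _ _ 0 J)// ?leq_addr// [X in _ + X]big_nat [X in _ + X]big1 ?addr0; last first.
  by move=> k /andP[h _]; rewrite ltnNge h.
by rewrite !big_nat; apply: ler_sum => k /andP[_ ->].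
Qed.

Definition down_dev t n N : R :=
  if (t < trunc_log 2 N.+1)%N then dev (trunc_log 2 N.+1 - t.+1) N n else 0.

(** Contains the [l] points preceding any point of [[n + m l, n + m.+1 l)], that is, the incomplete
    block on which a function of mean zero on blocks of length [l] may fail to cancel. *)
Definition win (g : nat -> R) l m n : R := \sum_(n + m * l - l <= i < n + (m + 2) * l) `|g i|.

Lemma win_ge0 g l m n : 0 <= win g l m n. Proof. exact: sumr_ge0. Qed.

Lemma win_energy g l m : (forall i, (W <= i)%N -> g i = 0) ->
  energy (win g l m) <= (3 * l)%:R ^+ 2 * energy g.
Proof.
move=> gW; have G0 i : 0 <= `|g i| ^+ 2 by exact: sqr_ge0.
apply: (@le_trans _ _ (\sum_(0 <= n < W) (3 * l)%:R *
    \sum_(0 <= i < W) (n + m * l - l <= i < n + (m + 2) * l)%N%:R * `|g i| ^+ 2)).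
  apply: ler_sum => n _; apply: (le_trans (@sqr_sum_nat_le R _ _ _ (3 * l) _ (fun i => normr_ge0 (g i)))).
    by rewrite mulnDl; clear; lia.
  apply: ler_wpM2l; first exact: ler0n.
  by apply: sum_window_supp => // i /gW ->; rewrite normr0 expr0n.
rewrite -mulr_sumr exchange_big/= expr2 -mulrA; apply: ler_wpM2l; first exact: ler0n.
rewrite /energy mulr_sumr; apply: ler_sum => i _.
rewrite -mulr_suml real_normK ?num_real//; apply: ler_wpM2r; first exact: sqr_ge0.
apply: (le_trans (@count_interval _ _ _ _ (i.+1 - (m + 2) * l) (i.+1 + l - m * l) _)).
  by move=> n _; rewrite mulnDl; clear; lia.
by rewrite ler_nat mulnDl; clear; lia.
Qed.

Lemma dd_mean0 k m : \sum_(m * 2 ^ k.+1 <= i < m.+1 * 2 ^ k.+1) dd k i = 0.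
Proof.
have e1 : (m * 2 ^ k.+1 = 2 * m * 2 ^ k)%N by rewrite expnS; clear; lia.
have e2 : (m.+1 * 2 ^ k.+1 = (2 * m).+2 * 2 ^ k)%N by rewrite expnS; clear; lia.
rewrite e1 e2 (@sum_cat _ _ _ ((2 * m).+1 * 2 ^ k)); try (rewrite leq_mul2r; lia).
have part b : \sum_(b * 2 ^ k <= i < b.+1 * 2 ^ k) dd k i = (2 ^ k)%:R * (dyav f k b - dyav f k.+1 (b %/ 2)).
  rewrite big_nat (eq_bigr (fun=> dyav f k b - dyav f k.+1 (b %/ 2))); last first.
    by move=> i /block_div ib; rewrite ddE ib.
  by rewrite -big_nat sum_const_nat_R mulSn addnK.
rewrite !part; have [-> ->] := half_double m; rewrite dyavS; by field.
Qed.

Lemma dd_prefix k x (l := (2 ^ k.+1)%N) :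
  `|\sum_(0 <= i < x) dd k i| <= \sum_(x - l <= i < x) `|dd k i|.
Proof.
have xE := divn_eq x l; have xl : (x %% l < l)%N by rewrite ltn_pmod ?expn_gt0.
rewrite (@sum_cat _ _ 0 (x %/ l * l) x)// ?leq_divM//.
rewrite -sum_dyadic big1 ?add0r => [|m _]; last exact: dd_mean0.
apply: (le_trans (ler_norm_sum _ _ _)); apply: ler_sum_widen => //.
by rewrite leq_subLR {1}xE addnC leq_add2r ltnW.
Qed.

Lemma dd_sum_le k n N m (l := (2 ^ k.+1)%N) : (m * l <= N.+1 < m.+1 * l)%N ->
  `|\sum_(n <= i < n + N.+1) dd k i| <= win (dd k) l 0 n + win (dd k) l m n.
Proof.
move=> /andP[mN Nm].
have -> : \sum_(n <= i < n + N.+1) dd k i =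
    \sum_(0 <= i < n + N.+1) dd k i - \sum_(0 <= i < n) dd k i.
  rewrite [X in _ = X - _](@sum_cat _ _ 0 n (n + N.+1))// ?leq_addr//; ring.
apply: (le_trans (ler_normB _ _)); rewrite addrC; apply: lerD.
  apply: (le_trans (dd_prefix _ _)); apply: ler_sum_widen => //; rewrite -/l; clear; lia.
apply: (le_trans (dd_prefix _ _)); apply: ler_sum_widen => //; rewrite -/l; clear -mN Nm; nia.
Qed.

(* The label of [N] records its dyadic scale [2^j] and the block of length [2^(j-t)] in
   which [N + 1] falls: [dd (j - t.+1)] has mean zero on blocks of that length, so only
   the two blocks at the ends of the interval of summation contribute. *)
Lemma down_dev_controls t n M : (M.+1 < 2 ^ J)%N ->
  vari 2 M (down_dev t n) `^ 2 <=
  fracC 2 * \sum_(0 <= j < J) \sum_(j * 2 ^ t.+1 <= b < j.+1 * 2 ^ t.+1)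
    (if (t < j)%N then ((win (dd (j - t.+1)) (2 ^ (j - t)) 0 n +
       win (dd (j - t.+1)) (2 ^ (j - t)) (b %% 2 ^ t.+1) n) / (2 ^ j)%:R) ^+ 2 else 0).
Proof.
move=> MJ; pose c N := trunc_log 2 N.+1.
have cb N : (2 ^ c N <= N.+1 < 2 ^ (c N).+1)%N by exact: trunc_log_bounds.
have cJ N : (N <= M)%N -> (c N < J)%N.
  move=> NM; rewrite -(ltn_exp2l _ _ (ltnSn 1)); case/andP: (cb N) => h _.
  by apply: leq_ltn_trans h _; apply: leq_ltn_trans MJ; rewrite ltnS.
pose T := (2 ^ t.+1)%N; have T0 : (0 < T)%N by rewrite expn_gt0.
pose sub N := (N.+1 %/ 2 ^ (c N - t))%N.
have subT N : (sub N < T)%N.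
  rewrite /sub ltn_divLR ?expn_gt0// -expnD; case/andP: (cb N) => _ h.
  by apply: (leq_trans h); rewrite leq_pexp2l//; clear; lia.
pose lb N := (c N * T + sub N)%N.
have lbd N : (lb N %/ T = c N)%N by rewrite /lb divnMDl// divn_small ?addn0.
have lbm N : (lb N %% T = sub N)%N by rewrite /lb modnMDl modn_small.
pose S N := if (t < c N)%N then \sum_(n <= i < n + N.+1) dd (c N - t.+1) i else 0.
pose h b := if (t < b %/ T)%N then win (dd (b %/ T - t.+1)) (2 ^ (b %/ T - t)) 0 n +
       win (dd (b %/ T - t.+1)) (2 ^ (b %/ T - t)) (b %% T) n else 0.
pose d b : R := (2 ^ (b %/ T))%:R.
have h0 b : 0 <= h b by rewrite /h; case: ifP => // _; rewrite addr_ge0 ?win_ge0.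
have d0 b : 0 < d b by exact: expn2_R.
have SE N : down_dev t n N = S N / N.+1%:R.
  rewrite /down_dev /S -/(c N); case: ifP => tc; last by rewrite mul0r.
  rewrite /dev /av -/(c N) ifF ?subr0 ?addnS//; apply/negP; clear -tc; lia.
have ctS j : (t < j)%N -> (j - t = (j - t.+1).+1)%N by clear; lia.
have subb N : (sub N * 2 ^ (c N - t) <= N.+1 < (sub N).+1 * 2 ^ (c N - t))%N.
  by rewrite leq_divM ltn_ceil ?expn_gt0.
have [|||om [om1 om2]] := @frac_controls R 2 (ler1n _ 2) 0 M S lb h d h0 d0.
- move=> N N' _ NN' _; have := leq_trunc_log 2 (ltac:(by rewrite ltnS) : (N.+1 <= N'.+1)%N).
  rewrite -/(c N) -/(c N') leq_eqVlt => /predU1P[cc|cc].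
    by rewrite /lb /sub cc leq_add2l leq_div2r.
  have := subT N; rewrite /lb => h1.
  apply: (@leq_trans ((c N).+1 * T)%N); first by rewrite mulSn addnC leq_add2r ltnW.
  by apply: (@leq_trans (c N' * T)%N); rewrite ?leq_mul2r ?cc ?orbT// leq_addr.
- move=> N _; have /andP[b1 b2] := cb N; rewrite /h /d /S lbd lbm; split; last by rewrite ler_nat.
  case: ifPn => tc; last by rewrite normr0.
  by rewrite (ctS _ tc); apply: dd_sum_le; rewrite -ctS.
- move=> N N' _ NN' _ ll; have cc : c N = c N' by rewrite -lbd ll lbd.
  have ss : sub N = sub N' by rewrite -lbm ll lbm.
  have /andP[b1 _] := cb N; have /andP[_ b2] := cb N'; rewrite -cc in b2.
  have len : (N' - N <= 2 ^ c N)%N by move: b2; rewrite expnS; clear -b1; lia.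
  rewrite /h /d lbd lbm; split; last by rewrite ler_nat.
  have cm m : (N <= m <= N')%N -> c m = c N.
    move=> /andP[Nm mN']; apply/eqP; rewrite eqn_leq; apply/andP; split; last exact: leq_trunc_log.
    by rewrite cc; apply: leq_trunc_log.
  case: ifPn => tc; last first.
    rewrite big_nat big1// => m /andP[Nm mN'].
    rewrite /S !cm ?(negPf tc) ?subrr ?normr0// ?Nm ?(ltnW mN')// ?mN' ?andbT.
    exact: leqW.
  rewrite -[leLHS]add0r; apply: lerD; first exact: win_ge0.
  apply: (@le_trans _ _ (\sum_(n + N.+1 <= i < n + N'.+1) `|dd (c N - t.+1) i|)).
    rewrite -![(n + _.+1)%N]addSnnS ![(n.+1 + _)%N]addnC.
    have -> : \sum_(N + n.+1 <= i < N' + n.+1) `|dd (c N - t.+1) i| =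
        \sum_(N <= m < N') `|dd (c N - t.+1) (m + n.+1)%N|.
      by rewrite big_addn addnK.
    rewrite big_nat [leRHS]big_nat; apply: ler_sum => m /andP[Nm mN'].
    rewrite /S !cm ?Nm ?(ltnW mN')// ?mN' ?andbT//; last exact: leqW.
    rewrite tc.
    have e1 : (n <= n + m.+1)%N by exact: leq_addr.
    have e2 : (n + m.+1 <= n + m.+2)%N by rewrite leq_add2l.
    rewrite [X in `|X - _|](sum_cat _ e1 e2) addrAC subrr add0r [(n + m.+2)%N]addnS big_nat1.
    by rewrite -addSnnS addnC.
  have /andP[s1 _] := subb N; have /andP[_ s2] := subb N'; rewrite -ss -cc in s2.
  apply: ler_sum_widen => //; clear -s1 s2; move: s1 s2.
    by move: (sub N) (2 ^ (c N - t))%N => u v; lia.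
  by move: (sub N) (2 ^ (c N - t))%N => u v; lia.
have ctrl : controls 2 M (down_dev t n) om.
  by move=> N N' /andP[NN' N'M]; rewrite !SE; exact: om1.
apply: (le_trans (vari_controls (ler1n _ 2) (lexx 2) ctrl)).
have /andP[om00 _] := om2 0%N ltac:(by []).
have /andP[_ omM] := om2 M ltac:(by rewrite leqnn).
apply: (@le_trans _ _ (om M)); first by rewrite gerBl.
apply: (le_trans omM); apply: ler_wpM2l; first exact: fracC_ge0.
have P0 b : 0 <= (h b / d b) `^ 2 by exact: powR_ge0.
have lM : (lb M < J * T)%N.
  apply: (@leq_trans ((c M).+1 * T)%N); last by rewrite leq_mul2r cJ ?orbT.
  by rewrite /lb mulSn addnC ltn_add2r.
apply: (le_trans (ler_sum_widen P0 (leqnn 0) lM)).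
rewrite -sum_dyadic; apply: ler_sum => j _; rewrite big_nat [leRHS]big_nat; apply: ler_sum => b /block_div bj.
rewrite powR_mulrn ?(divr_ge0 (h0 b) (ltW (d0 b)))// /h /d bj.
by case: ifP => // _; rewrite mul0r expr0n.
Qed.

Lemma sqr_add_div_le (x y c : R) : 0 < c ->
  ((x + y) / c) ^+ 2 <= 2 / c ^+ 2 * (x ^+ 2 + y ^+ 2).
Proof.
move=> c0; have c2 : 0 <= (c ^+ 2)^-1 by rewrite invr_ge0 exprn_ge0// ltW.
rewrite exprMn exprVn -[leRHS]mulrA [X in _ <= _ * X]mulrC mulrA; apply: (ler_wpM2r c2).
have := sqr_ge0 (x - y); nra.
Qed.

(** A window of length at most [3 l], with [l = 2 ^ (j - t)], divided by [2 ^ j], makes each label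
    contribute [36 * 4 ^ (- t)] times the energy of the martingale difference. There are only
    [2 ^ t.+1] labels of scale [j], so the total is [72 * 2 ^ (- t)], rounded up to match
    [up_dev_energy]. *)
Lemma down_dev_energy t M : (M.+1 < 2 ^ J)%N ->
  (2 ^ t)%:R * \sum_(0 <= n < W) vari 2 M (down_dev t n) `^ 2 <= fracC 2 * (288 * energy f).
Proof.
move=> MJ; set Z := fun j b n => if (t < j)%N then ((win (dd (j - t.+1)) (2 ^ (j - t)) 0 n +
  win (dd (j - t.+1)) (2 ^ (j - t)) (b %% 2 ^ t.+1) n) / (2 ^ j)%:R) ^+ 2 else 0.
pose e j := if (t < j)%N then energy (dd (j - t.+1)) else 0.
have e0 j : 0 <= e j by rewrite /e; case: ifP => // _; exact: energy_ge0.
have Zn j b : (j < J)%N -> (2 ^ t)%:R ^+ 2 * \sum_(0 <= n < W) Z j b n <= 36 * e j.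
  move=> jJ; rewrite /Z /e; case: ifPn => tj; last by rewrite big1 ?mulr0.
  set k := (j - t.+1)%N; set l := (2 ^ (j - t))%N.
  have kJ : (k < J)%N by apply: leq_ltn_trans jJ; exact: leq_subr.
  have dW i : (W <= i)%N -> dd k i = 0 by exact: dd_supp.
  have E m : energy (win (dd k) l m) <= (3 * l)%:R ^+ 2 * energy (dd k) by exact: win_energy.
  have lt : (2 ^ t)%:R * l%:R = (2 ^ j)%:R :> R.
    by rewrite -natrM /l -expnD subnKC// ltnW.
  have pj : 0 < (2 ^ j)%:R :> R by exact: expn2_R.
  have pt : 0 < (2 ^ t)%:R :> R by exact: expn2_R.
  have S : \sum_(0 <= n < W) ((win (dd k) l 0 n + win (dd k) l (b %% 2 ^ t.+1) n) / (2 ^ j)%:R) ^+ 2 <=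
      2 / (2 ^ j)%:R ^+ 2 * (energy (win (dd k) l 0) + energy (win (dd k) l (b %% 2 ^ t.+1))).
    by rewrite /energy -big_split/= mulr_sumr; apply: ler_sum => n _; exact: sqr_add_div_le.
  have c0 : 0 <= 2 / (2 ^ j)%:R ^+ 2 :> R by rewrite divr_ge0// exprn_ge0// ltW.
  have S2 := le_trans S (ler_wpM2l c0 (lerD (E 0%N) (E (b %% 2 ^ t.+1)%N))).
  have p2 : 0 <= (2 ^ t)%:R ^+ 2 :> R by rewrite exprn_ge0// ltW.
  apply: (le_trans (ler_wpM2l p2 S2)); rewrite -lt natrM; apply: eq_le.
  have l0 : l%:R != 0 :> R by rewrite gt_eqF// expn2_R.
  by field; rewrite l0 gt_eqF.
apply: (@le_trans _ _ ((2 ^ t)%:R * \sum_(0 <= n < W) fracC 2 *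
    \sum_(0 <= j < J) \sum_(j * 2 ^ t.+1 <= b < j.+1 * 2 ^ t.+1) Z j b n)).
  by rewrite ler_wpM2l ?ler0n//; apply: ler_sum => n _; exact: down_dev_controls.
rewrite -mulr_sumr mulrCA; apply: ler_wpM2l; first exact: fracC_ge0.
rewrite exchange_big/= mulr_sumr.
apply: (@le_trans _ _ (\sum_(0 <= j < J) 72 * e j)).
  rewrite big_nat [leRHS]big_nat; apply: ler_sum => j /andP[_ jJ].
  have pt : 0 < (2 ^ t)%:R :> R by exact: expn2_R.
  rewrite exchange_big/= -(ler_pM2l pt) mulrA -expr2 mulr_sumr.
  apply: (@le_trans _ _ (\sum_(j * 2 ^ t.+1 <= b < j.+1 * 2 ^ t.+1) 36 * e j)).
    by apply: ler_sum => b _; exact: Zn.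
  rewrite sum_const_nat_R mulSn addnK expnS natrM; apply: eq_le; ring.
have eS : \sum_(0 <= j < J) e j <= energy f.
  apply: le_trans sum_energy_dd.
  have [tJ|Jt] := leqP t.+1 J; last first.
    rewrite big_nat big1 ?sumr_ge0// => [k _|j /andP[_ jJ]]; first exact: energy_ge0.
    by rewrite /e ifF//; clear -Jt jJ; lia.
  rewrite (@sum_cat _ _ 0 t.+1 J)// [X in X + _]big_nat [X in X + _]big1 ?add0r; last first.
    by move=> j /andP[_ jt]; rewrite /e ltnNge -ltnS jt.
  have -> : \sum_(t.+1 <= j < J) e j = \sum_(0 <= k < J - t.+1) energy (dd k).
    have := @big_addn R 0 +%R 0 J t.+1 xpredT e; rewrite add0n => ->.
    by apply: eq_bigr => k _; rewrite /e ifT ?addnK//; clear; lia.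
  have E0 k := energy_ge0 (dd k); exact: (ler_sum_widen E0 (leqnn 0) (leq_subr _ _)).
rewrite -mulr_sumr; apply: (le_trans (ler_wpM2l (ler0n _ _) eS)).
by apply: ler_wpM2r; [exact: energy_ge0|rewrite ler_nat].
Qed.

Lemma vari_sum (q : R) M (F : nat -> nat -> R) n : 1 <= q ->
  vari q M (fun N => \sum_(0 <= s < n) F s N) <= \sum_(0 <= s < n) vari q M (F s).
Proof.
move=> q1; elim: n => [|n IH].
  rewrite big_geq// vari_const// => N _; by rewrite !big_geq.
rewrite big_nat_recr//=; apply: le_trans (lerD IH (lexx _)).
apply: le_trans (variD _ _ _ q1); apply: eq_le; apply: eq_vari => N _.
by rewrite big_nat_recr.
Qed.

(** Inside the window the top average at level [J] is constant and cancels against its own average,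
    which leaves the martingale differences. *)
Lemma sum_dev n N : (n + N.+1 < W)%N ->
  av f n N - dyE f (trunc_log 2 N.+1) n =
  \sum_(0 <= s < J) up_dev s n N + \sum_(0 <= t < J) down_dev t n N.
Proof.
move=> nW; set j := trunc_log 2 N.+1.
have jJ : (j < J)%N.
  rewrite -(ltn_exp2l _ _ (ltnSn 1)); have /andP[h _] := trunc_log_bounds (ltnSn 1) (ltn0Sn N).
  by apply: leq_ltn_trans h _; apply: leq_ltn_trans nW; exact: leq_addl.
have -> : \sum_(0 <= s < J) up_dev s n N + \sum_(0 <= t < J) down_dev t n N =
    \sum_(0 <= k < J) dev k N n by rewrite [RHS](shifts_sum _ jJ).
have dyEJ i : (i < W)%N -> dyE f J i = dyE f J 0.
  by move=> iW; rewrite /dyE div0n divn_small.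
have avf : av f n N = \sum_(0 <= k < J) av (dd k) n N + dyE f J 0.
  rewrite /av -mulr_suml exchange_big/=.
  have -> : \sum_(n <= i < (n + N).+1) f i =
      \sum_(n <= i < (n + N).+1) (\sum_(0 <= k < J) dd k i + dyE f J 0).
    rewrite !big_nat; apply: eq_bigr => i /andP[_ iN]; rewrite -dyE0 (dyE_sum _ (leq0n J)) dyEJ//.
    by apply: leq_trans iN _; rewrite -addnS ltnW.
  rewrite big_split/= sum_const_nat_R -addnS addKn mulrDl; congr (_ + _).
  by rewrite mulrAC mulfV ?mul1r// pnatr_eq0.
rewrite avf (dyE_sum _ (ltnW jJ)) dyEJ; last exact: leq_ltn_trans (leq_addr _ _) nW.
have -> : \sum_(0 <= k < J) dev k N n = \sum_(0 <= k < J) av (dd k) n N -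
    \sum_(0 <= k < J) (if (j <= k)%N then dd k n else 0) by rewrite -sumrB.
have -> : \sum_(0 <= k < J) (if (j <= k)%N then dd k n else 0) = \sum_(j <= k < J) dd k n.
  rewrite (@sum_cat _ (fun k => if (j <= k)%N then dd k n else 0) 0 j J)// ?(ltnW jJ)//.
  rewrite big_nat [X in X + _]big1 ?add0r; last first.
    by move=> k /andP[_ kj]; rewrite leqNgt kj.
  by rewrite !big_nat; apply: eq_bigr => k /andP[-> _].
by ring.
Qed.

End SquareFunction.

Lemma sqr_powR (R : realType) (x : R) : 0 <= x -> x `^ 2 = x ^+ 2.
Proof. by move=> x0; rewrite powR_mulrn. Qed.

(** * The scalar unweighted weak type (2,2) *)

Section ScalarWeak.
Variable R : realType.

Definition squareC : R := (2 * geoC 2^-1) ^+ 2 * (fracC 2 * 288).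

Lemma half_geometric (N : nat -> R) (C : R) J : 0 <= C -> (forall s, 0 <= N s) ->
  (forall s, (2 ^ s)%:R * N s `^ 2 <= C) -> \sum_(0 <= s < J) N s <= geoC 2^-1 * C `^ 2^-1.
Proof.
move=> C0 N0 H; have h0 : 0 < (2^-1 : R) by rewrite invr_gt0.
have G := @geo_sum_down R 2^-1 1 J h0 ltr01.
rewrite powR1 mulr1 in G.
have CG := ler_wpM2r (powR_ge0 C 2^-1) G; apply: le_trans CG.
rewrite mulr_suml; apply: ler_sum => s _.
have p2 : 0 < (2 : R) ^+ s by rewrite exprn_gt0.
rewrite mul1r powRN; rewrite mulrC ler_pdivlMr ?powR_gt0//.
have -> : N s * (2 ^+ s) `^ 2^-1 = (2 ^+ s * N s `^ 2) `^ 2^-1.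
  by rewrite powRM// ?(ltW p2)// powRK// mulrC.
by apply: le_powR; rewrite ?(ltW h0) ?mulr_ge0 ?(ltW p2)//; have := H s; rewrite natrX.
Qed.

Lemma square_function (f : nat -> R) J L M : (forall i, (2 ^ J <= i)%N -> f i = 0) ->
  (forall n, (n < L)%N -> (n + M.+1 < 2 ^ J)%N) -> (M.+1 < 2 ^ J)%N -> (L <= 2 ^ J)%N ->
  \sum_(0 <= n < L) vari 2 M (fun N => av f n N - dyE f (trunc_log 2 N.+1) n) `^ 2 <=
  squareC * \sum_(0 <= n < 2 ^ J) f n ^+ 2.
Proof.
move=> fJ nJ MJ LJ; set S := \sum_(0 <= n < 2 ^ J) f n ^+ 2.
have S0 : 0 <= S by apply: sumr_ge0 => n _; exact: sqr_ge0.
have two1 : 1 <= (2 : R) by exact: ler1n.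
have two0 : (2 : R) != 0 by rewrite pnatr_eq0.
pose r := index_iota 0 L.
pose C : R := fracC 2 * (288 * S).
have C0 : 0 <= C.
  apply: mulr_ge0; first exact: fracC_ge0.
  exact: mulr_ge0 (ler0n _ _) S0.
pose up s := lnorm r 2 (fun n => vari 2 M (up_dev f J s n)).
pose dn t := lnorm r 2 (fun n => vari 2 M (down_dev f t n)).
have norm2 (V : nat -> R) : (forall n, 0 <= V n) ->
    lnorm r 2 V `^ 2 = \sum_(0 <= n < L) V n `^ 2.
  move=> V0; rewrite (lnorm_powR _ _ two0); apply: eq_bigr => n _.
  by rewrite ger0_norm.
have half (V : nat -> R) : (forall n, 0 <= V n) ->
    lnorm r 2 V `^ 2 <= \sum_(0 <= n < 2 ^ J) V n `^ 2.
  by move=> V0; rewrite norm2//; apply: ler_sum_widen.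
have upC s : (2 ^ s)%:R * up s `^ 2 <= C.
  apply: le_trans (up_dev_energy fJ s MJ); apply: ler_wpM2l; first exact: ler0n.
  by apply: half => n; exact: vari_ge0.
have dnC t : (2 ^ t)%:R * dn t `^ 2 <= C.
  apply: le_trans (down_dev_energy fJ t MJ); apply: ler_wpM2l; first exact: ler0n.
  by apply: half => n; exact: vari_ge0.
have sum_up := half_geometric J C0 (fun s => lnorm_ge0 _ _ _) upC.
have sum_dn := half_geometric J C0 (fun s => lnorm_ge0 _ _ _) dnC.
pose D n := vari 2 M (fun N => av f n N - dyE f (trunc_log 2 N.+1) n).
have DL : lnorm r 2 D <= \sum_(0 <= s < J) up s + \sum_(0 <= t < J) dn t.
  (* [lnorm_le] compares at all indices, but [sum_dev] is available only for [n < L]; hence the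
     extension by 0. *)
  have -> : lnorm r 2 D = lnorm r 2 (fun n => if (n < L)%N then D n else 0).
    congr (_ `^ _); rewrite !big_seq; apply: eq_bigr => n.
    by rewrite mem_index_iota => /andP[_ ->].
  apply: (@le_trans _ _ (lnorm r 2 (fun n => \sum_(0 <= s < J) vari 2 M (up_dev f J s n) +
      \sum_(0 <= t < J) vari 2 M (down_dev f t n)))).
    apply: lnorm_le => // n; case: ifPn => nL; last by rewrite normr0.
    rewrite ger0_norm ?vari_ge0// ger0_norm; last first.
      by rewrite addr_ge0// sumr_ge0// => i _; exact: vari_ge0.
    apply: le_trans (lerD (vari_sum _ _ _ two1) (vari_sum _ _ _ two1)).
    apply: le_trans (variD _ _ _ two1); apply: eq_le; apply: eq_vari => N NM.
    apply: sum_dev; apply: leq_ltn_trans (nJ n nL).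
    by rewrite leq_add2l ltnS.
  apply: (le_trans (lnormD _ _ _ two1)); apply: lerD; exact: lnorm_sum.
have h0 : 0 <= C `^ 2^-1 by exact: powR_ge0.
have Dle : lnorm r 2 D <= 2 * geoC 2^-1 * C `^ 2^-1.
  apply: (le_trans DL); apply: (le_trans (lerD sum_up sum_dn)).
  by apply: eq_le; ring.
have -> : \sum_(0 <= n < L) D n `^ 2 = lnorm r 2 D `^ 2.
  by rewrite norm2// => n; exact: vari_ge0.
have l0 : 0 <= lnorm r 2 D by exact: lnorm_ge0.
rewrite sqr_powR//; apply: (@le_trans _ _ ((2 * geoC 2^-1 * C `^ 2^-1) ^+ 2)).
  rewrite lerXn2r// nnegrE//; exact: le_trans Dle.
rewrite exprMn -[(C `^ _) ^+ 2]sqr_powR// powRVK// /squareC /C.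
by apply: eq_le; ring.
Qed.

Definition scalarC (q : R) : R := 4 * (dyadicC q + squareC).

Lemma lnorm_unit (p : R) (u : unit -> R) : p != 0 -> lnorm (index_enum unit) p u = `|u tt|.
Proof.
move=> p0; rewrite /lnorm (big_pred1 tt); last by case.
by rewrite powRK.
Qed.

Lemma scalar_weak2 (q rho : R) : 2 < q -> rho != 0 ->
  weakT q rho unit 2 (scalarC q) (fun=> 1).
Proof.
move=> q2 rho0 M L f lam2 fL lam20.
set lam := lam2 / 2; have lam0 : 0 < lam by rewrite divr_gt0.
have lamE : lam2 = 2 * lam by rewrite /lam; field.
clearbody lam; rewrite {lam2 lam20}lamE.
have two1 : 1 <= (2 : R) by exact: ler1n.
have q1 : 1 <= q by exact: ltW (le_lt_trans two1 q2).
(* The dyadic window [[0, 2 ^ J)] must contain every average of length at most [M.+1] starting below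
   [L]. *)
pose g := f tt; pose J := (L + M).+2.
have JJ : (J < 2 ^ J)%N by exact: ltn_expl.
have gJ i : (2 ^ J <= i)%N -> g i = 0.
  by move=> Ji; apply: fL; apply: leq_trans Ji; apply: leq_trans (ltnW JJ); rewrite /J; clear; lia.
have nJ n : (n < L)%N -> (n + M.+1 < 2 ^ J)%N.
  by move=> nL; apply: leq_ltn_trans JJ; rewrite /J; clear -nL; lia.
have MJ : (M.+1 < 2 ^ J)%N by apply: leq_ltn_trans JJ; rewrite /J; clear; lia.
have LJ : (L <= 2 ^ J)%N by apply: leq_trans (ltnW JJ); rewrite /J; clear; lia.
set S := \sum_(0 <= n < 2 ^ J) g n ^+ 2.
have SE : \sum_(0 <= n < L) vnm rho f n `^ 2 * 1 = S.
  rewrite /S (@sum_cat _ _ 0 L (2 ^ J))// [X in _ = _ + X]big_nat [X in _ = _ + X]big1 ?addr0.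
    by apply: eq_bigr => n _; rewrite mulr1 /vnm lnorm_unit// sqr_powR// real_normK// num_real.
  by move=> i /andP[Li _]; rewrite /g fL// expr0n.
rewrite SE.
pose c N := trunc_log 2 N.+1.
pose A n := vari q M (fun j => dyE g j n).
pose D n := vari 2 M (fun N => av g n N - dyE g (c N) n).
have VE n : VT q rho M f n <= A n + D n.
  rewrite /VT lnorm_unit// ger0_norm ?vari_ge0//.
  apply: (@le_trans _ _ (vari q M ((fun j => dyE g j n) \o c) +
    vari q M (fun N => av g n N - dyE g (c N) n))).
    apply: le_trans (variD _ _ _ q1); apply: eq_le; apply: eq_vari => N _ /=.
    by rewrite /g; ring.
  apply: lerD; last by apply: vari_exponent => //; exact: ltW.
  apply: vari_comp => // [i j ij|N NM]; first by apply: leq_trunc_log; rewrite ltnS.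
  have /andP[h _] := trunc_log_bounds (ltnSn 1) (ltn0Sn N).
  by apply: leq_trans NM; rewrite -ltnS; apply: leq_trans h; exact: ltn_expl.
have HA : lam ^+ 2 * \sum_(0 <= n < L | lam < A n) 1 <= dyadicC q * S.
  have MJ' : (M <= J)%N by rewrite /J; clear; lia.
  apply: le_trans (dyadic_weak q2 g lam0 MJ').
  rewrite ler_wpM2l ?exprn_ge0 ?(ltW lam0)// big_mkcond [leRHS]big_mkcond.
  by apply: ler_sum_widen => // i; case: ifP.
have HD : lam ^+ 2 * \sum_(0 <= n < L | lam < D n) 1 <= squareC * S.
  apply: le_trans (square_function gJ nJ MJ LJ); rewrite mulr_sumr big_mkcond.
  apply: ler_sum => n _; case: ifPn => [h|_]; last exact: powR_ge0.
  by rewrite mulr1 -(sqr_powR (ltW lam0)); apply: le_powR => //; exact: ltW.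
have cover : \sum_(0 <= n < L | 2 * lam < VT q rho M f n) (1 : R) <=
    \sum_(0 <= n < L | lam < A n) 1 + \sum_(0 <= n < L | lam < D n) 1.
  apply: (@ler_sum_predU _ (fun=> 1)) => // i _ h.
  exact: two_mul_lt_add (lt_le_trans h (VE i)).
have l2 : 0 <= 2 * lam by rewrite mulr_ge0// ltW.
rewrite (sqr_powR l2) exprMn -mulrA /scalarC -mulrA.
have -> : (2 : R) ^+ 2 = 4 by ring.
rewrite ler_pM2l//; apply: (@le_trans _ _ (lam ^+ 2 *
    (\sum_(0 <= n < L | lam < A n) 1 + \sum_(0 <= n < L | lam < D n) 1))).
  by apply: (ler_wpM2l _ cover); exact: sqr_ge0.
by rewrite mulrDr mulrDl; exact: lerD.
Qed.

Lemma dyadicC_ge0 (q : R) : 2 < q -> 0 <= dyadicC q.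
Proof.
move=> q2; have G : 0 <= geoC (q - 2) by apply: geoC_ge0; rewrite subr_gt0.
by rewrite /dyadicC addr_ge0// mulr_ge0.
Qed.

Lemma squareC_ge0 : 0 <= squareC.
Proof.
have F : 0 <= fracC (2 : R) by exact: fracC_ge0.
by rewrite /squareC; apply: mulr_ge0 (sqr_ge0 _) (mulr_ge0 F (ler0n _ _)).
Qed.

Lemma scalarC_ge0 (q : R) : 2 < q -> 0 <= scalarC q.
Proof. by move=> q2; rewrite /scalarC mulr_ge0// addr_ge0 ?dyadicC_ge0// squareC_ge0. Qed.

End ScalarWeak.

(** * Extrapolation *)

Section Extrapolation.
Variable R : realType.

Lemma czC_ge0 (tau s Cs C1 : R) : 1 < tau -> 0 <= Cs -> 0 <= C1 -> 0 <= czC tau s Cs C1.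
Proof.
move=> t1 Cs0 C10; have T0 := tailC_ge0 t1; have F0 : 0 <= fracC tau by exact: fracC_ge0.
have X0 : 0 <= fracC tau * (4 `^ tau * (2 `^ tau * tailC tau * C1)).
  by repeat (apply: mulr_ge0 => //).
have Y0 : 0 <= Cs * (2 `^ (s - 1) * (1 + 16 * C1)).
  apply: mulr_ge0 => //; apply: mulr_ge0 => //; lra.
rewrite /czC mulr_ge0//; lra.
Qed.

Lemma marcinkiewiczC_ge0 (p p0 p1 C0 C1 : R) : p0 < p -> p < p1 -> 0 <= C0 -> 0 <= C1 ->
  0 <= 4 `^ p * (C0 * geoC (p - p0) + C1 * geoC (p1 - p)).
Proof.
move=> h0 h1 C00 C10; have G0 : 0 <= geoC (p - p0) by rewrite geoC_ge0// subr_gt0.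
have G1 : 0 <= geoC (p1 - p) by rewrite geoC_ge0// subr_gt0.
by apply: mulr_ge0 => //; apply: addr_ge0; exact: mulr_ge0.
Qed.

Lemma A1_unweighted : A1 1 (fun=> 1 : R).
Proof. by move=> a n an; rewrite sum_const_nat_R mul1r. Qed.

Lemma exponent_between (m s : R) : 1 < m -> 1 <= s -> exists r, [/\ 1 < r, r < m & r * s < m * s].
Proof.
move=> m1 s1; exists ((1 + m) / 2); have h1 : 1 < (1 + m) / 2 by lra.
have h2 : (1 + m) / 2 < m by lra.
by split => //; rewrite ltr_pM2r// (lt_le_trans ltr01).
Qed.

(* From one unweighted weak type to all weighted strong types: Calderon-Zygmund and
   interpolation bring the exponent down to [r] close to 1, the good-lambda inequality
   gives weighted weak types on both sides of [p], and one interpolates again. *)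
Lemma strong_of_weak (q rho s0 C0 s p Cw : R) :
  1 < q -> 1 < rho -> 1 < s0 -> 0 <= C0 -> 1 <= s -> s < p -> 0 <= Cw ->
  exists2 C : R, 0 <= C & forall (K : finType) (w : nat -> R), (forall n, 0 < w n) ->
    weakT q rho K s0 C0 (fun=> 1) -> Bp s Cw w -> strongT q rho K p C w.
Proof.
move=> q1 rho1 s01 C00 s1 sp Cw0.
have sgt0 : 0 < s by exact: lt_le_trans s1.
pose tau := Num.min rho q.
have tau1 : 1 < tau by rewrite lt_min rho1.
have taurho : tau <= rho by rewrite ge_min lexx.
have tauq : tau <= q by rewrite ge_min lexx orbT.
(* [r] must be below [s0] to interpolate with exponent 1, below [p / s] to have [s r < p], and at
   most [tau] for [good_lambda]. *)
pose m := Num.min (Num.min s0 (p / s)) tau.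
have m1 : 1 < m by rewrite !lt_min s01 ltr_pdivlMr// mul1r sp -lt_min.
have [r [r1 rm rsm]] := exponent_between m1 s1.
have [ms0 mps mtau] : [/\ m <= s0, m <= p / s & m <= tau].
  by have := lexx m; rewrite {2}/m le_min le_min => /andP[/andP[]].
have rs0 : r < s0 by exact: lt_le_trans ms0.
have rtau : r <= tau by exact: ltW (lt_le_trans rm mtau).
have r0 : 0 < r by exact: lt_trans r1.
have rsp : s * r < p.
  by rewrite mulrC; apply: (lt_le_trans rsm); rewrite -ler_pdivlMr.
pose Cz := czC tau s0 C0 1.
have Cz0 : 0 <= Cz by exact: czC_ge0.
pose Cr := 4 `^ r * (Cz * geoC (r - 1) + C0 * geoC (s0 - r)).
have Cr0 : 0 <= Cr by exact: marcinkiewiczC_ge0.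
have rP0 : r <= s * r by rewrite ler_peMl// ltW.
have rP1 : r <= p + 1 by apply: (le_trans rP0); rewrite ltW// (lt_trans rsp)// ltrDl.
have rrho := le_trans rtau taurho; have rq := le_trans rtau tauq.
have [Ca Ca0 Ha] := good_lambda r1 rrho rq Cr0 rP0 Cw0.
have [Cb Cb0 Hb] := good_lambda r1 rrho rq Cr0 rP1 Cw0.
exists (4 `^ p * (Ca * geoC (p - s * r) + Cb * geoC (p + 1 - p))).
  by apply: marcinkiewiczC_ge0 => //; rewrite ltrDl.
move=> K w w0 W0 Bw.
have one0 (n : nat) : 0 <= (1 : R) by exact: ler01.
have W1 : weakT q rho K 1 Cz (fun=> 1).
  exact: cz_weakT tau1 taurho tauq (ltW s01) C00 ler01 one0 A1_unweighted W0.
have Wr : weakT q rho K r Cr (fun=> 1).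
  apply: strongT_weakT => //.
  by apply: (marcinkiewicz (ltW q1) (ltW rho1) ltr01 r1 rs0 Cz0 C00 one0 W1 W0).
have wge0 n : 0 <= w n by exact: ltW.
have Wa : weakT q rho K (s * r) Ca w by apply: Ha => //; rewrite mulfK// gt_eqF.
have Wb : weakT q rho K (p + 1) Cb w.
  apply: Hb => //; apply: Bp_exponent Bw => //.
  by rewrite ler_pdivlMr//; apply: ltW; apply: (lt_trans rsp); rewrite ltrDl.
apply: (marcinkiewicz (ltW q1) (ltW rho1) _ rsp _ Ca0 Cb0 wge0 Wa Wb).
  exact: mulr_gt0.
by rewrite ltrDl.
Qed.

Lemma scalar_strong (q p : R) : 2 < q -> 1 < p ->
  exists2 C : R, 0 <= C & strongT q 2 unit p C (fun=> 1).
Proof.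
move=> q2 p1; have q1 : 1 < q by apply: lt_trans q2; rewrite ltr1n.
have two1 : 1 < (2 : R) by rewrite ltr1n.
have one0 (n : nat) : 0 <= (1 : R) by exact: ler01.
have [C C0 H] := strong_of_weak q1 two1 two1 (scalarC_ge0 q2) (lexx 1) p1 ler01.
exists C => //; apply: H => //; first by apply: scalar_weak2 => //; rewrite pnatr_eq0.
exact: A1_Bp one0 ler01 A1_unweighted.
Qed.

(** At exponent [rho] the sums over [k] and [n] can be exchanged, so each component is estimated
    separately. *)
Lemma vector_strong (q rho C : R) (K : finType) : 1 <= rho ->
  strongT q 2 unit rho C (fun=> 1) -> strongT q rho K rho C (fun=> 1).
Proof.
move=> rho1 H M L f fL; have rho0 : rho != 0 by rewrite gt_eqF// (lt_le_trans _ rho1).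
have two0 : (2 : R) != 0 by rewrite pnatr_eq0.
have VE n : VT q rho M f n `^ rho = \sum_(k : K) vari q M (av (f k) n) `^ rho.
  apply: (etrans (lnorm_powR _ _ rho0)); apply: eq_bigr => k _.
  by rewrite (ger0_norm (vari_ge0 _ _ _)).
have UE k n : VT q 2 M (fun _ : unit => f k) n = vari q M (av (f k) n).
  exact: etrans (lnorm_unit _ two0) (ger0_norm (vari_ge0 _ _ _)).
have E1 : \sum_(0 <= n < L) VT q rho M f n `^ rho * 1 =
    \sum_(k : K) \sum_(0 <= n < L) VT q 2 M (fun _ : unit => f k) n `^ rho * 1.
  rewrite exchange_big; apply: eq_bigr => n _; apply: (etrans (mulr1 _)).
  apply: (etrans (VE n)); apply: eq_bigr => k _; rewrite UE; exact: esym (mulr1 _).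
have E2 : \sum_(0 <= n < L) vnm rho f n `^ rho * 1 =
    \sum_(k : K) \sum_(0 <= n < L) vnm 2 (fun _ : unit => f k) n `^ rho * 1.
  rewrite exchange_big; apply: eq_bigr => n _; apply: (etrans (mulr1 _)).
  apply: (etrans (lnorm_powR _ _ rho0)); apply: eq_bigr => k _.
  have -> : vnm 2 (fun _ : unit => f k) n = `|f k n| by exact: lnorm_unit _ two0.
  exact: esym (mulr1 _).
apply: (le_trans (eq_le E1)); apply: (le_trans _ (eq_le (congr1 (fun x => C * x) (esym E2)))).
apply: (le_trans _ (eq_le (esym (mulr_sumr _ _ _ _)))); apply: ler_sum => k _.
exact: (H M L (fun=> f k) (fun _ i Li => fL k i Li)).
Qed.

Lemma vector_weak (q rho : R) : 2 < q -> 1 < rho ->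
  exists2 C : R, 0 <= C & forall K : finType, weakT q rho K rho C (fun=> 1).
Proof.
move=> q2 rho1; have [C C0 H] := scalar_strong q2 rho1; exists C => // K.
apply: strongT_weakT; first exact: lt_trans rho1.
  by move=> n; exact: ler01.
exact: vector_strong (ltW rho1) H.
Qed.

Lemma nat_strong (q rho p Cw : R) : 2 < q -> 1 < rho -> 1 < p -> 0 <= Cw ->
  exists2 C : R, 0 <= C & forall (K : finType) (w : nat -> R), (forall n, 0 < w n) ->
    Ap p Cw w -> strongT q rho K p C w.
Proof.
move=> q2 rho1 p1 Cw0; have q1 : 1 < q by apply: lt_trans q2; rewrite ltr1n.
have [C0 C00 W] := vector_weak q2 rho1.
have [s [Cs [/andP[s1 sp] Cs0] As]] := Ap_open p1 Cw0.
have [C C0' H] := strong_of_weak q1 rho1 rho1 C00 (ltW s1) sp Cs0.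
exists C => // K w w0 Aw; apply: H => //; apply: Ap_Bp => //; exact: As.
Qed.

(** An [A1] weight satisfies [Bp 1], which yields a weighted strong bound at exponent [rho]; the
    Calderon-Zygmund decomposition uses it for the good part. *)
Lemma nat_weak (q rho C1 : R) : 2 < q -> 1 < rho -> 0 <= C1 ->
  exists2 C : R, 0 <= C & forall (K : finType) (w : nat -> R), (forall n, 0 < w n) ->
    A1 C1 w -> weakT q rho K 1 C w.
Proof.
move=> q2 rho1 C10; have q1 : 1 < q by apply: lt_trans q2; rewrite ltr1n.
have [C0 C00 W] := vector_weak q2 rho1.
have [Cs Cs0 H] := strong_of_weak q1 rho1 rho1 C00 (lexx 1) rho1 C10.
pose tau := Num.min rho q.
have tau1 : 1 < tau by rewrite lt_min rho1.
have taurho : tau <= rho by rewrite ge_min lexx.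
have tauq : tau <= q by rewrite ge_min lexx orbT.
exists (czC tau rho Cs C1); first exact: czC_ge0.
move=> K w w0 Aw; have wge0 n : 0 <= w n by exact: ltW.
apply: (cz_weakT tau1 taurho tauq (ltW rho1)) => //.
apply: strongT_weakT => //; first exact: lt_trans rho1.
by apply: H => //; exact: A1_Bp.
Qed.

End Extrapolation.

(** * Transfer to the integers *)

Section ComplexParts.
Variable R : realType.
Implicit Types (z : R[i]) (f : int -> R[i]) (b : bool).

Definition cpart b z : R := if b then complex.Re z else complex.Im z.

Lemma cpart_le b z : `|cpart b z| <= cabs z.
Proof.
case: z b => x y [] /=; rewrite -sqrtr_sqr; apply: ler_wsqrtr.
  by rewrite lerDl sqr_ge0.
by rewrite lerDr sqr_ge0.
Qed.

Lemma cabs_ge0 z : 0 <= cabs z.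
Proof. by case: z => x y; exact: sqrtr_ge0. Qed.

Lemma cabs_le_parts z : cabs z <= `|cpart true z| + `|cpart false z|.
Proof.
case: z => x y /=; rewrite -[leRHS]ger0_norm ?addr_ge0// -sqrtr_sqr; apply: ler_wsqrtr.
rewrite sqrrD !real_normK ?num_real// lerD2r lerDl.
by rewrite mulrn_wge0// mulr_ge0.
Qed.

Lemma cpartD b z z' : cpart b (z + z') = cpart b z + cpart b z'.
Proof. by case: z z' b => x y [x' y'] []. Qed.

Lemma cpartB b z z' : cpart b (z - z') = cpart b z - cpart b z'.
Proof. by case: z z' b => x y [x' y'] []. Qed.

Lemma cpart0 b : cpart b 0 = 0 :> R. Proof. by case: b. Qed.

Lemma cpart_sum b (F : nat -> R[i]) l n :
  cpart b (\sum_(l <= i < n) F i) = \sum_(l <= i < n) cpart b (F i).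
Proof. exact: (big_morph (cpart b) (cpartD b) (cpart0 b)). Qed.

Lemma cpart_avg b f (z0 : int) x N :
  cpart b (avg_plus f (z0 + x%:Z) N) = av (fun i => cpart b (f (z0 + i%:Z))) x N.
Proof.
have E : (N.+1%:R : R[i])^-1 = ((N.+1%:R)^-1 : R)%:C.
  by rewrite fmorphV rmorph_nat.
have M (c : R) z : cpart b (c%:C * z) = c * cpart b z.
  by case: z b => u v [] /=; rewrite mul0r ?subr0 ?addr0.
rewrite /avg_plus E M cpart_sum /av mulrC; congr (_ / _).
rewrite -[in RHS]addnS addnC sum_shift; apply: eq_bigr => i _.
by rewrite addnC PoszD addrA.
Qed.

Definition pvar q M b f (n : int) : R := vari q M (fun N => cpart b (avg_plus f n N)).

Definition cvar q M f (n : int) : R := pvar q M true f n + pvar q M false f n.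

Lemma vari_monotone q M M' (a : nat -> R) : 1 <= q -> (M <= M')%N -> vari q M a <= vari q M' a.
Proof.
move=> q1 MM; apply: vari_le_lnorm; rewrite ?vari_ge0// => m N Nm NM.
by apply: lnorm_le_vari => // i; exact: leq_trans (NM i) MM.
Qed.

Lemma cvar_ge0 q M f n : 0 <= cvar q M f n.
Proof. by rewrite addr_ge0// vari_ge0. Qed.

Lemma cvar_monotone q M M' f n : 1 <= q -> (M <= M')%N -> cvar q M f n <= cvar q M' f n.
Proof. by move=> q1 MM; apply: lerD; exact: vari_monotone. Qed.

Lemma var_avg_plus_le q f n u : 1 <= q -> (forall M, cvar q M f n <= u) ->
  (var_avg_plus q f n <= u%:E)%E.
Proof.
move=> q1 H; have q0 : 0 < q by exact: lt_le_trans q1.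
have u0 : 0 <= u by exact: le_trans (cvar_ge0 q 0 f n) (H 0%N).
apply: ge_ereal_sup => _ [N Nincr <-].
have Nh : {homo N : i j / (i <= j)%N}.
  by move=> i j; rewrite leq_eqVlt => /predU1P[->//|/Nincr/ltnW].
set a := avg_plus f n.
have part m : (\sum_(0 <= j < m) (cabs (a (N j) - a (N j.+1)) `^ q)%:E <= (u `^ q)%:E)%E.
  rewrite sumEFin lee_fin; pose M := N m.
  (* The sequence is frozen after [m], because [vari] wants all indices at most [M]. *)
  pose N' j := N (minn j m).
  have N'h : {homo N' : i j / (i <= j)%N}.
    by move=> i j ij; apply: Nh; rewrite leq_min geq_minr (leq_trans (geq_minl _ _)).
  have N'M i : (N' i <= M)%N by apply: Nh; rewrite geq_minr.
  apply: (@le_trans _ _ (cvar q M f n `^ q)); last by apply: le_powR; rewrite ?(ltW q0)// ?cvar_ge0.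
  have step b := @lnorm_le_vari _ q M (fun N => cpart b (a N)) m N' q1 N'h N'M.
  have tri : lnorm (index_iota 0 m) q (fun j => cabs (a (N j) - a (N j.+1))) <= cvar q M f n.
    apply: le_trans (lerD (step true) (step false)).
    rewrite -[X in _ <= X + _]lnorm_abs -[X in _ <= _ + X]lnorm_abs.
    apply: le_trans (lnormD _ _ _ q1).
    have -> : lnorm (index_iota 0 m) q (fun j => cabs (a (N j) - a (N j.+1))) =
        lnorm (index_iota 0 m) q (fun j => cabs (a (N' j) - a (N' j.+1))).
      congr (_ `^ _); rewrite !big_nat; apply: eq_bigr => j /andP[_ jm].
      by rewrite /N' (minn_idPl (ltnW jm)) (minn_idPl jm).
    apply: (lnorm_le _ q0) => j.
    rewrite (ger0_norm (cabs_ge0 _)) (ger0_norm (addr_ge0 (normr_ge0 _) (normr_ge0 _))).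
    apply: (le_trans (cabs_le_parts _)); rewrite !cpartB.
    by apply: lerD; rewrite distrC.
  have l0 := lnorm_ge0 (index_iota 0 m) q (fun j => cabs (a (N j) - a (N j.+1))).
  have := le_powR (ltW q0) l0 tri; rewrite lnorm_powR ?gt_eqF//; apply: le_trans.
  by apply: ler_sum => j _; rewrite (ger0_norm (cabs_ge0 _)).
set S := (\sum_(0 <= j <oo) _)%E.
have t0 j : (0 <= (cabs (a (N j) - a (N j.+1)) `^ q)%:E)%E by rewrite lee_fin.
have S0 : (0 <= S)%E by apply: nneseries_ge0 => j _ _; exact: t0.
have Su : (S <= (u `^ q)%:E)%E.
  apply: lime_le; first by apply: is_cvg_nneseries => j _ _; exact: t0.
  by apply: nearW => m; exact: part.
apply: (@le_trans _ _ (((u `^ q)%:E) `^ q^-1)%E); last first.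
  by rewrite poweR_EFin powRK// gt_eqF.
apply: gt0_ler_poweR => //; first by rewrite invr_ge0 ltW.
- by rewrite in_itv/= S0 leey.
- by rewrite in_itv/= leey andbT lee_fin.
Qed.

End ComplexParts.

Section Windows.
Variable R : realType.

Lemma sum_in_window (H : int -> R) (F : seq int) (z0 : int) L : (forall n, 0 <= H n) -> uniq F ->
  (forall n, n \in F -> exists2 x, (x < L)%N & n = z0 + x%:Z) ->
  \sum_(n <- F) H n <= \sum_(0 <= x < L) H (z0 + x%:Z).
Proof.
move=> H0 uF HF; rewrite -(big_map (fun x : nat => z0 + x%:Z) xpredT H).
set s := [seq z0 + x%:Z | x <- index_iota 0 L].
have us : uniq s by rewrite map_inj_uniq ?iota_uniq// => x y /addrI [].
rewrite [leRHS](bigID (mem F))/=; apply: (@le_trans _ _ (\sum_(n <- s | n \in F) H n)); last first.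
  by rewrite lerDl; apply: sumr_ge0.
rewrite -[leRHS]big_filter; apply: eq_le; apply: perm_big; apply: uniq_perm => //.
  exact: filter_uniq.
move=> n; rewrite mem_filter; apply/idP/andP => [nF|[]//]; split => //.
have [x xL ->] := HF n nF; apply/mapP; exists x => //.
by rewrite mem_index_iota.
Qed.

Lemma seq_int_window (F : seq int) : exists z0 : int, exists L : nat,
  forall n, n \in F -> exists2 x, (x < L)%N & n = z0 + x%:Z.
Proof.
pose B := (\sum_(n <- F) `|n|)%N.
exists (- B%:Z), (2 * B).+1 => n nF.
have nB : (`|n| <= B)%N by rewrite /B (big_rem n)//= leq_addr.
exists (absz ((n : int) + B%:Z)); clear -nB; move: B nB => B; lia.
Qed.

Lemma esum_window_le (H : int -> R) (z0 : int) L : (forall n, 0 <= H n) ->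
  ((\sum_(0 <= x < L) H (z0 + x%:Z))%:E <= \esum_(n in [set: int]) (H n)%:E)%E.
Proof.
move=> H0; apply: esum_ge; set s := [seq z0 + x%:Z | x <- index_iota 0 L].
have us : uniq s by rewrite map_inj_uniq ?iota_uniq// => x y /addrI [].
exists [set` s]; first by split => //; exact: finite_seq.
rewrite -fsbig_seq// /s big_map sumEFin; exact: lexx.
Qed.

Lemma esum_le_seq (A : set int) (H : int -> \bar R) (B : \bar R) :
  (forall F : seq int, uniq F -> (forall n, n \in F -> A n) -> (\sum_(n <- F) H n <= B)%E) ->
  (\esum_(n in A) H n <= B)%E.
Proof.
move=> HF; apply: ge_ereal_sup => _ [F [finF FA] <-].
rewrite fsbig_finite//=; apply: HF; first exact: finmap.fset_uniq.
by move=> n; rewrite in_fset_set// inE; exact: FA.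
Qed.

Lemma sup_approx (A : nat -> R) (B theta : R) : (forall M, 0 <= A M <= B) ->
  theta < 1 -> exists M, theta * sup (range A) <= A M.
Proof.
move=> AB th1; have hs : has_sup (range A).
  by split; [exists (A 0%N), 0%N|exists B => _ [M _ <-]; case/andP: (AB M)].
have A0 : 0 <= A 0%N by case/andP: (AB 0%N).
have s0 : 0 <= sup (range A).
  by apply: (le_trans A0); apply: ub_le_sup; [case: hs|exists 0%N].
move: s0; rewrite le_eqVlt => /predU1P[<-|s0]; first by exists 0%N; rewrite mulr0.
have e0 : 0 < (1 - theta) * sup (range A) by rewrite mulr_gt0// subr_gt0.
have [_ [M _ <-] h] := sup_adherent e0 hs; exists M; apply: ltW.
by apply: le_lt_trans h; rewrite mulrBl mul1r opprB addrCA subrr addr0.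
Qed.

Lemma common_index (T : eqType) (s : seq T) (P : T -> nat -> Prop) :
  (forall t M M', (M <= M')%N -> P t M -> P t M') ->
  (forall t, t \in s -> exists M, P t M) -> exists M, forall t, t \in s -> P t M.
Proof.
move=> Pm; elim: s => [|t s IH] H; first by exists 0%N.
have [M1 h1] := H t (mem_head _ _).
have [|M2 h2] := IH; first by move=> t' ts; apply: H; rewrite inE ts orbT.
exists (maxn M1 M2) => t'; rewrite inE => /predU1P[->|/h2].
  exact: Pm (leq_maxl _ _) h1.
exact: Pm (leq_maxr _ _).
Qed.

Lemma le_of_scaled (p X B : R) : 0 < p -> 0 <= B ->
  (forall theta, 0 <= theta -> theta < 1 -> theta `^ p * X <= B) -> X <= B.
Proof.
move=> p0 B0 H; rewrite leNgt; apply/negP => BX.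
have X0 : 0 < X by exact: le_lt_trans BX.
pose c := (B + X) / (2 * X).
have c0 : 0 <= c by rewrite divr_ge0 ?addr_ge0 ?mulr_ge0// ltW.
have c1 : c < 1 by rewrite ltr_pdivrMr ?mulr_gt0// mul1r; lra.
have t1 : c `^ p^-1 < 1.
  have := @lt_powR R p^-1 c 1 ltac:(by rewrite invr_gt0) c0 c1.
  by rewrite powR1.
have := H _ (powR_ge0 c p^-1) t1; rewrite powRVK ?gt_eqF//.
have -> : c * X = (B + X) / 2 by rewrite /c; field; rewrite gt_eqF.
by rewrite leNgt => /negP; apply; lra.
Qed.

End Windows.

Section Samples.
Variables (R : realType) (q rho : R) (m : nat) (f : 'I_m -> int -> R[i]).
Hypotheses (q1 : 1 <= q) (rho1 : 1 <= rho).

Let rho0 : 0 < rho. Proof. exact: lt_le_trans rho1. Qed.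

(** Real and imaginary parts become separate components; doubling their number is free, as the
    constants are uniform in the index type. *)
Definition sample (z0 : int) L (kb : 'I_m * bool) (i : nat) : R :=
  if (i < L)%N then cpart kb.2 (f kb.1 (z0 + i%:Z)) else 0.

Definition fnorm (n : int) : R := \sum_(k < m) cabs (f k n) `^ rho.

Definition vnorm_upto M (n : int) : R := \sum_(k < m) cvar q M (f k) n `^ rho.

Lemma fnorm_ge0 n : 0 <= fnorm n. Proof. by apply: sumr_ge0 => k _; exact: powR_ge0. Qed.

Lemma vnorm_upto_ge0 M n : 0 <= vnorm_upto M n.
Proof. by apply: sumr_ge0 => k _; exact: powR_ge0. Qed.

Lemma vnorm_upto_monotone M M' n : (M <= M')%N -> vnorm_upto M n <= vnorm_upto M' n.
Proof.
move=> MM; apply: ler_sum => k _; apply: le_powR; rewrite ?(ltW rho0) ?cvar_ge0//.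
exact: cvar_monotone.
Qed.

Lemma sample_supp z0 L : supp_lt L (sample z0 L).
Proof. by move=> kb i Li; rewrite /sample ltnNge Li. Qed.

Lemma sum_pair_bool (F : 'I_m * bool -> R) :
  \sum_(kb : 'I_m * bool) F kb = \sum_(k < m) (F (k, true) + F (k, false)).
Proof.
have -> : \sum_kb F kb = \sum_kb F (kb.1, kb.2) by apply: eq_bigr => -[].
rewrite -(pair_bigA _ (fun k b => F (k, b))).
by apply: eq_bigr => k _; rewrite big_bool.
Qed.

(** For [x + M < L] no average of length at most [M.+1] from [x] sees the truncation. The [2 ^ rho]
    comes from adding real and imaginary parts. *)
Lemma vnorm_upto_le M z0 L x : (x + M < L)%N ->
  vnorm_upto M (z0 + x%:Z) <= 2 `^ rho * VT q rho M (sample z0 L) x `^ rho.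
Proof.
move=> xL.
have E k b : pvar q M b (f k) (z0 + x%:Z) = vari q M (av (sample z0 L (k, b)) x).
  apply: eq_vari => N NM; rewrite cpart_avg; apply: eq_av => i /andP[_ iN].
  by rewrite /sample/= ifT//; apply: leq_ltn_trans xL; apply: leq_trans iN _; rewrite leq_add2l.
have -> : VT q rho M (sample z0 L) x `^ rho =
    \sum_(kb : 'I_m * bool) vari q M (av (sample z0 L kb) x) `^ rho.
  have rhoN : rho != 0 by rewrite gt_eqF.
  apply: (etrans (lnorm_powR _ _ rhoN)); apply: eq_bigr => kb _.
  by rewrite (ger0_norm (vari_ge0 _ _ _)).
rewrite sum_pair_bool mulr_sumr; apply: ler_sum => k _.
rewrite /cvar !E; apply: powR_add_le; rewrite ?vari_ge0//; exact: ltW.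
Qed.

Lemma sample_norm_le z0 L x : (x < L)%N ->
  vnm rho (sample z0 L) x `^ rho <= 2 * fnorm (z0 + x%:Z).
Proof.
move=> xL; have rhoN : rho != 0 by rewrite gt_eqF.
apply: (le_trans (eq_le (lnorm_powR _ _ rhoN))).
rewrite sum_pair_bool mulr_sumr; apply: ler_sum => k _.
have P b : `|sample z0 L (k, b) x| `^ rho <= cabs (f k (z0 + x%:Z)) `^ rho.
  by rewrite /sample xL; apply: le_powR; rewrite ?(ltW rho0)// cpart_le.
by rewrite mulr_natl mulr2n; apply: lerD.
Qed.

Lemma powR_ratio (a x p : R) : 0 <= a -> 0 <= x -> (a `^ rho * x `^ rho) `^ (p / rho) = a `^ p * x `^ p.
Proof.
move=> a0 x0; have rp : rho * (p / rho) = p by field; rewrite gt_eqF.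
by rewrite powRM// -!powRrM rp.
Qed.

Lemma sample_norm_powR_le (p : R) z0 L x : 0 <= p -> (x < L)%N ->
  vnm rho (sample z0 L) x `^ p <= 2 `^ (p / rho) * fnorm (z0 + x%:Z) `^ (p / rho).
Proof.
move=> p0 xL; have pr : 0 <= p / rho by rewrite divr_ge0// ltW.
have H := le_powR pr (powR_ge0 _ _) (sample_norm_le z0 xL).
have E := powR_ratio p ler01 (vnm_ge0 rho (sample z0 L) x).
rewrite !powR1 !mul1r in E; rewrite -E; apply: (le_trans H).
by rewrite powRM; [exact: lexx|exact: ler0n|exact: fnorm_ge0].
Qed.

Section Weighted.
Variable w : int -> R.
Hypothesis w0 : forall n, 0 < w n.

Let wge0 n : 0 <= w n. Proof. exact: ltW. Qed.

Lemma window_strong (p C : R) (F : seq int) z0 L0 M : 0 <= p -> 0 <= C ->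
  strongT q rho ('I_m * bool)%type p C (fun i => w (z0 + i%:Z)) -> uniq F ->
  (forall n, n \in F -> exists2 x, (x < L0)%N & n = z0 + x%:Z) ->
  \sum_(n <- F) vnorm_upto M n `^ (p / rho) * w n <=
  C * (2 `^ p * 2 `^ (p / rho)) *
  \sum_(0 <= x < L0 + M) fnorm (z0 + x%:Z) `^ (p / rho) * w (z0 + x%:Z).
Proof.
move=> p0 C0 HT uF HF; have pr : 0 <= p / rho by rewrite divr_ge0// ltW.
set g := sample z0 (L0 + M).
have H0 n : 0 <= vnorm_upto M n `^ (p / rho) * w n by exact: mulr_ge0.
apply: (le_trans (sum_in_window H0 uF HF)).
have p2 : 0 <= (2 : R) `^ p by exact: powR_ge0.
apply: (@le_trans _ _ (2 `^ p * \sum_(0 <= x < L0 + M) VT q rho M g x `^ p * w (z0 + x%:Z))).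
  apply: (@le_trans _ _ (\sum_(0 <= x < L0) 2 `^ p * (VT q rho M g x `^ p * w (z0 + x%:Z)))).
    rewrite big_nat [leRHS]big_nat; apply: ler_sum => x /andP[_ xL].
    rewrite mulrA; apply: (ler_wpM2r (wge0 _)).
    have xL' : (x + M < L0 + M)%N by rewrite ltn_add2r.
    apply: (le_trans (le_powR pr (vnorm_upto_ge0 _ _) (vnorm_upto_le z0 xL'))).
    by apply: eq_le; apply: powR_ratio => //; exact: VT_ge0.
  rewrite -mulr_sumr; apply: (ler_wpM2l p2); apply: ler_sum_widen => //; last exact: leq_addr.
  by move=> i; exact: mulr_ge0.
have S := HT M (L0 + M)%N g (@sample_supp z0 (L0 + M)).
apply: (le_trans (ler_wpM2l p2 S)); rewrite mulrCA -!mulrA; apply: (ler_wpM2l C0); apply: (ler_wpM2l p2).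
rewrite mulr_sumr big_nat [leRHS]big_nat; apply: ler_sum => x /andP[_ xL].
rewrite mulrA; apply: (ler_wpM2r (wge0 _)); exact: sample_norm_powR_le.
Qed.

Lemma window_weak (C lam : R) (F : seq int) z0 L0 M : 0 <= C -> 0 < lam ->
  weakT q rho ('I_m * bool)%type 1 C (fun i => w (z0 + i%:Z)) -> uniq F ->
  (forall n, n \in F -> exists2 x, (x < L0)%N & n = z0 + x%:Z) ->
  (forall n, n \in F -> lam `^ rho < vnorm_upto M n) ->
  lam * \sum_(n <- F) w n <= 2 * (C * 2 `^ rho^-1) *
  \sum_(0 <= x < L0 + M) fnorm (z0 + x%:Z) `^ rho^-1 * w (z0 + x%:Z).
Proof.
move=> C0 lam0 HT uF HF Fl; set g := sample z0 (L0 + M).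
pose H n := if lam `^ rho < vnorm_upto M n then w n else 0.
have H0 n : 0 <= H n by rewrite /H; case: ifP.
have -> : \sum_(n <- F) w n = \sum_(n <- F) H n.
  by rewrite !big_seq; apply: eq_bigr => n /Fl h; rewrite /H h.
have l2 : 0 < lam / 2 by rewrite divr_gt0.
have S := HT M (L0 + M)%N g (lam / 2) (@sample_supp z0 (L0 + M)) l2.
rewrite (powRr1 (ltW l2)) in S.
have -> : lam = 2 * (lam / 2) by field.
rewrite -!mulrA ler_pM2l//.
apply: (@le_trans _ _ (lam / 2 * \sum_(0 <= n < L0 + M | lam / 2 < VT q rho M g n) w (z0 + n%:Z))).
  rewrite mulrA ler_pM2l//; apply: (le_trans (sum_in_window H0 uF HF)).
  rewrite [leRHS]big_mkcond; apply: (@le_trans _ _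
    (\sum_(0 <= x < L0) if lam / 2 < VT q rho M g x then w (z0 + x%:Z) else 0)).
    rewrite big_nat [leRHS]big_nat; apply: ler_sum => x /andP[_ xL].
    rewrite /H; case: ifPn => [h|_]; last by case: ifP.
    have xL' : (x + M < L0 + M)%N by rewrite ltn_add2r.
    rewrite ifT//; rewrite ltNge; apply/negP => V.
    have := lt_le_trans h (vnorm_upto_le z0 xL'); rewrite -powRM ?VT_ge0//.
    rewrite ltNge => /negP; apply; apply: le_powR; rewrite ?(ltW rho0) ?mulr_ge0 ?VT_ge0//.
    by rewrite -ler_pdivlMl// mulrC.
  apply: ler_sum_widen => //; last exact: leq_addr.
  by move=> i; case: ifP.
apply: (le_trans S); apply: (ler_wpM2l C0).
rewrite mulr_sumr big_nat [leRHS]big_nat; apply: ler_sum => x /andP[_ xL].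
rewrite mulrA; apply: (ler_wpM2r (wge0 _)).
by have := sample_norm_powR_le z0 ler01 xL; rewrite mul1r.
Qed.

Lemma poweR_le (x y : \bar R) (r : R) : 0 <= r -> (0 <= x)%E -> (x <= y)%E -> (x `^ r <= y `^ r)%E.
Proof.
move=> r0 x0 xy; apply: gt0_ler_poweR => //; rewrite in_itv/= leey andbT//.
exact: le_trans xy.
Qed.

Lemma var_avg_plus_ge0 k n : (0 <= var_avg_plus q (f k) n)%E.
Proof.
pose a := avg_plus (f k) n.
apply: (@le_trans _ _ ((\sum_(0 <= j <oo) (cabs (a j - a j.+1) `^ q)%:E) `^ q^-1)%E).
  exact: poweR_ge0.
by apply: ereal_sup_ubound; exists id.
Qed.

(* The variation up to time [M] may be replaced by [theta < 1] times its supremum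
   simultaneously at the finitely many points involved. *)
Lemma strong_limit (p B : R) (F : seq int) : 0 < p ->
  (forall M, \sum_(n <- F) vnorm_upto M n `^ (p / rho) * w n <= B) ->
  (\sum_(n <- F) (\sum_(k < m) var_avg_plus q (f k) n `^ rho) `^ (p / rho) * (w n)%:E <= B%:E)%E.
Proof.
move=> p0 HB; have pr : 0 <= p / rho by rewrite divr_ge0// ltW.
have H0 M n : 0 <= vnorm_upto M n `^ (p / rho) * w n by exact: mulr_ge0.
have B0 : 0 <= B by apply: le_trans (HB 0%N); apply: sumr_ge0.
pose A n k M := cvar q M (f k) n.
pose u n k := sup (range (A n k)).
have term M n : n \in F -> vnorm_upto M n `^ (p / rho) * w n <= B.
  move=> nF; apply: le_trans (HB M); rewrite (big_rem n)//= lerDl.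
  by apply: sumr_ge0.
have bnd n k M : n \in F -> 0 <= A n k M <= (B / w n) `^ p^-1.
  move=> nF; rewrite /A cvar_ge0/=; apply: (powR_le_inj p0); rewrite ?cvar_ge0 ?powR_ge0//.
  rewrite powRVK ?gt_eqF ?divr_ge0// ler_pdivlMr//; apply: le_trans (term M n nF).
  apply: (ler_wpM2r (wge0 n)).
  have E := powR_ratio p ler01 (cvar_ge0 q M (f k) n).
  rewrite !powR1 !mul1r in E; rewrite -E; apply: (le_powR pr (powR_ge0 _ _)).
  rewrite /vnorm_upto (bigD1 k)//= lerDl; apply: sumr_ge0 => j _; exact: powR_ge0.
have ub n k M : n \in F -> A n k M <= u n k.
  move=> nF; apply: ub_le_sup; last by exists M.
  by exists ((B / w n) `^ p^-1) => _ [M' _ <-]; case/andP: (bnd n k M' nF).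
have u0 n k : n \in F -> 0 <= u n k.
  by move=> nF; apply: le_trans (ub n k 0%N nF); exact: cvar_ge0.
apply: (@le_trans _ _ (\sum_(n <- F) (\sum_(k < m) u n k `^ rho) `^ (p / rho) * w n)%:E).
  rewrite -sumEFin big_seq [leRHS]big_seq; apply: lee_sum => n nF.
  rewrite EFinM; apply: lee_wpmul2r; first by rewrite lee_fin.
  rewrite -poweR_EFin; apply: poweR_le => //.
    by apply: sume_ge0 => k _; exact: poweR_ge0.
  rewrite -sumEFin; apply: lee_sum => k _; rewrite -poweR_EFin.
  apply: poweR_le; [exact: ltW|exact: var_avg_plus_ge0|].
  by apply: var_avg_plus_le => // M; exact: ub.
rewrite lee_fin; apply: (le_of_scaled p0 B0) => theta t0 t1.
have [M HM] : exists M, forall n, n \in F -> forall k, theta * u n k <= A n k M.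
  have [||M HM] := @common_index _ [seq (n, k) | n <- F, k <- enum 'I_m]
    (fun nk M => theta * u nk.1 nk.2 <= A nk.1 nk.2 M).
  - by move=> t M M' MM h; apply: (le_trans h); exact: cvar_monotone.
  - move=> t /allpairsP[[n k] /= [nF _ ->]] /=; apply: sup_approx t1 => M.
    exact: bnd.
  exists M => n nF k; apply: (HM (n, k)); apply/allpairsP; exists (n, k).
  by rewrite /= nF mem_enum.
apply: le_trans (HB M); rewrite mulr_sumr big_seq [leRHS]big_seq; apply: ler_sum => n nF.
rewrite mulrA; apply: (ler_wpM2r (wge0 n)).
have s0 : 0 <= \sum_(k < m) u n k `^ rho by apply: sumr_ge0 => k _; exact: powR_ge0.
have rp : rho * (p / rho) = p by field; rewrite gt_eqF.
have -> : theta `^ p = (theta `^ rho) `^ (p / rho) by rewrite -powRrM rp.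
rewrite -powRM ?powR_ge0//; apply: (le_powR pr); first by rewrite mulr_ge0 ?powR_ge0.
rewrite mulr_sumr; apply: ler_sum => k _; rewrite -powRM ?u0//.
by apply: le_powR; [exact: ltW|rewrite mulr_ge0 ?u0|exact: HM].
Qed.

End Weighted.
End Samples.

Section WeightTransfer.
Variables (R : realType) (w : int -> R).
Hypothesis w0 : weight w.

Let wge0 n : 0 <= w n. Proof. exact: ltW. Qed.

Lemma sum_reindex_int (a d l : nat) (z0 z1 : int) (g : int -> R) : z0 + a%:Z = z1 + d%:Z ->
  \sum_(a <= i < l + a) g (z0 + i%:Z) = \sum_(d <= i < l + d) g (z1 + i%:Z).
Proof.
move=> E; rewrite !sum_shift; apply: eq_bigr => i _.
by rewrite ![(i + _)%N]addnC !PoszD !addrA E.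
Qed.

Lemma A1_plus_window : A1_plus w -> exists2 C : R, 0 <= C &
  forall z0 : int, A1 C (fun i => w (z0 + i%:Z)).
Proof.
move=> [C HC]; exists `|C| => // z0 a n an.
have := HC (z0 + n%:Z) (n - a)%N.
have -> : \sum_(0 <= i < (n - a).+1) w (z0 + n%:Z - (n - a)%:Z + i%:Z) =
    \sum_(a <= i < n.+1) w (z0 + i%:Z).
  have := @sum_reindex_int a 0 (n - a).+1 z0 (z0 + n%:Z - (n - a)%:Z) w.
  rewrite addn0 addSn subnK// => -> //; clear -an; lia.
move=> h; apply: (le_trans h); rewrite subSn//.
set mn := \big[_/_]_(_ <= _ < _) _.
have mn0 : 0 <= mn.
  rewrite /mn; elim/big_rec: _ => [|i x _ x0]; first exact: wge0.
  by rewrite le_min x0 wge0.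
have mnw : mn <= w (z0 + n%:Z) by exact: bigmin_le_id.
apply: (@le_trans _ _ (`|C| * (n - a).+1%:R * mn)).
  by rewrite ler_wpM2r// ler_wpM2r// ler_norm.
by rewrite ler_wpM2l// mulr_ge0// ler0n.
Qed.

(** The definition uses windows of equal length meeting at one point. For [a <= y <= c], both are
    enlarged to [k + 1] points with [k = c - a], meeting at [y]; this is why [Ap] is normalized by
    the length of [[a, c]]. *)
Lemma Ap_plus_window p : 1 < p -> Ap_plus p w -> exists2 C : R, 0 <= C &
  forall z0 : int, Ap p C (fun i => w (z0 + i%:Z)).
Proof.
move=> p1 [C HC]; exists `|C| => // z0 a y c /andP[ay yc].
set k := (c - a)%N; pose z1 := z0 + y%:Z - k%:Z.
have kc : (c.+1 - a = k.+1)%N by rewrite subSn// (leq_trans ay).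
rewrite kc; have h : C * k.+1%:R `^ p <= `|C| * k.+1%:R `^ p by rewrite ler_wpM2r// ler_norm.
apply: le_trans h; apply: le_trans (HC z1 k).
pose v n := w n `^ (- (p - 1)^-1).
have v0 n : 0 <= v n by exact: powR_ge0.
have pp : 0 <= p - 1 by rewrite subr_ge0 ltW.
apply: ler_pM; [exact: sumr_ge0|exact: powR_ge0| |].
  pose d := (k - (y - a))%N.
  have -> : \sum_(a <= i < y.+1) w (z0 + i%:Z) = \sum_(d <= i < k.+1) w (z1 + i%:Z).
    have := @sum_reindex_int a d (y - a).+1 z0 z1 w.
    rewrite addSn subnK// (_ : (y - a).+1 + d = k.+1)%N => [->//|]; rewrite /z1 /d /k; clear -ay yc; lia.
  by apply: ler_sum_widen => // i; exact: wge0.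
apply: le_powR => //; first exact: sumr_ge0.
have -> : \sum_(y <= i < c.+1) w (z0 + i%:Z) `^ (- (p - 1)^-1) =
    \sum_(k <= i < (c - y).+1 + k) w (z1 + i%:Z) `^ (- (p - 1)^-1).
  have := @sum_reindex_int y k (c - y).+1 z0 z1 v.
  by rewrite addSn subnK// => -> //; rewrite /z1; clear; lia.
apply: ler_sum_widen => //; rewrite /k; clear -ay yc; lia.
Qed.

End WeightTransfer.

(** Contrapositive of [strong_limit] at a single point, with weight 1 and [p = rho]. *)
Lemma exists_vnorm_upto (R : realType) (q rho lam : R) (m : nat) (f : 'I_m -> int -> R[i]) (n : int) :
  1 <= q -> 1 <= rho ->
  ((lam `^ rho)%:E < \sum_(k < m) var_avg_plus q (f k) n `^ rho)%E ->
  exists M, lam `^ rho < vnorm_upto q rho f M n.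
Proof.
move=> q1 rho1 h; apply: contrapT => H.
have rho0 : 0 < rho by exact: lt_le_trans rho1.
have one0 (z : int) : 0 < (1 : R) by exact: ltr01.
have rr : rho / rho = 1 by rewrite divff// gt_eqF.
have := @strong_limit R q rho m f q1 rho1 (fun=> 1) one0 rho (lam `^ rho) [:: n] rho0.
rewrite big_seq1 rr mule1 poweRe1; last by apply: sume_ge0 => k _; exact: poweR_ge0.
rewrite leNgt h => P; suff : false by [].
apply: P => M; rewrite big_seq1 mulr1 powRr1 ?vnorm_upto_ge0// leNgt; apply/negP => h'.
by apply: H; exists M.
Qed.

Theorem theorem4p1 (R : realType) (q rho : R) (hq : 2 < q) (hrho : 1 < rho) :
  (forall (p : R) (w : int -> R), 1 < p -> weight w -> Ap_plus p w ->
    exists C : R, forall (m : nat) (f : 'I_m -> int -> R[i]),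
      (forall k, in_lp p w (f k)) ->
      (\esum_(n in [set: int])
          ((\sum_(k < m) var_avg_plus q (f k) n `^ rho) `^ (p / rho)
             * (w n)%:E)
       <= C%:E * \esum_(n in [set: int])
            ((\sum_(k < m) cabs (f k n) `^ rho) `^ (p / rho) * w n)%R%:E)%E)
  /\
  (forall w : int -> R, weight w -> A1_plus w ->
    exists C : R, forall (m : nat) (f : 'I_m -> int -> R[i]),
      (forall k, in_lp 1 w (f k)) ->
      forall lambda : R, 0 < lambda ->
      (wmeas w [set n : int |
          (lambda `^ rho)%:E < \sum_(k < m) var_avg_plus q (f k) n `^ rho]
       <= (C / lambda)%:E * \esum_(n in [set: int])
            ((\sum_(k < m) cabs (f k n) `^ rho) `^ (rho^-1) * w n)%R%:E)%E).
Proof.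
have q1 : 1 <= q by apply: ltW; apply: lt_trans hq; rewrite ltr1n.
have rho1 := ltW hrho.
split=> [p w p1 w0 Aw|w w0 Aw].
  have p0 : 0 < p by exact: lt_trans p1.
  have [Cw Cw0 Hw] := Ap_plus_window w0 p1 Aw.
  have [C0 C00 HC] := nat_strong hq hrho p1 Cw0.
  (* The 1 makes [C] positive, so that the bound is infinite when the sum on the right is. *)
  pose C := C0 * (2 `^ p * 2 `^ (p / rho)) + 1.
  have K0 : 0 <= C0 * (2 `^ p * 2 `^ (p / rho)) by rewrite !mulr_ge0.
  have Cgt0 : 0 < C by rewrite ltr_wpDl.
  exists C => m f _.
  pose H n := fnorm rho f n `^ (p / rho) * w n.
  have H0 n : 0 <= H n by rewrite mulr_ge0// ltW.
  have E0 : (0 <= \esum_(n in [set: int]) (H n)%:E)%E.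
    by apply: esum_ge0 => n _; rewrite lee_fin.
  rewrite -/(H _); apply: esum_le_seq => F uF _.
  have [Ey|Efin] := eqVneq (\esum_(n in [set: int]) (H n)%:E)%E +oo%E.
    by rewrite Ey gt0_muley ?lte_fin// leey.
  have EE : (\esum_(n in [set: int]) (H n)%:E = (fine (\esum_(n in [set: int]) (H n)%:E))%:E)%E.
    by rewrite fineK// ge0_fin_numE// ltey.
  rewrite EE -EFinM; apply: strong_limit => // M.
  have [z0 [L0 HF]] := seq_int_window F.
  have S := HC ('I_m * bool)%type (fun i => w (z0 + i%:Z)) (fun i => w0 _) (Hw z0).
  apply: (le_trans (window_strong f rho1 w0 M (ltW p0) C00 S uF HF)).
  have W : \sum_(0 <= x < L0 + M) H (z0 + x%:Z) <= fine (\esum_(n in [set: int]) (H n)%:E).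
    by rewrite -lee_fin -EE; exact: esum_window_le.
  apply: (le_trans (ler_wpM2l K0 W)); apply: ler_wpM2r; last by rewrite lerDl.
  exact: fine_ge0.
have [Cw Cw0 Hw] := A1_plus_window w0 Aw.
have [C0 C00 HC] := nat_weak hq hrho Cw0.
have K0 : 0 <= 2 * (C0 * 2 `^ rho^-1) by rewrite !mulr_ge0.
exists (2 * (C0 * 2 `^ rho^-1)) => m f _ lam lam0.
pose H n := fnorm rho f n `^ rho^-1 * w n.
have H0 n : 0 <= H n by rewrite mulr_ge0// ltW.
apply: esum_le_seq => F uF FA.
(* One [M] serves the finitely many points of [F], since [vnorm_upto] increases with [M]. *)
have [||M HM] := @common_index _ F (fun n M => lam `^ rho < vnorm_upto q rho f M n).
- by move=> n M M' MM h; apply: (lt_le_trans h); exact: vnorm_upto_monotone.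
- by move=> n /FA; exact: exists_vnorm_upto.
have [z0 [L0 HF]] := seq_int_window F.
have S := HC ('I_m * bool)%type (fun i => w (z0 + i%:Z)) (fun i => w0 _) (Hw z0).
have WW := window_weak rho1 w0 C00 lam0 S uF HF HM.
have W : ((\sum_(0 <= x < L0 + M) H (z0 + x%:Z))%:E <= \esum_(n in [set: int]) (H n)%:E)%E.
  exact: esum_window_le.
have Cl : 0 <= 2 * (C0 * 2 `^ rho^-1) / lam by rewrite divr_ge0// ltW.
apply: (le_trans _ (lee_wpmul2l _ W)); last by rewrite lee_fin.
rewrite sumEFin -EFinM lee_fin mulrAC ler_pdivlMr// mulrC; exact: WW.
Qed.
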